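(* Let $N\ge 2$ be an integer, $0<s<1<p<\infty$, $t\ge 0$, $m\ge 0$, and suppose that $$m\le p-1\ \text{ if } \frac{sp}{p-1}>1,\qquad m<sp\ \text{ if } \frac{sp}{p-1}\le 1.$$ Suppose moreover that $N>sp$ and $$t(N-sp)+m\bigl(N-(sp-p+1)\bigr)<N(p-1).$$ Then any nonnegative viscosity solution $u:\mathbb{R}^N\to[0,\infty)$ of $$(-\Delta_p)^s u\ \ge\ u^{t}\,|\nabla u|^{m}\quad\text{in } \mathbb{R}^N$$ is constant.
   Context: The fractional $p$-Laplacian is $$(-\Delta_p)^s u(x)=\mathrm{PV}\int_{\mathbb{R}^N}|u(x)-u(y)|^{p-2}(u(x)-u(y))\frac{dy}{|x-y|^{N+sp}}.$$ For $t=0$ (resp. $m=0$) the factor $u^t$ (resp. $|\nabla u|^m$) is understood as $1$. For an open set $D$ and $\phi\in C^2(D)$, put $N_\phi=\{x\in D:\nabla\phi(x)=0\}$, $d_\phi(x)=\mathrm{dist}(x,N_\phi)$, and let $$C^2_\eta(D)=\Bigl\{\phi\in C^2(D):\sup_{x\in D\setminus N_\phi}\Bigl[\frac{\min\{d_\phi(x),1\}^{\eta-1}}{|\nabla\phi(x)|}+\frac{|D^2\phi(x)|}{(d_\phi(x))^{\eta-2}}\Bigr]<\infty\Bigr\}.$$ Let $L^{p-1}_{sp}(\mathbb{R}^N)=\{w\in L^{p-1}_{\rm loc}(\mathbb{R}^N):\int_{\mathbb{R}^N}\frac{|w(z)|^{p-1}}{1+|z|^{N+sp}}dz<\infty\}$.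 Viscosity (super)solution: let $\Omega$ be a nonempty open set and $f$ a continuous function. A function $u:\mathbb{R}^N\to\mathbb{R}$ is a viscosity supersolution of $(-\Delta_p)^su=f(x,u,\nabla u)$ in $\Omega$, also called a viscosity solution of $(-\Delta_p)^su\ge f(x,u,\nabla u)$ in $\Omega$, if: (i) $u$ is lower semicontinuous in $\bar\Omega$; (ii) whenever $\varphi\in C^2(B_r(x_0))$ for some $B_r(x_0)\subset\Omega$ satisfies $\varphi(x_0)=u(x_0)$, $\varphi\le u$ in $B_r(x_0)$, and one of the following holds: (a) $p>\frac{2}{2-s}$ or $\nabla\varphi(x_0)\ne0$; (b) $p\le\frac{2}{2-s}$, $\nabla\varphi(x_0)=0$, $x_0$ is an isolated critical point of $\varphi$, and $\varphi\in C^2_\eta(B_r(x_0))$ for some $\eta>\frac{sp}{p-1}$; then $(-\Delta_p)^s\varphi_r(x_0)\ge f(x_0,\varphi(x_0),\nabla\varphi(x_0))$, where $\varphi_r=\varphi$ in $B_r(x_0)$ and $\varphi_r=u$ elsewhere; (iii) $u_-\in L^{p-1}_{sp}(\mathbb{R}^N)$, where $u_-$ is the negative part of $u$. *)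

(* Defs.v *)
From HB Require Import structures.
From mathcomp Require Import all_boot all_order all_algebra.
From mathcomp Require Import all_classical all_reals all_analysis.

Set Implicit Arguments.
Unset Strict Implicit.
Unset Printing Implicit Defensive.
Import Order.TTheory GRing.Theory Num.Theory.
Import numFieldNormedType.Exports.

Local Open Scope classical_set_scope.
Local Open Scope ring_scope.

(* R^N is the space 'rV[R]_N of row vectors. Its topology, its compact sets
   and its directional derivatives are the library's. The library norm on
   'rV[R]_N is the sup norm (same topology), so the Euclidean norm, which the
   mathematics below uses, is defined separately. *)
Section euclidean.
Context {R : realType} {N : nat}.
Implicit Types (x y : 'rV[R]_N) (A : set 'rV[R]_N).

Definition enorm x : R := Num.sqrt (\sum_(i < N) x 0 i ^+ 2).

Definition eball x (r : R) : set 'rV[R]_N := [set y | enorm (y - x) < r].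

(* Only meaningful for A nonempty: inf set0 = 0 in the library. *)
Definition dist_to x A : R := inf [set enorm (x - y) | y in A].

End euclidean.

(* Measurable sets of R^N: the product sigma-algebra of the Borel sets of R,
   i.e., the Borel sets of R^N. *)
Definition rV_display : measure_display. Proof. exact: default_measure_display. Qed.

Section measurable_rV.
Context {R : realType} (n : nat).

Definition rV_coord (i : 'I_n) (x : 'rV[R]_n) : measurableTypeR R := x 0 i.

Let rV_set0 : g_sigma_preimage rV_coord set0.
Proof. exact: sigma_algebra0. Qed.

Let rV_setC A : g_sigma_preimage rV_coord A -> g_sigma_preimage rV_coord (~` A).
Proof. exact: sigma_algebraC. Qed.

Let rV_bigcup (F : (set 'rV[R]_n)^nat) :
  (forall i, g_sigma_preimage rV_coord (F i)) ->
  g_sigma_preimage rV_coord (\bigcup_i (F i)).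
Proof. exact: sigma_algebra_bigcup. Qed.

HB.instance Definition _ := @isMeasurable.Build rV_display
  'rV[R]_n (g_sigma_preimage rV_coord) rV_set0 rV_setC rV_bigcup.

End measurable_rV.

Section measurable_rV_theory.
Context {R : realType}.

Lemma measurable_rV_coord n (i : 'I_n) :
  measurable_fun setT (@rV_coord R n i).
Proof.
move=> _ Y mY; rewrite setTI; apply: sub_sigma_algebra => /=.
rewrite -bigcup_seq/=; exists i => /=; first by rewrite mem_index_enum.
by exists Y => //; rewrite setTI.
Qed.

Lemma measurable_fun_rVP d (T : measurableType d) n (f : T -> 'rV[R]_n) :
  (forall i, measurable_fun setT (@rV_coord R n i \o f)) ->
  measurable_fun setT f.
Proof.
move=> mf.
suff H : g_sigma_preimage (fun i => @rV_coord R n i \o f) `<=` measurable.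
  move=> _ A mA; rewrite setTI; apply: H.
  by rewrite g_sigma_preimage_comp; exists A => //; rewrite setTI.
apply: smallest_sub; first exact: sigma_algebra_measurable.
move=> A; rewrite -bigcup_seq => -[i _ [B mB <-]]; exact: mf.
Qed.

Definition cons_rV n (ax : measurableTypeR R * 'rV[R]_n) : 'rV[R]_n.+1 :=
  @row_mx R 1 1 n (const_mx ax.1) ax.2.

Lemma measurable_cons_rV n : measurable_fun setT (@cons_rV n).
Proof.
apply: measurable_fun_rVP => i.
have [j ->|j ->] := @split_ordP 1 n i.
- rewrite (_ : _ \o _ = fst)//; apply/funext => -[a x].
  by apply: etrans; [exact: row_mxEl|rewrite mxE].
- rewrite (_ : _ \o _ = @rV_coord R n j \o snd); last first.
    by apply/funext => -[a x]; exact: row_mxEr.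
  by apply: measurableT_comp => //; exact: measurable_rV_coord.
Qed.

(* Lebesgue measure on R^n, as the iterated product of the Lebesgue measure
   on R. *)
Fixpoint lebesgue_rV (n : nat) : set 'rV[R]_n -> \bar R :=
  if n is n'.+1 then
    pushforward (@lebesgue_measure R \x @lebesgue_rV n')%E (@cons_rV n')
  else dirac (0 : 'rV[R]_0).

Definition uncons_rV n (x : 'rV[R]_n.+1) : measurableTypeR R * 'rV[R]_n :=
  (x 0 0, @rsubmx R 1 1 n x).

Lemma cons_rVK n : cancel (@cons_rV n) (@uncons_rV n).
Proof.
move=> [a x]; rewrite /uncons_rV /cons_rV /= row_mxKr; congr pair.
rewrite (_ : 0 = lshift n (0 : 'I_1)); last exact/val_inj.
by apply: etrans; [exact: row_mxEl|rewrite mxE].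
Qed.

Lemma measurable_uncons_rV n : measurable_fun setT (@uncons_rV n).
Proof.
apply/measurable_fun_pairP; split; first exact: measurable_rV_coord.
apply: measurable_fun_rVP => i.
rewrite (_ : _ \o _ = @rV_coord R n.+1 (rshift 1 i)); last first.
  by apply/funext => x; rewrite /= /rV_coord mxE.
exact: measurable_rV_coord.
Qed.

End measurable_rV_theory.

Section lebesgue_rV_step.
Context {R : realType} (n : nat).
Variable m : {sigma_finite_measure set 'rV[R]_n -> \bar R}.

Let P : {measure set _ -> \bar R} := (@lebesgue_measure R \x m)%E.

Definition lebesgue_rV_step : set 'rV[R]_n.+1 -> \bar R :=
  pushforward P (@cons_rV R n).

Let preimage_cons A : measurable A -> measurable (@cons_rV R n @^-1` A).
Proof. by move=> mA; rewrite -[X in measurable X]setTI; exact: measurable_cons_rV. Qed.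

Let step0 : lebesgue_rV_step set0 = 0%E.
Proof. by rewrite /lebesgue_rV_step /pushforward preimage_set0 measure0. Qed.

Let step_ge0 A : (0 <= lebesgue_rV_step A)%E.
Proof. by rewrite /lebesgue_rV_step /pushforward measure_ge0. Qed.

Let step_sigma_additive : semi_sigma_additive lebesgue_rV_step.
Proof.
move=> F mF tF mUF; rewrite /lebesgue_rV_step /pushforward preimage_bigcup.
apply: measure_semi_sigma_additive.
- by move=> k; exact: preimage_cons.
- apply/trivIsetP => /= i j _ _ ij; rewrite -preimage_setI.
  by move/trivIsetP : tF => /(_ _ _ _ _ ij) ->//; rewrite preimage_set0.
- by rewrite -preimage_bigcup; exact: preimage_cons.
Qed.

HB.instance Definition _ := isMeasure.Build _ _ _ lebesgue_rV_step
  step0 step_ge0 step_sigma_additive.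

Let step_sigma_finite : sigma_finite setT lebesgue_rV_step.
Proof.
have /sigma_finiteP[F [FT ndF Foo]] := sigma_finiteT (@lebesgue_measure R).
have /sigma_finiteP[G [GT ndG Goo]] := sigma_finiteT m.
exists (fun k => @uncons_rV R n @^-1` (F k `*` G k)).
  rewrite -preimage_bigcup (_ : \bigcup_k _ = setT) ?preimage_setT//.
  apply/seteqP; split=> // -[a x] _.
  have [i _ Fia] : (\bigcup_i F i) a by rewrite -FT.
  have [j _ Gjx] : (\bigcup_i G i) x by rewrite -GT.
  exists (maxn i j) => //; split => /=.
  - by move: a Fia; exact/subsetPset/ndF/leq_maxl.
  - by move: x Gjx; exact/subsetPset/ndG/leq_maxr.
move=> k; have [mFk Fkoo] := Foo k; have [mGk Gkoo] := Goo k; split.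
  rewrite -[X in measurable X]setTI.
  by apply: measurable_uncons_rV => //; exact: measurableX.
rewrite /lebesgue_rV_step /pushforward (_ : _ @^-1` _ = F k `*` G k).
  by rewrite /P/= product_measure1E// lte_mul_pinfty// ge0_fin_numE.
by rewrite -comp_preimage (_ : _ \o _ = id)//; apply/funext/cons_rVK.
Qed.

HB.instance Definition _ := Measure_isSigmaFinite.Build _ _ _
  lebesgue_rV_step step_sigma_finite.

End lebesgue_rV_step.

Lemma lebesgue_rV_sigma_finite_measure (R : realType) n :
  exists m : {sigma_finite_measure set 'rV[R]_n -> \bar R},
    @lebesgue_rV R n = m.
Proof.
elim: n => [|n [m mE]]; first by exists (dirac (0 : 'rV[R]_0)).
by exists (lebesgue_rV_step m); rewrite /= mE.
Qed.

Section lebesgue_rV_measure.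
Context {R : realType} (n : nat).
Local Notation mu := (@lebesgue_rV R n).

Let mu0 : mu set0 = 0%E.
Proof.
have [m ->] := @lebesgue_rV_sigma_finite_measure R n; exact: measure0.
Qed.

Let mu_ge0 A : (0 <= mu A)%E.
Proof.
have [m ->] := @lebesgue_rV_sigma_finite_measure R n; exact: measure_ge0.
Qed.

Let mu_sigma_additive : semi_sigma_additive mu.
Proof.
have [m ->] := @lebesgue_rV_sigma_finite_measure R n.
exact: measure_semi_sigma_additive.
Qed.

HB.instance Definition _ := isMeasure.Build _ _ _ mu
  mu0 mu_ge0 mu_sigma_additive.

Let mu_sigma_finite : sigma_finite setT mu.
Proof.
have [m ->] := @lebesgue_rV_sigma_finite_measure R n; exact: sigma_finiteT.
Qed.

HB.instance Definition _ := Measure_isSigmaFinite.Build _ _ _ mu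
  mu_sigma_finite.

End lebesgue_rV_measure.

Lemma lebesgue_rV_box (R : realType) n (A : 'I_n -> set (measurableTypeR R)) :
  (forall i, measurable (A i)) ->
  lebesgue_rV [set x | forall i, A i (x 0 i)] =
  (\prod_(i < n) lebesgue_measure (A i))%E.
Proof.
elim: n A => [|n IH] A mA.
  by rewrite big_ord0 /= diracE mem_set// => -[].
rewrite big_ord_recl -IH//.
have [m mE] := @lebesgue_rV_sigma_finite_measure R n.
pose B : set 'rV[R]_n := [set x | forall i, A (lift ord0 i) (x 0 i)].
have mB : measurable B.
  rewrite (_ : B = \big[setI/setT]_(i < n) (rV_coord i @^-1` A (lift ord0 i))).
    apply: bigsetI_measurable => i _; rewrite -[X in measurable X]setTI.
    exact: measurable_rV_coord.
  apply/seteqP; split=> x; rewrite -bigcap_seq.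
    by move=> Bx i _; exact: Bx.
  by move=> Bx i; apply: Bx; rewrite /= mem_index_enum.
have cl a (x : 'rV[R]_n) : cons_rV (a, x) 0 ord0 = a.
  rewrite (_ : ord0 = lshift n (0 : 'I_1)); last exact/val_inj.
  by apply: etrans; [exact: row_mxEl|rewrite mxE].
have cr a (x : 'rV[R]_n) i : cons_rV (a, x) 0 (lift ord0 i) = x 0 i.
  rewrite (_ : lift ord0 i = rshift 1 i); last exact/val_inj.
  exact: row_mxEr.
rewrite /= mE /pushforward -[RHS](product_measure1E _ _ _ mB)//; congr (_ _).
apply/seteqP; split=> -[a x] /=.
  by move=> H; split=> [|i]; [rewrite -(cl a x)|rewrite -(cr a x)]; exact: H.
by move=> [Aa Ax] i; case: (unliftP ord0 i) => [j|] ->; rewrite ?cl ?cr.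
Qed.

Section differential.
Context {R : realType} {N : nat}.
Implicit Types (phi : 'rV[R]_N -> R) (D : set 'rV[R]_N) (x : 'rV[R]_N).

Definition partial (i : 'I_N) phi : 'rV[R]_N -> R := 'D_(delta_mx 0 i) phi.

Definition gradient phi x : 'rV[R]_N := \row_i partial i phi x.

Definition hessian phi x : 'M[R]_N :=
  \matrix_(i, j) partial j (partial i phi) x.

Definition frobenius (A : 'M[R]_N) : R :=
  Num.sqrt (\sum_(i < N) \sum_(j < N) A i j ^+ 2).

(* phi \in C^2(D), for D open: the partial derivatives of order at most 2
   exist and are continuous on D. Nothing is required of phi outside D. *)
Definition C2 D phi := forall x, D x ->
  [/\ {for x, continuous phi},
      forall i, derivable phi x (delta_mx 0 i) /\
                {for x, continuous (partial i phi)} &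
      forall i j, derivable (partial i phi) x (delta_mx 0 j) /\
                  {for x, continuous (partial j (partial i phi))}].

Definition critical_set D phi := [set x | D x /\ gradient phi x = 0].

(* The class C^2_eta(D); it is only used for phi having a critical point in
   D, so that the distance to the critical set is a genuine one. *)
Definition C2_eta (eta : R) D phi :=
  let Z := critical_set D phi in
  C2 D phi /\
  has_ubound [set (Num.min (dist_to x Z) 1) `^ (eta - 1) / enorm (gradient phi x)
                  + frobenius (hessian phi x) / (dist_to x Z) `^ (eta - 2)
             | x in D `\` Z].

Definition isolated_critical_point phi x :=
  gradient phi x = 0 /\ \forall y \near x^', gradient phi y != 0.

End differential.

Section fractional_p_laplacian.
Context {R : realType} {N : nat}.
Variables (s p : R).
Implicit Types (u w : 'rV[R]_N -> R) (x y z : 'rV[R]_N).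
Local Notation mu := (@lebesgue_rV R N).

(* The integral is extended-real valued: if u grows too fast at infinity, it is
   -oo, and then no lower bound on the operator holds. For p < 2
   the first factor is a negative power of 0 where u x = u y: it is 0 in the
   library, so the integrand vanishes there, as it should. *)
Definition frac_plaplacian_trunc u x (e : R) : \bar R :=
  (\int[mu]_(y in ~` eball x e)
     (`|u x - u y| `^ (p - 2) * (u x - u y)
      / enorm (x - y) `^ (N%:R + s * p))%:E)%E.

(* l is the principal value (-Delta_p)^s u(x), possibly infinite. *)
Definition is_frac_plaplacian u x (l : \bar R) :=
  frac_plaplacian_trunc u x e @[e --> 0^'+] --> l.

Definition Lsp w :=
  [/\ measurable_fun setT w,
      forall K : set 'rV[R]_N, compact K ->
        mu.-integrable K (fun z => (`|w z| `^ (p - 1))%:E) &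
      mu.-integrable setT
        (fun z => (`|w z| `^ (p - 1) / (1 + enorm z `^ (N%:R + s * p)))%:E)].

Definition admissible_test (x0 : 'rV[R]_N) (r : R) (phi : 'rV[R]_N -> R) :=
  (p > 2 / (2 - s) \/ gradient phi x0 != 0) \/
  [/\ p <= 2 / (2 - s), isolated_critical_point phi x0 &
      exists2 eta, eta > s * p / (p - 1) & C2_eta eta (eball x0 r) phi].

(* Viscosity solutions of (-Delta_p)^s u >= f(x, u, grad u) in Omega, for Omega
   nonempty and open and f continuous. The principal value is required to
   exist in the extended reals. [patch u B phi] is phi on B and u elsewhere. *)
Definition viscosity_supersolution (Omega : set 'rV[R]_N)
    (f : 'rV[R]_N -> R -> 'rV[R]_N -> R) u :=
  [/\ lower_semicontinuous
        ((fun x => (u x)%:E) : subspace (closure Omega) -> \bar R),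
      forall (x0 : 'rV[R]_N) (r : R) (phi : 'rV[R]_N -> R),
        0 < r -> eball x0 r `<=` Omega ->
        C2 (eball x0 r) phi ->
        phi x0 = u x0 -> (forall x, eball x0 r x -> phi x <= u x) ->
        admissible_test x0 r phi ->
        exists2 l, is_frac_plaplacian (patch u (eball x0 r) phi) x0 l &
                   ((f x0 (phi x0) (gradient phi x0))%:E <= l)%E &
      Lsp (fun z => Num.max (- u z) 0)].

End fractional_p_laplacian.

(* Main.v *)
(* Subtracting inf u keeps the inequality, so assume inf u = 0; only test
   functions G(|x - x1|^2) with nonzero gradient at the contact point x0 are
   needed. For the kernel with profile |y|^tau, a fractional inversion in the
   sphere |y| = |x0 - x1| exchanges the outer contribution, where the test
   function is smaller, with a weighted inner one, which gives an upper bound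
   for its operator at x0 without computing a principal value. Taking
   tau = - gam < 0 with gam slightly above (N - sp)/(p - 1), for which the
   bound is negative, and touching a positive u from below by
   A |x - x1|^(-gam) - d is impossible, so u >= c |x - x1|^(-gam) at infinity.
   Since inf u = 0, u is then touched from below by some
   a exp(- sigma |x - x1|^kap) with small kap > 0 at an x0 far away. There
   u^t |grad|^m is too large compared with the bound on the operator: this is
   where gam (t + m - p + 1) < sp - m, i.e., the subcriticality, enters. *)
Require Import Defs.
From mathcomp Require Import all_boot all_order all_algebra.
From mathcomp Require Import all_classical all_reals all_analysis.
From mathcomp Require Import measurable_realfun ring lra.
Import Order.TTheory GRing.Theory Num.Theory.
Import numFieldNormedType.Exports.
Local Open Scope classical_set_scope.
Local Open Scope ring_scope.

Set Implicit Arguments.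
Unset Strict Implicit.
Unset Printing Implicit Defensive.

(** * Lebesgue measure and Euclidean geometry on R^N *)

(** The integrand of the operator need not be absolutely integrable at the contact point, so every
    estimate is made on truncated integrals, uniformly in the truncation. After inversion, outer
    minus inner part is, up to small errors, the integral over |y| > 1 of (1 - |y|^beta) times the
    kernel, with beta = sp - N - tau (p - 1). The first factor vanishes on the unit sphere, which
    leaves at most C |e - y|^(p - sp - N), integrable near e because s < 1; it is negative exactly
    when beta > 0, i.e., gam > (N - sp)/(p - 1) for tau = - gam. The inversion itself rests on
    scaling, reflections and Tonelli only.

    The profile is exponential because the decay rate of v is unknown. It decays faster than any
    power, so the polynomial lower bound on v produces a contact point; there its logarithmic slope
    is X kap / r with X = ln (a / v), at most logarithmic in r. Since exp z >= 1 + z, its increments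
    are bounded by those of v X (|y| / r)^kap, which brings back the power kernel, now with tau =
    kap. *)

Section lebesgue_affine.
Context {R : realType}.

Lemma lebesgue_measure_affine (c a : R) (A : set (measurableTypeR R)) :
  0 < c -> measurable A ->
  lebesgue_measure A =
  (c%:E * lebesgue_measure ((fun x : measurableTypeR R => c * x + a)%R @^-1` A))%E.
Proof.
move=> c0 mA.
have mf : measurable_fun [set: measurableTypeR R]
    (fun x : measurableTypeR R => c * x + a : measurableTypeR R).
  apply: (@measurable_funD _ (measurableTypeR R) R setT (fun x => c * x)
    (cst a)); last exact: measurable_cst.
  apply: (@measurable_funM _ (measurableTypeR R) R setT (cst c) id);
    [exact: measurable_cst|exact: measurable_id].
pose nu : {measure set (measurableTypeR R) -> \bar R} :=
  mscale (NngNum (ltW c0)) (pushforward (@lebesgue_measure R) (fun x : measurableTypeR R => c * x + a : measurableTypeR R)).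
rewrite -[RHS]/(nu mf A); apply: (@lebesgue_measure_unique R (nu mf)) => // _ [[x y]] _ <-.
rewrite /nu /= /mscale /= /pushforward.
rewrite (_ : _ @^-1` _ = [set` `](x - a) / c, (y - a) / c]]); last first.
  apply/seteqP; split => z; rewrite /= !in_itv /= ltr_pdivrMr// ler_pdivlMr//;
  rewrite ltrBlDr lerBrDr (mulrC z) //.
have := @lebesgue_measure_itv R `]x, y].
have := @lebesgue_measure_itv R `](x - a) / c, (y - a) / c].
move=> /= -> ->; rewrite !lte_fin ltr_pM2r ?invr_gt0// ltrD2r.
case: ifPn => _; last by rewrite mule0.
rewrite -!EFinD -EFinM; congr EFin; field.
by rewrite gt_eqF.
Qed.

Definition rV_box n (A : 'I_n -> set (measurableTypeR R)) : set 'rV[R]_n :=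
  [set x | forall i, A i (x 0 i)].

Lemma lebesgue_rV_boxE n (A : 'I_n -> set (measurableTypeR R)) :
  (forall i, measurable (A i)) ->
  lebesgue_rV (rV_box A) = (\prod_(i < n) lebesgue_measure (A i))%E.
Proof. exact: lebesgue_rV_box. Qed.

Lemma measurable_rV_box n (A : 'I_n -> set (measurableTypeR R)) :
  (forall i, measurable (A i)) -> measurable (rV_box A).
Proof.
move=> mA.
rewrite (_ : rV_box A = \big[setI/setT]_(i < n) (rV_coord i @^-1` A i)).
  apply: bigsetI_measurable => i _; rewrite -[X in measurable X]setTI.
  exact: measurable_rV_coord.
apply/seteqP; split=> x; rewrite -bigcap_seq.
  by move=> Bx i _; exact: Bx.
by move=> Bx i; apply: Bx; rewrite /= mem_index_enum.
Qed.

Lemma measurable_fun_coord d (T : measurableType d) n (f : T -> 'rV[R]_n) i :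
  measurable_fun setT f -> measurable_fun setT (fun x => f x 0 i).
Proof. by move=> mf; apply: (measurableT_comp (@measurable_rV_coord R n i)). Qed.

Lemma measurable_fun_rV d (T : measurableType d) n (f : T -> 'rV[R]_n) :
  (forall i, measurable_fun setT (fun x => f x 0 i)) -> measurable_fun setT f.
Proof. by move=> H; apply: measurable_fun_rVP => i; exact: H. Qed.

Lemma measurable_fun_addV d (T : measurableType d) n (f g : T -> 'rV[R]_n) :
  measurable_fun setT f -> measurable_fun setT g ->
  measurable_fun setT (fun x => f x + g x).
Proof.
move=> mf mg; apply: measurable_fun_rV => i; under eq_fun do rewrite mxE.
by apply: measurable_funD; exact: measurable_fun_coord.
Qed.

Lemma measurable_fun_scaleV d (T : measurableType d) n (c : T -> R)
    (f : T -> 'rV[R]_n) :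
  measurable_fun setT c -> measurable_fun setT f ->
  measurable_fun setT (fun x => c x *: f x).
Proof.
move=> mc mf; apply: measurable_fun_rV => i; under eq_fun do rewrite mxE.
by apply: measurable_funM => //; exact: measurable_fun_coord.
Qed.

Lemma measurable_fun_oppV d (T : measurableType d) n (f : T -> 'rV[R]_n) :
  measurable_fun setT f -> measurable_fun setT (fun x => - f x).
Proof.
move=> mf; apply: measurable_fun_rV => i; under eq_fun do rewrite mxE.
by apply: measurable_funN; exact: measurable_fun_coord.
Qed.

Lemma measurable_fun_subV d (T : measurableType d) n (f g : T -> 'rV[R]_n) :
  measurable_fun setT f -> measurable_fun setT g ->
  measurable_fun setT (fun x => f x - g x).
Proof.
by move=> mf mg; apply: measurable_fun_addV => //; exact: measurable_fun_oppV.
Qed.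

Lemma measurable_fun_enorm d (T : measurableType d) n (f : T -> 'rV[R]_n) :
  measurable_fun setT f -> measurable_fun setT (fun x => enorm (f x)).
Proof.
move=> mf; apply: (measurableT_comp (f := @Num.sqrt R)).
  by apply: continuous_measurable_fun; exact: sqrt_continuous.
apply: measurable_sum => i; apply: measurable_funX.
exact: measurable_fun_coord.
Qed.

(** By uniqueness of measures: both sides agree on boxes with measurable sides, by the
    one-dimensional case in each coordinate. These boxes are stable under intersection, generate the
    sigma-algebra, and the cubes [-k, k]^n exhaust the space with finite measure. *)
Lemma lebesgue_rV_affine n (c : R) (v : 'rV[R]_n) (A : set 'rV[R]_n) :
  0 < c -> measurable A ->
  lebesgue_rV A =
  ((c ^+ n)%:E * lebesgue_rV ((fun x => c *: x + v)%R @^-1` A))%E.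
Proof.
move=> c0 mA.
have mf : measurable_fun [set: 'rV[R]_n] (fun x : 'rV[R]_n => c *: x + v).
  apply: measurable_fun_addV; last exact: measurable_cst.
  by apply: measurable_fun_scaleV; [exact: measurable_cst|exact: measurable_id].
pose nu : {measure set 'rV[R]_n -> \bar R} :=
  mscale (NngNum (exprn_ge0 n (ltW c0))) (pushforward (@lebesgue_rV R n)
    (fun x : 'rV[R]_n => c *: x + v : 'rV[R]_n)).
rewrite -[RHS]/(nu mf A).
pose G := [set @rV_box n B | B in [set B | forall i, measurable (B i)]].
apply: (@measure_unique _ R 'rV[R]_n G
  (fun k => rV_box (fun=> `[- k%:R, k%:R]%classic))) => //.
- apply/seteqP; split.
  + apply: smallest_sub; first exact: smallest_sigma_algebra.
    move=> B; rewrite -bigcup_seq => -[i _ [C mC <-]].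
    apply: sub_sigma_algebra; exists (fun j => if j == i then C else setT).
      by move=> j /=; case: ifP.
    apply/seteqP; split => x /=.
      by move=> /(_ i); rewrite eqxx.
    by move=> [_ Cx] j; case: ifPn => // /eqP ->.
  + apply: smallest_sub; first exact: sigma_algebra_measurable.
    by move=> _ [B mB <-]; exact: measurable_rV_box.
- move=> _ _ [B mB <-] [C mC <-]; exists (fun i => B i `&` C i).
    by move=> i; apply: measurableI.
  apply/seteqP; split => x /=; first by move=> H; split=> i; have [] := H i.
  by move=> [H1 H2] i; split.
- by move=> k; exists (fun=> `[- k%:R, k%:R]%classic) => // i.
- apply/seteqP; split=> // x _.
  exists (\max_(i < n) (Num.truncn `|x 0%R i|%R).+1)%N => // i /=.
  rewrite in_itv /= -ler_norml (le_trans (ltW (truncnS_gt _)))//.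
  by rewrite ler_nat (leq_bigmax i).
- move=> _ [B mB <-]; rewrite /nu /= /mscale /= /pushforward.
  rewrite (_ : _ @^-1` _ = rV_box (fun i => (fun x => c * x + v 0 i) @^-1` B i)).
    rewrite !lebesgue_rV_boxE//.
      under [LHS]eq_bigr => i _ do rewrite (@lebesgue_measure_affine c (v 0 i))//.
      rewrite big_split /= prodEFin; congr (_%:E * _)%E.
      by rewrite prodr_const card_ord.
    move=> i; rewrite -[X in measurable X]setTI.
    suff mh : measurable_fun [set: measurableTypeR R]
        (fun x : measurableTypeR R => c * x + v 0 i : measurableTypeR R).
      by apply: mh.
    apply: (@measurable_funD _ (measurableTypeR R) R setT (fun x => c * x)
      (cst (v 0 i))); last exact: measurable_cst.
    by apply: (@measurable_funM _ (measurableTypeR R) R setT (cst c) id);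
      [exact: measurable_cst|exact: measurable_id].
  by apply/seteqP; split=> x /= H i; have := H i; rewrite !mxE.
- move=> k; rewrite /= lebesgue_rV_boxE//.
  suff: (0 <= \prod_(i < n) lebesgue_measure (`[(- k%:R)%R, k%:R%R]%classic : set (measurableTypeR R)) < +oo)%E by case/andP.
  apply: (big_ind (fun x : \bar R => (0 <= x < +oo)%E)) => //.
  + by rewrite lee01 ltry.
  + by move=> x y /andP[x0 xo] /andP[y0 yo]; rewrite mule_ge0//= lte_mul_pinfty ?ge0_fin_numE.
  + move=> i _; rewrite measure_ge0 /= lebesgue_measure_itv /=.
    by case: ifP => _; rewrite ?ltry.
Qed.

End lebesgue_affine.

Section euclidean_norm.
Context {R : realType} {N : nat}.
Implicit Types (x y z w : 'rV[R]_N) (c : R).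

Definition dotV x y : R := \sum_(i < N) x 0 i * y 0 i.

Lemma dotVC x y : dotV x y = dotV y x.
Proof. by apply: eq_bigr => i _; rewrite mulrC. Qed.

Lemma dotVDl x y z : dotV (x + y) z = dotV x z + dotV y z.
Proof. by rewrite -big_split; apply: eq_bigr => i _; rewrite mxE mulrDl. Qed.

Lemma dotVZl c x y : dotV (c *: x) y = c * dotV x y.
Proof. by rewrite mulr_sumr; apply: eq_bigr => i _; rewrite mxE mulrA. Qed.

Lemma dotVBl x y z : dotV (x - y) z = dotV x z - dotV y z.
Proof. by rewrite dotVDl -scaleN1r dotVZl mulN1r. Qed.

Lemma dotVBr x y z : dotV x (y - z) = dotV x y - dotV x z.
Proof. by rewrite dotVC dotVBl !(dotVC x). Qed.

Lemma dotVZr c x y : dotV x (c *: y) = c * dotV x y.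
Proof. by rewrite dotVC dotVZl dotVC. Qed.

Lemma dotV_ge0 x : 0 <= dotV x x.
Proof. by apply: sumr_ge0 => i _; rewrite -expr2 sqr_ge0. Qed.

Lemma dotV_eq0 x : dotV x x = 0 -> x = 0.
Proof.
move=> /eqP; rewrite psumr_eq0; last by move=> i _; rewrite -expr2 sqr_ge0.
move=> /allP H; apply/rowP => i; rewrite mxE.
have := H i (mem_index_enum _); rewrite implyTb -expr2 sqrf_eq0.
by move/eqP.
Qed.

Lemma enormE x : enorm x = Num.sqrt (dotV x x).
Proof. by congr Num.sqrt; apply: eq_bigr => i _; rewrite expr2. Qed.

Lemma sqr_enorm x : enorm x ^+ 2 = dotV x x.
Proof. by rewrite enormE sqr_sqrtr ?dotV_ge0. Qed.

Lemma enorm_ge0 x : 0 <= enorm x.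
Proof. exact: sqrtr_ge0. Qed.

Lemma enorm0 : enorm (0 : 'rV[R]_N) = 0.
Proof.
by rewrite enormE /dotV big1 ?sqrtr0// => i _; rewrite mxE mul0r.
Qed.

Lemma enorm_eq0 x : (enorm x == 0) = (x == 0).
Proof.
apply/eqP/eqP => [H|->]; last exact: enorm0.
by apply: dotV_eq0; rewrite -sqr_enorm H expr0n.
Qed.

Lemma enormZ c x : enorm (c *: x) = `|c| * enorm x.
Proof.
by rewrite !enormE dotVZl dotVZr mulrA -expr2 sqrtrM ?sqr_ge0// sqrtr_sqr.
Qed.

Lemma enormN x : enorm (- x) = enorm x.
Proof. by rewrite -scaleN1r enormZ normrN1 mul1r. Qed.

Lemma enormBC x y : enorm (x - y) = enorm (y - x).
Proof. by rewrite -enormN opprB. Qed.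

Lemma dotV_le x y : dotV x y <= enorm x * enorm y.
Proof.
have [->|y0] := eqVneq y 0.
  by rewrite enorm0 mulr0 /dotV big1// => i _; rewrite mxE mulr0.
apply: (le_trans (ler_norm _)).
rewrite -ler_sqr ?nnegrE ?mulr_ge0 ?enorm_ge0// real_normK ?num_real//. rewrite exprMn !sqr_enorm.
have yy0 : 0 < dotV y y.
  rewrite lt_neqAle dotV_ge0 andbT eq_sym; apply: contra y0 => /eqP H.
  exact/eqP/dotV_eq0.
(* This squared norm equals <y,y> (<x,x> <y,y> - <x,y>^2). *)
have := dotV_ge0 (dotV y y *: x - dotV x y *: y).
rewrite !(dotVBl, dotVBr, dotVZl, dotVZr) (dotVC y x) => H.
rewrite -subr_ge0 -(pmulr_rge0 _ yy0); apply: le_trans H _.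
by rewrite le_eqVlt; apply/orP; left; apply/eqP; ring.
Qed.

Lemma enormD x y : enorm (x + y) <= enorm x + enorm y.
Proof.
rewrite -ler_sqr ?nnegrE ?addr_ge0 ?enorm_ge0// sqrrD !sqr_enorm.
rewrite (_ : dotV (x + y) _ = dotV x x + dotV x y *+ 2 + dotV y y).
  by rewrite lerD2r lerD2l lerMn2r; apply/orP; right; exact: dotV_le.
by rewrite dotVDl !(dotVC _ (x + y)) !dotVDl (dotVC y x); ring.
Qed.

Lemma enormB x y : enorm (x - y) <= enorm x + enorm y.
Proof. by rewrite -(enormN y) enormD. Qed.

Lemma enorm_dist x y : enorm x - enorm y <= enorm (x - y).
Proof. by rewrite lerBlDr -[X in enorm X <= _](subrK y) enormD. Qed.

Lemma coord_le_enorm x i : `|x 0 i| <= enorm x.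
Proof.
rewrite -ler_sqr ?nnegrE ?enorm_ge0// sqr_enorm /dotV real_normK ?num_real//.
rewrite (bigD1 i)//= -expr2 lerDl; apply: sumr_ge0 => j _.
by rewrite -expr2 sqr_ge0.
Qed.

(** Householder reflection in the hyperplane orthogonal to [w]; for [w = 0] it is the identity,
    since the inverse of 0 is 0. Reflections stand in for rotations: the one along x - y exchanges
    two vectors x, y of equal norm. *)
Definition reflV w y : 'rV[R]_N := y - (2 * dotV y w / dotV w w) *: w.

Lemma reflVB w x y : reflV w (x - y) = reflV w x - reflV w y.
Proof.
rewrite /reflV dotVBl; apply/rowP => i; rewrite !mxE; ring.
Qed.

Lemma reflV_sqr w y : dotV (reflV w y) (reflV w y) = dotV y y.
Proof.
have [w0|w0] := eqVneq (dotV w w) 0.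
  by rewrite /reflV w0 invr0 mulr0 scale0r subr0.
rewrite /reflV !(dotVBl, dotVBr, dotVZl, dotVZr) (dotVC w y).
by field.
Qed.

Lemma enorm_reflV w y : enorm (reflV w y) = enorm y.
Proof. by rewrite !enormE reflV_sqr. Qed.

Lemma reflVK w : involutive (reflV w).
Proof.
move=> y; have [w0|w0] := eqVneq (dotV w w) 0.
  by rewrite /reflV w0 invr0 !mulr0 !scale0r !subr0.
rewrite /reflV dotVBl dotVZl; apply/rowP => i; rewrite !mxE; by field.
Qed.

Lemma reflV_exchange x y : enorm x = enorm y -> reflV (x - y) x = y.
Proof.
move=> xy; have {}xy : dotV x x = dotV y y by rewrite -!sqr_enorm xy.
have [w0|w0] := eqVneq (dotV (x - y) (x - y)) 0.
  by have := dotV_eq0 w0; rewrite /reflV => ->; rewrite scaler0 subr0; move/eqP: (dotV_eq0 w0); rewrite subr_eq0 => /eqP.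
rewrite /reflV (_ : _ / _ = 1); first by rewrite scale1r opprB addrC subrK.
have E : dotV (x - y) (x - y) = 2 * dotV x (x - y).
  by rewrite !(dotVBl, dotVBr) (dotVC y x) -xy; ring.
by rewrite -E divff.
Qed.

Lemma measurable_reflV w : measurable_fun setT (reflV w).
Proof.
apply: measurable_fun_subV; first exact: measurable_id.
apply: measurable_fun_scaleV; last exact: measurable_cst.
apply: measurable_funM; last exact: measurable_cst.
apply: measurable_funM; first exact: measurable_cst.
apply: measurable_sum => i; apply: measurable_funM; last exact: measurable_cst.
exact: measurable_rV_coord.
Qed.

End euclidean_norm.

Lemma mule_pfin_inj (R : realType) (V a b : \bar R) :
  (0 < V)%E -> V \is a fin_num -> (V * a = V * b)%E -> a = b.
Proof.
move=> V0 Vf H; case: (ltgtP a b) => // ab.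
- by move: ab; rewrite -(lte_pmul2l Vf V0) H ltxx.
- by move: ab; rewrite -(lte_pmul2l Vf V0) H ltxx.
Qed.

(** * Invariance of Lebesgue measure under similarities and reflections *)

Section invariance.
Context {R : realType} {N : nat}.
Local Notation mu := (@lebesgue_rV R N).
Implicit Types (f : 'rV[R]_N -> \bar R) (c r : R) (v w x y : 'rV[R]_N).

Lemma ge0_integral_affine f c v : 0 < c ->
  measurable_fun setT f -> (forall x, (0 <= f x)%E) ->
  (\int[mu]_x f x = (c ^+ N)%:E * \int[mu]_x f (c *: x + v)%R)%E.
Proof.
move=> c0 mf f0.
have mphi : measurable_fun [set: 'rV[R]_N] (fun x : 'rV[R]_N => c *: x + v).
  apply: measurable_fun_addV; last exact: measurable_cst.
  by apply: measurable_fun_scaleV; [exact: measurable_cst|exact: measurable_id].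
pose nu : {measure set 'rV[R]_N -> \bar R} :=
  mscale (NngNum (exprn_ge0 N (ltW c0))) (pushforward mu
    (fun x : 'rV[R]_N => c *: x + v : 'rV[R]_N)).
transitivity (\int[nu mphi]_x f x)%E.
  by apply: eq_measure_integral => A mA _; exact: lebesgue_rV_affine.
rewrite ge0_integral_mscale//; congr (_ * _)%E.
by rewrite ge0_integral_pushforward.
Qed.

Lemma ge0_integral_translate f v :
  measurable_fun setT f -> (forall x, (0 <= f x)%E) ->
  (\int[mu]_x f x = \int[mu]_x f (x + v)%R)%E.
Proof.
move=> mf f0; rewrite (ge0_integral_affine v ltr01 mf f0) expr1n mul1e.
by apply: eq_integral => x _; rewrite scale1r.
Qed.

Lemma ge0_integral_scale f c : 0 < c ->
  measurable_fun setT f -> (forall x, (0 <= f x)%E) ->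
  (\int[mu]_x f x = (c ^+ N)%:E * \int[mu]_x f (c *: x)%R)%E.
Proof.
move=> c0 mf f0; rewrite (ge0_integral_affine 0 c0 mf f0); congr (_ * _)%E.
by apply: eq_integral => x _; rewrite addr0.
Qed.

Definition ind_ball (r : R) x : R := if enorm x < r then 1 else 0.

Lemma ind_ball_ge0 r x : 0 <= ind_ball r x.
Proof. by rewrite /ind_ball; case: ifP. Qed.

Lemma measurable_fun_ind_ball d (T : measurableType d) (g : T -> 'rV[R]_N) r :
  measurable_fun setT g -> measurable_fun setT (fun a => ind_ball r (g a)).
Proof.
move=> mg; apply: measurable_fun_ifT; [|exact: measurable_cst..].
apply: measurable_fun_ltr; last exact: measurable_cst.
exact: measurable_fun_enorm.
Qed.

Definition vol_ball (r : R) : \bar R := (\int[mu]_x (ind_ball r x)%:E)%E.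

Lemma vol_ball_scale r : 0 < r -> vol_ball r = ((r ^+ N)%:E * vol_ball 1)%E.
Proof.
move=> r0; rewrite {1}/vol_ball (ge0_integral_scale r0); last 2 first.
- by apply/measurable_EFinP/measurable_fun_ind_ball; exact: measurable_id.
- by move=> x; rewrite lee_fin ind_ball_ge0.
congr (_ * _)%E; apply: eq_integral => x _; congr EFin.
by rewrite /ind_ball enormZ gtr0_norm// gtr_pMr.
Qed.

Lemma integral_rV_box (A : 'I_N -> set (measurableTypeR R)) :
  (forall i, measurable (A i)) ->
  (\int[mu]_x (\1_(rV_box A) x)%:E = \prod_(i < N) lebesgue_measure (A i))%E.
Proof.
move=> mA; rewrite integral_indic//; last exact: measurable_rV_box.
by rewrite setIT /= lebesgue_rV_boxE.
Qed.

Lemma vol_ball1_gt0 : (0 < vol_ball 1)%E.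
Proof.
(* The cube of half-side 1/(N+1) lies in the unit ball, since N/(N+1)^2 < 1. *)
pose d : R := N.+1%:R^-1.
have d0 : 0 < d by rewrite invr_gt0.
pose A (i : 'I_N) : set (measurableTypeR R) := `[- d, d]%classic.
have mA i : measurable (A i) by exact: measurable_itv.
apply: (@lt_le_trans _ _ (\prod_(i < N) lebesgue_measure (A i))%E).
  apply: (big_ind (fun a : \bar R => (0 < a)%E)) => //.
    by move=> x y; exact: mule_gt0.
  move=> i _; rewrite lebesgue_measure_itv /= lte_fin gtrN// -EFinD lte_fin.
  by rewrite opprK addr_gt0.
rewrite -integral_rV_box//; apply: ge0_le_integral => //.
- apply/measurable_EFinP; apply: measurable_indic; exact: measurable_rV_box.
- by apply/measurable_EFinP/measurable_fun_ind_ball; exact: measurable_id.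
move=> x _; rewrite lee_fin indicE; have [/set_mem xA|_] := boolP (x \in _).
  rewrite /ind_ball ifT// -ltr_sqr ?nnegrE ?enorm_ge0// sqr_enorm expr1n /dotV.
  apply: (@le_lt_trans _ _ (\sum_(i < N) d ^+ 2)).
    apply: ler_sum => i _; rewrite -expr2 -(real_normK (num_real (x _ _))).
    have := xA i; rewrite /A /= in_itv /= -ler_norml => xd.
    by rewrite ler_sqr ?nnegrE// ltW.
  rewrite sumr_const card_ord -mulr_natl /d exprVn ltr_pdivrMr ?exprn_gt0//.
  rewrite mul1r -natrX ltr_nat; apply: (@leq_trans N.+1) => //.
  by rewrite -{1}(expn1 N.+1) leq_pexp2l.
exact: ind_ball_ge0.
Qed.

Lemma vol_ball1_fin : vol_ball 1 \is a fin_num.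
Proof.
pose A (i : 'I_N) : set (measurableTypeR R) := `[-1, 1]%classic.
have mA i : measurable (A i) by exact: measurable_itv.
rewrite ge0_fin_numE; last by rewrite ltW// vol_ball1_gt0.
apply: (@le_lt_trans _ _ (\prod_(i < N) lebesgue_measure (A i))%E); last first.
  suff /andP[] : (0 <= \prod_(i < N) lebesgue_measure (A i) < +oo)%E by [].
  apply: (big_ind (fun a : \bar R => (0 <= a < +oo)%E)) => //.
  - by rewrite lee01 ltry.
  - move=> x y /andP[x0 xo] /andP[y0 yo].
    by rewrite mule_ge0//= lte_mul_pinfty ?ge0_fin_numE.
  - move=> i _; rewrite measure_ge0 /= lebesgue_measure_itv /=.
    by case: ifP => _; rewrite ?ltry.
rewrite -integral_rV_box//; apply: ge0_le_integral => //.
- by move=> x _; rewrite lee_fin ind_ball_ge0.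
- by apply/measurable_EFinP/measurable_fun_ind_ball; exact: measurable_id.
- apply/measurable_EFinP; apply: measurable_indic; exact: measurable_rV_box.
move=> x _; rewrite lee_fin indicE /ind_ball; case: ifPn => // x1.
rewrite mem_set// => i; rewrite /A /= in_itv /= -ler_norml.
exact: le_trans (coord_le_enorm _ _) (ltW x1).
Qed.

(* Averaging over the unit ball, which Q preserves, turns x |-> Q x into
   translations. *)
Lemma ge0_integral_isometryN (Q : 'rV[R]_N -> 'rV[R]_N) f :
  measurable_fun setT Q -> involutive Q -> {morph Q : x y / x - y} ->
  (forall x, enorm (Q x) = enorm x) ->
  measurable_fun setT f -> (forall x, (0 <= f x)%E) ->
  (\int[mu]_x f (Q x) = \int[mu]_x f (- x)%R)%E.
Proof.
move=> mQ QK QB Qn mf f0.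
have [V0 Vfin] := (vol_ball1_gt0, vol_ball1_fin).
have mI d (T : measurableType d) (g : T -> 'rV[R]_N) : measurable_fun setT g ->
    measurable_fun setT (fun a => (ind_ball 1 (g a))%:E).
  by move=> mg; apply/measurable_EFinP/measurable_fun_ind_ball.
have mI1 : measurable_fun setT (fun x : 'rV[R]_N => (ind_ball 1 x)%:E).
  by apply/measurable_EFinP/measurable_fun_ind_ball; exact: measurable_id.
have I0 x : (0 <= (ind_ball 1 x)%:E)%E by rewrite lee_fin ind_ball_ge0.
have mfg d (T : measurableType d) (g : T -> 'rV[R]_N) : measurable_fun setT g ->
    measurable_fun setT (fun a => f (g a)) by move=> mg; exact: measurableT_comp.
have mfst := @measurable_fst _ _ 'rV[R]_N 'rV[R]_N.
have msnd := @measurable_snd _ _ 'rV[R]_N 'rV[R]_N.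
have mN : measurable_fun setT (fun x : 'rV[R]_N => - x).
  by apply: measurable_fun_oppV; exact: measurable_id.
suff H : (vol_ball 1 * \int[mu]_x f (Q x) = vol_ball 1 * \int[mu]_x f (- x)%R)%E.
  move: H; set a := integral _ _ _; set b := integral _ _ _ => H.
  exact: mule_pfin_inj H.
have QN x : Q (- x) = - Q x.
  by have := QB 0 x; rewrite sub0r => ->; have := QB 0 0; rewrite subrr subrr => ->; rewrite sub0r.
have QD x y : Q (x + y) = Q x + Q y by rewrite -{1}(opprK y) QB QN opprK.
transitivity (\int[mu]_y \int[mu]_x ((ind_ball 1 y)%:E * f (Q x - y)%R))%E.
  rewrite muleC -ge0_integralZl//; last exact: integral_ge0.
  apply: eq_integral => y _; rewrite muleC [in RHS]ge0_integralZl//; last first.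
    by apply: mfg; apply: measurable_fun_subV => //; exact: measurable_cst.
  congr (_ * _)%E.
  rewrite (ge0_integral_translate (- Q y))//; last exact: mfg.
  by apply: eq_integral => x _; rewrite QB QK.
rewrite -(@fubini_tonelli _ _ _ _ _ mu mu (fun z => (ind_ball 1 z.2)%:E * f (Q z.1 - z.2)%R))%E/=; last 2 first.
- apply: emeasurable_funM; first exact: mI.
  by apply: mfg; apply: measurable_fun_subV => //; exact: measurableT_comp.
- by move=> z; exact: mule_ge0.
transitivity (\int[mu]_x \int[mu]_y ((ind_ball 1 (y + Q x)%R)%:E * f (- y)%R))%E.
  apply: eq_integral => x _; rewrite [LHS](ge0_integral_translate (Q x)); last 2 first.
  - apply: emeasurable_funM; first exact: mI1.
    apply: mfg; apply: measurable_fun_subV; last exact: measurable_id.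
    exact: measurable_cst.
  - by move=> y; exact: mule_ge0.
  by apply: eq_integral => y _; rewrite opprD addrCA subrr addr0.
rewrite (@fubini_tonelli _ _ _ _ _ mu mu (fun z => (ind_ball 1 (z.2 + Q z.1)%R)%:E * f (- z.2)%R))%E/=; last 2 first.
- apply: emeasurable_funM.
    by apply: mI; apply: measurable_fun_addV => //; exact: measurableT_comp.
  by apply: mfg; exact: measurable_fun_oppV.
- by move=> z; exact: mule_ge0.
rewrite muleC -ge0_integralZr//; last 2 first.
- exact: mfg.
- exact: integral_ge0.
apply: eq_integral => y _.
rewrite ge0_integralZr//; last first.
  by apply: mI; apply: measurable_fun_addV => //; exact: measurable_cst.
rewrite muleC; congr (_ * _)%E.
rewrite /vol_ball (ge0_integral_translate (Q y))//.
by apply: eq_integral => x _; rewrite /ind_ball -(Qn (y + Q x)) QD QK addrC.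
Qed.

(** The sign left by averaging cancels: the isometry lemma for the identity equates the integrals of
    f (- x) and f x. *)
Lemma ge0_integral_reflV f w :
  measurable_fun setT f -> (forall x, (0 <= f x)%E) ->
  (\int[mu]_x f (reflV w x) = \int[mu]_x f x)%E.
Proof.
move=> mf f0; rewrite (ge0_integral_isometryN (@measurable_reflV _ _ w))//.
- by rewrite -(@ge0_integral_isometryN id)//; exact: measurable_id.
- exact: reflVK.
- by move=> x y; exact: reflVB.
- exact: enorm_reflV.
Qed.

End invariance.

(** * Inversion in the unit sphere *)

Lemma measurable_invr (R : realType) : measurable_fun setT (@GRing.inv R).
Proof.
rewrite (_ : GRing.inv = fun x : R =>
    if 0 <= x then x `^ (- 1) else - ((- x) `^ (- 1))); last first.
  apply/funext => x; case: ifPn => [x0|]; first by rewrite powR_inv1.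
  by rewrite -ltNge => x0; rewrite powR_inv1 ?oppr_ge0 ?ltW// invrN opprK.
apply: measurable_fun_ifT.
- by apply: measurable_fun_ler; [exact: measurable_cst|exact: measurable_id].
- exact: measurable_powR.
- apply: measurable_funN; apply: (measurableT_comp (@measurable_powR R (- 1))).
  by apply: measurable_funN; exact: measurable_id.
Qed.

Section swap.
Context {R : realType} {N : nat}.
Local Notation mu := (@lebesgue_rV R N).
Implicit Types (h : R -> R -> R -> R) (e : 'rV[R]_N).

Lemma le_integral_EFin (f g : 'rV[R]_N -> R) :
  measurable_fun setT f -> measurable_fun setT g ->
  (forall x, 0 <= f x) -> (forall x, f x <= g x) ->
  (\int[mu]_x (f x)%:E <= \int[mu]_x (g x)%:E)%E.
Proof.
move=> mf mg f0 fg; apply: ge0_le_integral => //.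
- by move=> x _; rewrite lee_fin.
- exact/measurable_EFinP.
- exact/measurable_EFinP.
- by move=> x _; rewrite lee_fin.
Qed.

Lemma integral_EFinZl (f : 'rV[R]_N -> R) (k : R) :
  measurable_fun setT f -> (forall x, 0 <= f x) -> 0 <= k ->
  (\int[mu]_x (k * f x)%:E = k%:E * \int[mu]_x (f x)%:E)%E.
Proof.
move=> mf f0 k0; under eq_integral do rewrite EFinM.
rewrite ge0_integralZl//; first exact/measurable_EFinP.
by move=> x _; rewrite lee_fin.
Qed.

Lemma integral_EFinD (f g : 'rV[R]_N -> R) :
  measurable_fun setT f -> measurable_fun setT g ->
  (forall x, 0 <= f x) -> (forall x, 0 <= g x) ->
  (\int[mu]_x (f x + g x)%:E = \int[mu]_x (f x)%:E + \int[mu]_x (g x)%:E)%E.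
Proof.
move=> mf mg f0 g0; under eq_integral do rewrite EFinD.
rewrite ge0_integralD//.
- by move=> x _; rewrite lee_fin.
- exact/measurable_EFinP.
- by move=> x _; rewrite lee_fin.
- exact/measurable_EFinP.
Qed.

Lemma integral_EFin_affine (f : 'rV[R]_N -> R) (c : R) (v : 'rV[R]_N) :
  0 < c -> measurable_fun setT f -> (forall x, 0 <= f x) ->
  (\int[mu]_x (f x)%:E = \int[mu]_x (c ^+ N * f (c *: x + v)%R)%:E)%E.
Proof.
move=> c0 mf f0; rewrite integral_EFinZl ?exprn_ge0 ?(ltW c0)//; last first.
  apply: (measurableT_comp mf); apply: measurable_fun_addV; last exact: measurable_cst.
  by apply: measurable_fun_scaleV; [exact: measurable_cst|exact: measurable_id].
by rewrite (ge0_integral_affine v c0)//; exact/measurable_EFinP.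
Qed.

Lemma integral_EFin_scale (f : 'rV[R]_N -> R) (c : R) :
  0 < c -> measurable_fun setT f -> (forall x, 0 <= f x) ->
  (\int[mu]_x (f x)%:E = \int[mu]_x (c ^+ N * f (c *: x)%R)%:E)%E.
Proof.
move=> c0 mf f0; rewrite (integral_EFin_affine 0 c0 mf f0).
by apply: eq_integral => x _; rewrite addr0.
Qed.

Definition window (r : R) : R := if 1 <= r < 4 then 1 else 0.

Lemma window_ge0 r : 0 <= window r. Proof. by rewrite /window; case: ifP. Qed.

Lemma measurable_window : measurable_fun setT window.
Proof.
apply: measurable_fun_ifT; [|exact: measurable_cst..].
by apply: measurable_and; [apply: measurable_fun_ler|apply: measurable_fun_ltr];
  first [exact: measurable_cst|exact: measurable_id].
Qed.

(** A cut-off of the dilation-invariant density |x|^(-N). The window keeps its integral finite and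
    positive, and for [t = |y|] it depends on |x| |y| only, hence is symmetric in x and y. *)
Let swap_weight (t : R) (x : 'rV[R]_N) : R :=
  (enorm x ^+ N)^-1 * window (enorm x ^+ 2 * t).

Let swap_weight_ge0 t x : 0 <= swap_weight t x.
Proof. by rewrite mulr_ge0 ?window_ge0// invr_ge0 exprn_ge0 ?enorm_ge0. Qed.

Let measurable_swap_weight d (T : measurableType d) (t : T -> R) (g : T -> 'rV[R]_N) :
  measurable_fun setT t -> measurable_fun setT g ->
  measurable_fun setT (fun a => swap_weight (t a) (g a)).
Proof.
move=> mt mg; apply: measurable_funM.
  apply: (measurableT_comp (@measurable_invr R)).
  by apply: measurable_funX; exact: measurable_fun_enorm.
apply: (measurableT_comp measurable_window).
by apply: measurable_funM => //; apply: measurable_funX; exact: measurable_fun_enorm.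
Qed.

Let W := (\int[mu]_x (swap_weight 1 x)%:E)%E.

(** The dilation x |-> t^(-1/2) x preserves |x|^(-N) dx and turns |x|^2 t into |x|^2. *)
Let integral_swap_weight t : 0 < t -> (\int[mu]_x (swap_weight t x)%:E = W)%E.
Proof.
move=> t0; pose c := (Num.sqrt t)^-1.
have c0 : 0 < c by rewrite invr_gt0 sqrtr_gt0.
rewrite (ge0_integral_scale c0); last 2 first.
- apply/measurable_EFinP/measurable_swap_weight; first exact: measurable_cst.
  exact: measurable_id.
- by move=> x; rewrite lee_fin swap_weight_ge0.
rewrite -ge0_integralZl//; last 3 first.
- apply/measurable_EFinP/measurable_swap_weight; first exact: measurable_cst.
  by apply: measurable_fun_scaleV; [exact: measurable_cst|exact: measurable_id].
- by move=> x _; rewrite lee_fin swap_weight_ge0.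
- by rewrite lee_fin exprn_ge0// ltW.
apply: eq_integral => x _; rewrite -EFinM; congr EFin.
rewrite /swap_weight enormZ gtr0_norm// exprMn invfM !mulrA mulfV ?mul1r; last first.
  by rewrite expf_neq0// gt_eqF.
congr (_ * window _); rewrite mulr1 exprMn mulrAC /c exprVn sqr_sqrtr 1?ltW//.
by rewrite mulVf ?mul1r// gt_eqF.
Qed.

Let W_fin : W \is a fin_num.
Proof.
rewrite ge0_fin_numE; last first.
  by apply: integral_ge0 => x _; rewrite lee_fin swap_weight_ge0.
apply: (@le_lt_trans _ _ (@vol_ball R N 2)); last first.
  by rewrite vol_ball_scale// ltey_eq fin_numM// vol_ball1_fin.
apply: le_integral_EFin.
- by apply: measurable_swap_weight; [exact: measurable_cst|exact: measurable_id].
- by apply: measurable_fun_ind_ball; exact: measurable_id.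
- exact: swap_weight_ge0.
move=> x; rewrite /swap_weight /window mulr1; case: ifPn => [/andP[x1 x4]|_].
  have x1' : 1 <= enorm x by rewrite -ler_sqr ?nnegrE ?enorm_ge0// expr1n.
  rewrite /ind_ball ifT; last first.
    rewrite -ltr_sqr ?nnegrE ?enorm_ge0//; apply: lt_le_trans x4 _.
    by rewrite -natrX.
  by rewrite mulr1 invf_le1 ?exprn_ege1// exprn_gt0// (lt_le_trans _ x1').
by rewrite mulr0 ind_ball_ge0.
Qed.

Let W_gt0 : (0 < N)%N -> (0 < W)%E.
Proof.
move=> N0; pose g (x : 'rV[R]_N) : R := if 1 <= enorm x < 2 then 1 else 0.
have mg : measurable_fun setT g.
  apply: measurable_fun_ifT; [|exact: measurable_cst..].
  have me : measurable_fun setT (@enorm R N).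
    by apply: measurable_fun_enorm; exact: measurable_id.
  by apply: measurable_and; [apply: measurable_fun_ler|apply: measurable_fun_ltr] => //.
have g0 x : 0 <= g x by rewrite /g; case: ifP.
have V1 := @vol_ball1_gt0 R N; have V1f := @vol_ball1_fin R N.
have E : (@vol_ball R N 2 = @vol_ball R N 1 + \int[mu]_x (g x)%:E)%E.
  rewrite /vol_ball -ge0_integralD//; last 4 first.
  - by move=> x _; rewrite lee_fin ind_ball_ge0.
  - by apply/measurable_EFinP/measurable_fun_ind_ball; exact: measurable_id.
  - by move=> x _; rewrite lee_fin.
  - exact/measurable_EFinP.
  apply: eq_integral => x _; rewrite -EFinD; congr EFin; rewrite /ind_ball /g.
  have [x1|x1] := ltP (enorm x) 1; last by rewrite add0r.
  by rewrite addr0 ifT// (lt_trans x1)// ltr1n.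
(* Were the shell 1 <= |x| < 2 null, doubling the unit ball would leave its finite positive volume
   unchanged, although it multiplies it by 2^N > 1. *)
have G0 : (0 < \int[mu]_x (g x)%:E)%E.
  rewrite lt0e integral_ge0 ?andbT; last by move=> x _; rewrite lee_fin.
  apply/eqP => G0; move: E; rewrite G0 adde0 vol_ball_scale// => E.
  have : (@vol_ball R N 1 < (2 ^+ N)%:E * @vol_ball R N 1)%E.
    rewrite -[X in (X < _)%E]mul1e; rewrite lte_pmul2r// lte_fin.
    by rewrite exprn_egt1// ?ltr1n// -lt0n.
  by rewrite E ltxx.
apply: (@lt_le_trans _ _ (((2 ^+ N)^-1)%:E * \int[mu]_x (g x)%:E)%E).
  by rewrite mule_gt0// lte_fin invr_gt0 exprn_gt0.
rewrite -ge0_integralZl//; last 2 first.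
- exact/measurable_EFinP.
- by move=> x _; rewrite lee_fin.
apply: le_integral_EFin.
- by apply: measurable_funM => //; exact: measurable_cst.
- by apply: measurable_swap_weight; [exact: measurable_cst|exact: measurable_id].
- by move=> x; rewrite mulr_ge0// invr_ge0 exprn_ge0.
move=> x; rewrite /g; case: ifPn => [/andP[x1 x2]|_]; last first.
  by rewrite mulr0 swap_weight_ge0.
have x0 : 0 < enorm x by exact: lt_le_trans x1.
rewrite /swap_weight /window ifT; last first.
  rewrite mulr1 exprn_ege1//= (_ : 4 = 2 ^+ 2); last by rewrite -natrX.
  by rewrite ltr_pXn2r ?nnegrE ?enorm_ge0.
by rewrite !mulr1 lef_pV2 ?posrE ?exprn_gt0// lerXn2r ?nnegrE ?enorm_ge0// ltW.
Qed.

(** For fixed x <> 0 with r = |x|, substitute r Q y for y, where Q is the reflection carrying e to x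
    / r: then |x - r Q y| = r |e - y|, and homogeneity of degree -2N leaves r^(-N) h(1, |y|, |e -
    y|) times the window at r^2 |y|. Integrating in x first gives the constant [W]. *)
Let swap_avg h e :
  (forall a b c, 0 <= h a b c) ->
  (forall a b c, a <= 0 \/ b <= 0 -> h a b c = 0) ->
  (forall l a b c, 0 < l -> l ^+ (2 * N) * h (l * a) (l * b) (l * c) = h a b c) ->
  measurable_fun setT (fun z : 'rV[R]_N * 'rV[R]_N =>
    h (enorm z.1) (enorm z.2) (enorm (z.1 - z.2))) ->
  enorm e = 1 ->
  (\int[mu]_x \int[mu]_y (h (enorm x) (enorm y) (enorm (x - y)%R)
      * window (enorm x * enorm y))%:E =
   W * \int[mu]_y (h 1 (enorm y) (enorm (e - y)%R))%:E)%E.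
Proof.
move=> h0 hz hom mh e1.
have me d (T : measurableType d) (g : T -> 'rV[R]_N) : measurable_fun setT g ->
  measurable_fun setT (fun a => enorm (g a)) by exact: measurable_fun_enorm.
have mhx x : measurable_fun setT (fun y : 'rV[R]_N =>
    h (enorm x) (enorm y) (enorm (x - y))).
  apply: (measurableT_comp mh (g := fun y => (x, y))).
  exact: measurable_pair1.
have mhe : measurable_fun setT (fun y : 'rV[R]_N => h 1 (enorm y) (enorm (e - y))).
  by rewrite -e1; exact: mhx.
have mww x : measurable_fun setT (fun y : 'rV[R]_N => window (enorm x * enorm y)).
  apply: (measurableT_comp measurable_window); apply: measurable_funM.
    exact: measurable_cst.
  by apply: me; exact: measurable_id.
transitivity (\int[mu]_x \int[mu]_y
    (swap_weight (enorm y) x * h 1 (enorm y) (enorm (e - y)%R))%:E)%E.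
  apply: eq_integral => x _.
  have [x0|x0] := eqVneq (enorm x) 0.
    apply: eq_integral => y _; congr EFin.
    rewrite x0 hz ?lexx; last by left.
    rewrite mul0r /swap_weight x0 !expr0n mul0r /window ifF ?mulr0 ?mul0r//.
    by rewrite lt_geF.
  have {}x0 : 0 < enorm x by rewrite lt_neqAle eq_sym x0 enorm_ge0.
  pose r := enorm x; pose w := e - r^-1 *: x.
  have re : reflV w e = r^-1 *: x.
    apply: reflV_exchange; rewrite e1 enormZ gtr0_norm ?invr_gt0//.
    by rewrite mulVf// gt_eqF.
  have mI : measurable_fun setT (fun y : 'rV[R]_N =>
      (h (enorm x) (enorm y) (enorm (x - y)) * window (enorm x * enorm y))%:E).
    apply/measurable_EFinP/measurable_funM; [exact: mhx|exact: mww].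
  have I0 (y : 'rV[R]_N) : (0 <= (h (enorm x) (enorm y) (enorm (x - y)%R)
      * window (enorm x * enorm y))%:E)%E.
    by rewrite lee_fin mulr_ge0 ?h0 ?window_ge0.
  have mS : measurable_fun setT (fun y : 'rV[R]_N => r *: y).
    by apply: measurable_fun_scaleV; [exact: measurable_cst|exact: measurable_id].
  rewrite (ge0_integral_scale x0 mI I0) -(ge0_integral_reflV w); last 2 first.
  - exact: (measurableT_comp mI mS).
  - by move=> y; exact: I0.
  rewrite -ge0_integralZl//; last 2 first.
  - exact: (measurableT_comp (measurableT_comp mI mS) (measurable_reflV w)).
  - by rewrite lee_fin exprn_ge0// ltW.
  apply: eq_integral => y _; rewrite -EFinM; congr EFin.
  rewrite -/r enormZ gtr0_norm// enorm_reflV.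
  rewrite (_ : x - r *: reflV w y = r *: reflV w (e - y)); last first.
    by rewrite reflVB re [RHS]scalerBr scalerA divff ?scale1r// gt_eqF.
  rewrite enormZ gtr0_norm// enorm_reflV -(hom _ 1 (enorm y) _ x0) mulr1.
  rewrite /swap_weight -/r (_ : r ^+ 2 * _ = r * (r * enorm y)); last by ring.
  rewrite mul2n -addnn exprD.
  have rN : r ^+ N != 0 by rewrite expf_neq0// gt_eqF.
  move: (h _ _ _) (window _) (r ^+ N) rN => H1 H2 q q0.
  by rewrite -!mulrA [H2 * _]mulrCA mulKf// (mulrC H1) mulrCA.
rewrite (@fubini_tonelli _ _ _ _ _ mu mu (fun z =>
    (swap_weight (enorm z.2) z.1 * h 1 (enorm z.2) (enorm (e - z.2)%R))%:E))/=; last 2 first.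
- apply/measurable_EFinP/measurable_funM.
    by apply: measurable_swap_weight; [apply: me; exact: measurable_snd|exact: measurable_fst].
  exact: (measurableT_comp mhe measurable_snd).
- by move=> z; rewrite lee_fin mulr_ge0 ?swap_weight_ge0.
rewrite -ge0_integralZl//; last 3 first.
- exact/measurable_EFinP.
- by move=> y _; rewrite lee_fin.
- by apply: integral_ge0 => x _; rewrite lee_fin swap_weight_ge0.
apply: eq_integral => y _.
have [y0|y0] := eqVneq (enorm y) 0.
  rewrite y0 hz ?lexx; last by right.
  by rewrite mule0 integral0_eq// => x _; rewrite mulr0.
under eq_integral do rewrite EFinM.
rewrite ge0_integralZr//.
- by rewrite integral_swap_weight// lt_neqAle eq_sym y0 enorm_ge0.
- by apply/measurable_EFinP/measurable_swap_weight; [exact: measurable_cst|exact: measurable_id].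
- by move=> x _; rewrite lee_fin swap_weight_ge0.
- by rewrite lee_fin.
Qed.

(** This is the change of variables y |-> y / |y|^2 for kernels homogeneous of degree -2N. Both
    sides, multiplied by the positive finite [W], are the same double integral read in the two
    orders, the window being symmetric. *)
Lemma integral_swap h e : (0 < N)%N ->
  (forall a b c, 0 <= h a b c) ->
  (forall a b c, a <= 0 \/ b <= 0 -> h a b c = 0) ->
  (forall l a b c, 0 < l -> l ^+ (2 * N) * h (l * a) (l * b) (l * c) = h a b c) ->
  measurable_fun setT (fun z : 'rV[R]_N * 'rV[R]_N =>
    h (enorm z.1) (enorm z.2) (enorm (z.1 - z.2))) ->
  enorm e = 1 ->
  (\int[mu]_y (h 1 (enorm y) (enorm (e - y)%R))%:E =
   \int[mu]_y (h (enorm y) 1 (enorm (e - y)%R))%:E)%E.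
Proof.
move=> N0 h0 hz hom mh e1.
pose h' a b c := h b a c.
have mh' : measurable_fun setT (fun z : 'rV[R]_N * 'rV[R]_N =>
    h' (enorm z.1) (enorm z.2) (enorm (z.1 - z.2))).
  rewrite (_ : (fun z => _) = (fun z : 'rV[R]_N * 'rV[R]_N =>
    h (enorm z.1) (enorm z.2) (enorm (z.1 - z.2))) \o (fun z => (z.2, z.1))).
    by apply: measurableT_comp => //; exact: measurable_swap.
  by apply/funext => z; rewrite /= /h' enormBC.
apply: (mule_pfin_inj (W_gt0 N0) W_fin).
have E1 := swap_avg h0 hz hom mh e1.
have E2 : (\int[mu]_x \int[mu]_y (h' (enorm x) (enorm y) (enorm (x - y)%R)
      * window (enorm x * enorm y))%:E =
   W * \int[mu]_y (h' 1 (enorm y) (enorm (e - y)%R))%:E)%E.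
  apply: swap_avg => //.
  - by move=> a b c; exact: h0.
  - by move=> a b c [a0|b0]; apply: hz; [right|left].
  - by move=> l a b c l0; exact: hom.
apply: (etrans (esym E1)); apply: etrans E2.
pose F (z : 'rV[R]_N * 'rV[R]_N) :=
  (h (enorm z.1) (enorm z.2) (enorm (z.1 - z.2)%R) * window (enorm z.1 * enorm z.2))%:E.
have mF : measurable_fun setT F.
  apply/measurable_EFinP/measurable_funM; first exact: mh.
  apply: (measurableT_comp measurable_window); apply: measurable_funM.
    by apply: measurable_fun_enorm; exact: measurable_fst.
  by apply: measurable_fun_enorm; exact: measurable_snd.
have F0 z : (0 <= F z)%E by rewrite lee_fin mulr_ge0 ?window_ge0.
apply: (etrans (@fubini_tonelli _ _ _ _ _ mu mu F mF F0)).
apply: eq_integral => x _; apply: eq_integral => y _; congr EFin.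
by rewrite /h' enormBC [X in window X]mulrC.
Qed.

End swap.

Lemma ex_unit_rV (R : realType) N : (0 < N)%N ->
  exists e : 'rV[R]_N, enorm e = 1.
Proof.
case: N => // N _; exists (delta_mx 0 ord0).
rewrite enormE /dotV (bigD1 ord0)//= big1 => [|i i0]; rewrite !mxE !eqxx.
  by rewrite mulr1 addr0 sqrtr1.
by rewrite (negPf i0) mulr0.
Qed.

(** * Integrability of powers of the norm at infinity and at the origin *)

Section power_integrals.
Context {R : realType} {N : nat}.
Local Notation mu := (@lebesgue_rV R N).
Hypothesis N_gt0 : (0 < N)%N.

Let menorm : measurable_fun setT (@enorm R N).
Proof. by apply: measurable_fun_enorm; exact: measurable_id. Qed.

Let mpow (q : R) : measurable_fun setT (fun z : 'rV[R]_N => enorm z `^ q).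
Proof. exact: (measurableT_comp (@measurable_powR R q)). Qed.

Definition tail_pow (a K : R) (z : 'rV[R]_N) : R :=
  if K <= enorm z then enorm z `^ (- (N%:R + a)) else 0.

Lemma tail_pow_ge0 a K z : 0 <= tail_pow a K z.
Proof. by rewrite /tail_pow; case: ifP; rewrite ?powR_ge0. Qed.

Lemma measurable_tail_pow a K : measurable_fun setT (tail_pow a K).
Proof.
apply: measurable_fun_ifT; [|exact: mpow|exact: measurable_cst].
by apply: measurable_fun_ler; [exact: measurable_cst|exact: menorm].
Qed.

Lemma integral_tail_pow_scale a K : 0 < K ->
  (\int[mu]_z (tail_pow a K z)%:E =
   (K `^ (- a))%:E * \int[mu]_z (tail_pow a 1 z)%:E)%E.
Proof.
move=> K0; rewrite (integral_EFin_scale K0); last 2 first.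
- exact: measurable_tail_pow.
- exact: tail_pow_ge0.
rewrite -(integral_EFinZl (measurable_tail_pow a 1) (tail_pow_ge0 a 1) (powR_ge0 _ _)).
apply: eq_integral => z _; congr EFin.
rewrite /tail_pow enormZ gtr0_norm// ler_pMr//; case: ifP => _; last by rewrite !mulr0.
rewrite powRM ?enorm_ge0 ?(ltW K0)// mulrA -powR_mulrn ?(ltW K0)//; congr (_ * _).
rewrite -powRD; last by rewrite (gt_eqF K0) implybT.
by congr (_ `^ _); lra.
Qed.

Let shell_pow (a : R) (n : nat) (z : 'rV[R]_N) : R :=
  if 1 <= enorm z < 2 ^+ n then enorm z `^ (- (N%:R + a)) else 0.

Let shell_pow_ge0 a n z : 0 <= shell_pow a n z.
Proof. by rewrite /shell_pow; case: ifP; rewrite ?powR_ge0. Qed.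

Let measurable_shell_pow a n : measurable_fun setT (shell_pow a n).
Proof.
rewrite /tail_pow; rewrite /shell_pow; apply: measurable_fun_ifT; [|exact: mpow|exact: measurable_cst].
by apply: measurable_and; [apply: measurable_fun_ler|apply: measurable_fun_ltr];
  first [exact: menorm|exact: measurable_cst].
Qed.

(** Scaling by 2 replaces polar coordinates: the integral I(n) over 1 <= |z| < 2^n satisfies I(n+1)
    <= c1 + q I(n), where c1 is the volume of the ball of radius 2 and q = 2^(-a) < 1. The bound [C]
    is the fixed point of this recursion. *)
Let integral_shell_pow_le a : 0 < a -> exists C : R,
  forall n, (\int[mu]_z (shell_pow a n z)%:E <= C%:E)%E.
Proof.
move=> a0; pose q := (2 : R) `^ (- a).
have q1 : q < 1.
  rewrite /q powRN invf_lt1 ?powR_gt0// /powR pnatr_eq0 /= expR_gt1.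
  by rewrite mulr_gt0// ln_gt0// ltr1n.
pose c1 := fine (@vol_ball R N 2); pose C := c1 / (1 - q).
have c1E : @vol_ball R N 2 = c1%:E.
  by rewrite fineK// vol_ball_scale// fin_numM// vol_ball1_fin.
have CE : C = c1 + q * C.
  apply/eqP; rewrite -subr_eq -{1}(mul1r C) -mulrBl /C mulrC divfK//.
  by rewrite subr_eq0 gt_eqF.
have c10 : 0 <= c1.
  by apply/fine_ge0/integral_ge0 => x _; rewrite lee_fin ind_ball_ge0.
have C0 : 0 <= C by rewrite divr_ge0// subr_ge0 ltW.
exists C; elim => [|n IH].
  rewrite integral0_eq ?lee_fin// => z _; rewrite /shell_pow expr0.
  by case: ifPn => // /andP[h1 h2]; move: (le_lt_trans h1 h2); rewrite ltxx.
pose g (z : 'rV[R]_N) : R :=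
  if 2 <= enorm z < 2 ^+ n.+1 then enorm z `^ (- (N%:R + a)) else 0.
have g0 z : 0 <= g z by rewrite /g; case: ifP; rewrite ?powR_ge0.
have mg : measurable_fun setT g.
  apply: measurable_fun_ifT; [|exact: mpow|exact: measurable_cst].
  by apply: measurable_and; [apply: measurable_fun_ler|apply: measurable_fun_ltr];
  first [exact: menorm|exact: measurable_cst].
apply: (@le_trans _ _ (\int[mu]_z (ind_ball 2 z + g z)%:E)%E).
  apply: le_integral_EFin => //.
    by apply: measurable_funD => //; apply: measurable_fun_ind_ball; exact: measurable_id.
  move=> z; rewrite /shell_pow /g /ind_ball; case: ifPn => [/andP[z1 zn]|_]; last first.
    by rewrite addr_ge0//; case: ifP; rewrite ?powR_ge0.
  have [z2|z2] /= := ltP (enorm z) 2; last by rewrite add0r zn.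
  rewrite addr0 powRN invf_le1 ?powR_gt0 ?(lt_le_trans ltr01 z1)//.
  by rewrite -[leLHS](powRr0 (enorm z)) ler_powR// addr_ge0// ltW.
rewrite (integral_EFinD _ mg (ind_ball_ge0 2) g0); last first.
  by apply: measurable_fun_ind_ball; exact: measurable_id.
rewrite CE EFinD leeD//; first by rewrite -c1E.
rewrite (integral_EFin_scale _ mg g0 (c := 2))//.
rewrite (_ : integral _ _ _ = q%:E * \int[mu]_z (shell_pow a n z)%:E)%E.
  rewrite EFinM lee_pmul// ?lee_fin ?powR_ge0// integral_ge0// => z _.
  by rewrite lee_fin.
rewrite -(integral_EFinZl (measurable_shell_pow a n) (shell_pow_ge0 a n) (powR_ge0 _ _)).
apply: eq_integral => z _; congr EFin.
rewrite /g /shell_pow enormZ ger0_norm// ler_pMr// exprS ltr_pM2l//.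
case: ifP => _; rewrite ?mulr0// powRM ?enorm_ge0// mulrA; congr (_ * _).
rewrite -powR_mulrn// -powRD; last by rewrite pnatr_eq0 implybT.
by congr (_ `^ _); lra.
Qed.

Lemma integral_tail_pow_fin a : 0 < a ->
  (\int[mu]_z (tail_pow a 1 z)%:E)%E \is a fin_num.
Proof.
move=> a0; rewrite ge0_fin_numE; last first.
  by apply: integral_ge0 => z _; rewrite lee_fin tail_pow_ge0.
have [C HC] := integral_shell_pow_le a0.
apply: (@le_lt_trans _ _ C%:E); last exact: ltry.
have lim z : (shell_pow a n z)%:E @[n --> \oo] --> (tail_pow a 1 z)%:E.
  apply: cvg_near_cst.
  exists (Num.truncn (enorm z)).+1 => // n /= zn; congr EFin.
  rewrite /shell_pow /tail_pow; case: (leP 1 (enorm z)) => //= z1; rewrite ifT//.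
  apply: (lt_trans (truncnS_gt _)); rewrite -natrX ltr_nat.
  by rewrite (leq_ltn_trans zn)// ltn_expl.
have nd m n : (m <= n)%N -> forall z, shell_pow a m z <= shell_pow a n z.
  move=> mn z; rewrite /shell_pow; case: ifPn => [/andP[z1 z2]|_].
    by rewrite ifT// z1 (lt_le_trans z2)//= -!natrX ler_nat leq_pexp2l.
  by case: ifP; rewrite ?powR_ge0.
have H : (\int[mu]_z (shell_pow a n z)%:E)%E @[n --> \oo] -->
    (\int[mu]_z (limn (fun n => (shell_pow a n z)%:E)))%E.
  apply: cvg_monotone_convergence => //.
  - by move=> n; by apply/measurable_EFinP; exact: measurable_shell_pow.
  - by move=> n z _; rewrite lee_fin.
  - by move=> z _ m n mn; rewrite lee_fin; exact: nd.
move: H; rewrite (_ : (fun z => limn _) = (fun z => (tail_pow a 1 z)%:E)); last first.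
  by apply/funext => z; apply/cvg_lim.
move=> H; rewrite -(cvg_lim _ H)//; apply: lime_le.
  by apply/cvg_ex; eexists; exact: H.
by apply: nearW => n; exact: HC.
Qed.

Lemma integral_tail_pow_small a d : 0 < a -> 0 < d ->
  exists2 K0, 0 < K0 & forall K, K0 <= K ->
    (\int[mu]_z (tail_pow a K z)%:E <= d%:E)%E.
Proof.
move=> a0 d0; have I1 := integral_tail_pow_fin a0.
pose c := fine (\int[mu]_z (tail_pow a 1 z)%:E)%E.
have c0 : 0 <= c.
  by apply/fine_ge0/integral_ge0 => z _; rewrite lee_fin tail_pow_ge0.
pose K0 := ((c + 1) / d) `^ (a^-1).
have K00 : 0 < K0 by rewrite powR_gt0// divr_gt0// ltr_wpDl.
exists K0 => // K K0K; have K0' : 0 < K by exact: lt_le_trans K0K.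
rewrite integral_tail_pow_scale// -(fineK I1) -/c -EFinM lee_fin.
rewrite powRN mulrC ler_pdivrMr ?powR_gt0//.
have K0a : K0 `^ a = (c + 1) / d.
  rewrite /K0 -powRrM mulVf ?gt_eqF// powRr1// divr_ge0 ?ltW//.
  by rewrite ltr_wpDl.
have : K0 `^ a <= K `^ a by rewrite ge0_ler_powR ?nnegrE// ltW.
rewrite K0a ler_pdivrMr// mulrC => H; apply: le_trans H.
by rewrite lerDl.
Qed.

Definition head_pow (a r : R) (z : 'rV[R]_N) : R :=
  if 0 < enorm z < r then enorm z `^ (a - N%:R) else 0.

Lemma head_pow_ge0 a r z : 0 <= head_pow a r z.
Proof. by rewrite /head_pow; case: ifP; rewrite ?powR_ge0. Qed.

Lemma measurable_head_pow a r : measurable_fun setT (head_pow a r).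
Proof.
rewrite /head_pow; apply: measurable_fun_ifT; [|exact: mpow|exact: measurable_cst].
by apply: measurable_and; apply: measurable_fun_ltr;
  first [exact: menorm|exact: measurable_cst].
Qed.

(** Inversion carries |z|^(a-N) on the unit ball to |z|^(-N-a) outside it: both are slices of the
    kernel [h], homogeneous of degree -2N. *)
Let integral_head_pow1_fin a : 0 < a ->
  (\int[mu]_z (head_pow a 1 z)%:E < +oo)%E.
Proof.
move=> a0; have [e e1] := ex_unit_rV R N_gt0.
pose h (x y c : R) : R := if 0 < y < x then y `^ (a - N%:R) * x `^ (- (N%:R + a)) else 0.
have h0 x y c : 0 <= h x y c.
  by rewrite /h; case: ifP => // _; rewrite mulr_ge0 ?powR_ge0.
have hz x y c : x <= 0 \/ y <= 0 -> h x y c = 0.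
  move=> [x0|y0]; rewrite /h ifF//; apply/negP => /andP[h1 h2].
    by move: (lt_trans h1 h2); rewrite ltNge x0.
  by move: h1; rewrite ltNge y0.
have hom l x y c : 0 < l -> l ^+ (2 * N) * h (l * x) (l * y) (l * c) = h x y c.
  move=> l0; rewrite /h pmulr_rgt0// ltr_pM2l//; case: ifPn => [/andP[y0 yx]|]; last by rewrite mulr0.
  have x0 : 0 < x := lt_trans y0 yx.
  rewrite !powRM ?(ltW l0) ?(ltW x0) ?(ltW y0)// mulrACA mulrA -powRD; last by rewrite (gt_eqF l0) implybT.
rewrite !mulrA -powR_mulrn ?(ltW l0)// -powRD; last by rewrite (gt_eqF l0) implybT.
  rewrite (_ : (2 * N)%:R + _ = 0) ?powRr0 ?mul1r// natrM; lra.
have mh : measurable_fun setT (fun z : 'rV[R]_N * 'rV[R]_N =>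
    h (enorm z.1) (enorm z.2) (enorm (z.1 - z.2))).
  have m1 : measurable_fun setT (fun z : 'rV[R]_N * 'rV[R]_N => enorm z.1).
    by apply: measurable_fun_enorm; exact: measurable_fst.
  have m2 : measurable_fun setT (fun z : 'rV[R]_N * 'rV[R]_N => enorm z.2).
    by apply: measurable_fun_enorm; exact: measurable_snd.
  apply: measurable_fun_ifT; last exact: measurable_cst.
    by apply: measurable_and; apply: measurable_fun_ltr.
  apply: measurable_funM.
    exact: (measurableT_comp (@measurable_powR R _) m2).
  exact: (measurableT_comp (@measurable_powR R _) m1).
rewrite (_ : (fun y => _) = (fun y : 'rV[R]_N => (h 1 (enorm y) (enorm (e - y)))%:E)); last first.
  by apply/funext => y; rewrite /h /head_pow powR1 mulr1.
rewrite (integral_swap N_gt0 h0 hz hom mh e1).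
apply: (@le_lt_trans _ _ (\int[mu]_z (tail_pow a 1 z)%:E)%E).
  apply: le_integral_EFin.
  - apply: measurable_fun_ifT; last exact: measurable_cst.
      by apply: measurable_and; apply: measurable_fun_ltr.
    by apply: measurable_funM => //; exact: measurable_cst.
  - exact: measurable_tail_pow.
  - by move=> y.
  - move=> y; rewrite /h /tail_pow ltr01 /= powR1 mul1r.
    by case: ltP => [/ltW ->//|_]; case: ifP; rewrite ?powR_ge0.
by rewrite -ge0_fin_numE ?integral_tail_pow_fin// integral_ge0// => z _;
  rewrite lee_fin tail_pow_ge0.
Qed.

Lemma integral_head_pow_fin a r : 0 < a -> 0 < r ->
  (\int[mu]_z (head_pow a r z)%:E)%E \is a fin_num.
Proof.
move=> a0 r0; rewrite (integral_EFin_scale r0); last 2 first.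
- exact: measurable_head_pow.
- exact: head_pow_ge0.
rewrite (_ : integral _ _ _ =
    (r ^+ N * r `^ (a - N%:R))%:E * \int[mu]_z (head_pow a 1 z)%:E)%E.
  rewrite fin_numM// ge0_fin_numE ?integral_head_pow1_fin//.
  by apply: integral_ge0 => z _; rewrite lee_fin head_pow_ge0.
have k0 : 0 <= r ^+ N * r `^ (a - N%:R).
  by rewrite mulr_ge0 ?powR_ge0// exprn_ge0// ltW.
rewrite -(integral_EFinZl (measurable_head_pow a 1) (head_pow_ge0 a 1) k0).
apply: eq_integral => z _; congr EFin.
rewrite /head_pow enormZ gtr0_norm// pmulr_rgt0// gtr_pMr//.
by case: ifP => _; rewrite ?mulr0// powRM ?enorm_ge0 ?ltW// mulrA.
Qed.

End power_integrals.

(** * Comparison of the outer and inner kernels *)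

Ltac mfun :=
  lazymatch goal with
  | |- measurable_fun _ (fun x => andb (@?f x) (@?g x)) =>
      apply: (@measurable_and _ _ _ f g); mfun
  | |- measurable_fun _ (fun x => (@?f x <= @?g x)%R) =>
      apply: (@measurable_fun_ler _ _ _ _ f g); mfun
  | |- measurable_fun _ (fun x => (@?f x < @?g x)%R) =>
      apply: (@measurable_fun_ltr _ _ _ _ f g); mfun
  | |- measurable_fun _ (fun x => @?f x `^ ?q) =>
      apply: (measurableT_comp (@measurable_powR _ q) (g := f)); mfun
  | |- measurable_fun _ (fun x => (@?f x * @?g x)%R) =>
      apply: (@measurable_funM _ _ _ _ f g); mfun
  | |- measurable_fun _ (fun x => (@?f x ^-1)%R) =>
      apply: (measurableT_comp (@measurable_invr _) (g := f)); mfun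
  | |- measurable_fun _ (fun x => (@?f x - @?g x)%R) =>
      first [apply: (@measurable_funB _ _ _ _ f g)
            |apply: (@measurable_fun_subV _ _ _ _ f g)]; mfun
  | |- measurable_fun _ (fun x => (- @?f x)%R) =>
      first [apply: (@measurable_funN _ _ _ _ f)
            |apply: (@measurable_fun_oppV _ _ _ _ f)]; mfun
  | |- measurable_fun _ (fun x => (@?f x + @?g x)%R) =>
      first [apply: (@measurable_funD _ _ _ _ f g)
            |apply: (@measurable_fun_addV _ _ _ _ f g)]; mfun
  | |- measurable_fun _ (fun x => (@?f x *: @?g x)%R) =>
      apply: (@measurable_fun_scaleV _ _ _ _ f g); mfun
  | |- measurable_fun _ (fun x => `| @?f x |) =>
      apply: (measurableT_comp (@normr_measurable _ setT) (g := f)); mfun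
  | |- measurable_fun _ (fun x => enorm (@?f x)) =>
      apply: (@measurable_fun_enorm _ _ _ _ f); mfun
  | |- measurable_fun _ (fun x => x.1) => exact: measurable_fst
  | |- measurable_fun _ (fun x => x.2) => exact: measurable_snd
  | |- measurable_fun _ (fun x => x) => exact: measurable_id
  | |- measurable_fun _ id => exact: measurable_id
  | |- measurable_fun _ (cst _) => exact: measurable_cst
  | |- measurable_fun _ _ => first [exact: measurable_cst | assumption | apply: measurable_fun_ifT; mfun]
  end.


(** Combines r^b >= 1 + b ln r with ln r <= r - 1. It gives the first-order vanishing of 1 -
    |y|^beta on the unit sphere. *)
Lemma powR_Bernoulli (R : realType) (r b : R) : 1 <= r ->
  1 - r `^ b <= `|b| * (r - 1).
Proof.
move=> r1; have r0 : 0 < r by exact: lt_le_trans r1.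
have ln0 : 0 <= ln r by exact: ln_ge0.
have : 1 + b * ln r <= r `^ b by rewrite /powR gt_eqF// expR_ge1Dx.
have : ln r <= r - 1.
  have := expR_ge1Dx (ln r); rewrite lnK ?posrE//; lra.
have : - b * ln r <= `|b| * ln r by rewrite ler_wpM2r// -normrN ler_norm.
have := normr_ge0 b; nra.
Qed.

(** The bound is linear for all r >= 1, not only near 1; this is where tau <= 1 enters. *)
Lemma powR_sub1_le (R : realType) (r tau : R) : 1 <= r -> tau <= 1 ->
  `|r `^ tau - 1| <= (1 + `|tau|) * (r - 1).
Proof.
move=> r1 tau1; have [t0|t0] := leP 0 tau.
  rewrite ger0_norm ?subr_ge0; last by rewrite -(powRr0 r) ler_powR.
  apply: (@le_trans _ _ (r - 1)).
    by rewrite lerD2r -[leRHS]powRr1 ?(le_trans ler01)// ler_powR.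
  by rewrite ler_peMl ?subr_ge0// lerDl.
rewrite ler0_norm ?subr_le0; last by rewrite -(powRr0 r) ler_powR// ltW.
rewrite opprB; apply: (le_trans (powR_Bernoulli _ r1)).
by rewrite ler_wpM2r ?subr_ge0// lerDr.
Qed.

Lemma exprD1_le (R : realType) (n : nat) (x : R) : 0 <= x <= 1 ->
  (1 + x) ^+ n <= 1 + (2 ^+ n - 1) * x.
Proof.
move=> /andP[x0 x1]; elim: n => [|n IH]; first by rewrite !expr0 subrr mul0r addr0.
rewrite !exprS; have c : 0 <= (2 : R) ^+ n - 1 by rewrite subr_ge0 exprn_ege1// ler1n.
move: ((1 + x) ^+ n) (2 ^+ n) IH c => u v IH c.
have : (1 + x) * u <= (1 + x) * (1 + (v - 1) * x) by rewrite ler_wpM2l// addr_ge0.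
have : x * x <= x by rewrite ler_piMl.
nra.
Qed.

Section kernel.
Context {R : realType} {N : nat}.
Variables (p sp tau : R).
Hypotheses (N_gt0 : (0 < N)%N) (p_gt1 : 1 < p) (sp_gt0 : 0 < sp)
  (sp_ltp : sp < p) (tau_le1 : tau <= 1) (tau_sp : tau * (p - 1) < sp).
Local Notation mu := (@lebesgue_rV R N).
Implicit Types (e y : 'rV[R]_N) (del eps eta : R).

(** Modulus of the integrand of the operator applied to |y|^tau at the unit vector e. The integrand
    changes sign across the unit sphere, hence the separate outer and inner parts. *)
Definition kern (e y : 'rV[R]_N) : R :=
  `|enorm y `^ tau - 1| `^ (p - 1) * enorm (e - y) `^ (- (N%:R + sp)).

Lemma kern_ge0 e y : 0 <= kern e y.
Proof. by rewrite mulr_ge0 ?powR_ge0. Qed.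

Lemma measurable_kern e : measurable_fun setT (kern e).
Proof. by rewrite /kern; mfun. Qed.

Definition outer_kern (e : 'rV[R]_N) (eps : R) (y : 'rV[R]_N) : R :=
  if (1 < enorm y) && (eps <= enorm (e - y)) then kern e y else 0.

(** The ball of radius [del] is left out because a singular barrier |y|^(-gam) cannot be followed
    down to its centre; the radius depends only on the kernel. *)
Definition inner_kern (e : 'rV[R]_N) (del eps : R) (y : 'rV[R]_N) : R :=
  if (del < enorm y) && ((enorm y < 1) && (eps <= enorm (e - y)))
  then kern e y else 0.

Lemma outer_kern_ge0 e eps y : 0 <= outer_kern e eps y.
Proof. by rewrite /outer_kern; case: ifP => _ //; exact: kern_ge0. Qed.

Lemma inner_kern_ge0 e del eps y : 0 <= inner_kern e del eps y.
Proof. by rewrite /inner_kern; case: ifP => _ //; exact: kern_ge0. Qed.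

Lemma measurable_outer_kern e eps : measurable_fun setT (outer_kern e eps).
Proof. by rewrite /outer_kern /kern; mfun. Qed.

Lemma measurable_inner_kern e del eps : measurable_fun setT (inner_kern e del eps).
Proof. by rewrite /inner_kern /kern; mfun. Qed.

(** Exponent of the weight created by the inversion: -2N from the Jacobian, N + sp from |e - y|, -
    tau (p - 1) from the profile. *)
Let beta := sp - N%:R - tau * (p - 1).

(** Its domain is the inverted image of that of [inner_kern]: |y| > del becomes del |y| < 1, and |e
    - y| >= eps becomes |e - y| >= eps |y|. The outer domain differs from it only by [shell] and
    [tail]. *)
Let main (e : 'rV[R]_N) (del eps : R) (y : 'rV[R]_N) : R :=
  if (1 < enorm y) && ((del * enorm y < 1) && (eps * enorm y <= enorm (e - y)))
  then kern e y else 0.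

Let main_beta (e : 'rV[R]_N) (del eps : R) (y : 'rV[R]_N) : R :=
  if (1 < enorm y) && ((del * enorm y < 1) && (eps * enorm y <= enorm (e - y)))
  then enorm y `^ beta * kern e y else 0.

Let shell (e : 'rV[R]_N) (eps : R) (y : 'rV[R]_N) : R :=
  if (1 < enorm y) && ((eps <= enorm (e - y)) && (enorm (e - y) < eps * enorm y))
  then kern e y else 0.

Let tail (e : 'rV[R]_N) (del : R) (y : 'rV[R]_N) : R :=
  if 1 <= del * enorm y then kern e y else 0.

(* The antisymmetry of the kernel in disguise: this is the inversion
   y |-> y / |y|^2. *)
Let inner_kernE e del eps : 0 < del < 1 -> 0 < eps -> enorm e = 1 ->
  (\int[mu]_y (inner_kern e del eps y)%:E = \int[mu]_y (main_beta e del eps y)%:E)%E.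
Proof.
move=> /andP[d0 d1] eps0 e1.
(* The homogeneous extension of both integrands: putting 1 in the first slot gives [inner_kern], in
   the second slot [main_beta]. The exponent [beta] makes the degree -2N. *)
pose h (a b c : R) : R := if (del * a < b) && ((b < a) && (eps * a <= c)) then
  a `^ beta * (`|b `^ tau - a `^ tau| `^ (p - 1) * c `^ (- (N%:R + sp))) else 0.
have hpos a b c : (del * a < b) && ((b < a) && (eps * a <= c)) -> [/\ 0 < a, 0 < b & 0 < c].
  move=> /and3P[h1 h2 h3]; have a0 : 0 < a by nra.
  split => //; first by apply: lt_trans h1; rewrite mulr_gt0.
  by apply: lt_le_trans h3; rewrite mulr_gt0.
have h0 a b c : 0 <= h a b c by rewrite /h; case: ifP => // _; rewrite !mulr_ge0 ?powR_ge0.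
have hz a b c : a <= 0 \/ b <= 0 -> h a b c = 0.
  move=> ab; rewrite /h; case: ifP => // /hpos[a0 b0 _].
  by case: ab; rewrite leNgt ?a0 ?b0.
have hom l a b c : 0 < l -> l ^+ (2 * N) * h (l * a) (l * b) (l * c) = h a b c.
  move=> l0; rewrite /h !(mulrCA _ l) !ltr_pM2l// ler_pM2l//.
  case: ifPn => [/hpos[a0 b0 c0]|_]; last by rewrite mulr0.
  rewrite !(powRM _ (ltW l0)) ?ltW// -mulrBr normrM (ger0_norm (powR_ge0 l _)).
  rewrite (powRM (p - 1)) ?powR_ge0// -powRrM.
  rewrite (_ : _ * _ = l ^+ (2 * N) * (l `^ beta * l `^ (tau * (p - 1)) * l `^ (- (N%:R + sp))) *
    (a `^ beta * (`|b `^ tau - a `^ tau| `^ (p - 1) * c `^ (- (N%:R + sp))))); last first.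
    rewrite -!mulrA; do 2!congr (_ * _); rewrite [LHS]mulrCA; congr (_ * _).
    by rewrite [RHS]mulrCA; congr (_ * _); rewrite [LHS]mulrCA.
  rewrite -!powRD; [|by rewrite (gt_eqF l0) implybT..].
  rewrite -powR_mulrn ?(ltW l0)// -powRD; last by rewrite (gt_eqF l0) implybT.
  rewrite (_ : (2 * N)%:R + _ = 0) ?powRr0 ?mul1r// natrM /beta; lra.
have mh : measurable_fun setT (fun z : 'rV[R]_N * 'rV[R]_N =>
    h (enorm z.1) (enorm z.2) (enorm (z.1 - z.2))).
  by rewrite /h; mfun.
rewrite [RHS](_ : _ = \int[mu]_y (h (enorm y) 1 (enorm (e - y)%R))%:E)%E; last first.
  apply: eq_integral => y _; congr EFin; rewrite /main_beta /h andbCA.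
  by case: ifP => //; rewrite /kern powR1 distrC.
rewrite -(integral_swap N_gt0 h0 hz hom mh e1).
apply: eq_integral => y _; congr EFin; rewrite /inner_kern /h !mulr1.
by rewrite !powR1 mul1r.
Qed.

Let c0 := (1 + `|tau|) `^ (p - 1).

(** The profile vanishes on the unit sphere like |y| - 1 <= |e - y|, which gains p - 1 powers of |e
    - y|. *)
Let kern_le e y : enorm e = 1 -> 1 < enorm y ->
  kern e y <= c0 * enorm (e - y) `^ (p - 1 - (N%:R + sp)).
Proof.
move=> e1 y1; have d0 : 0 < enorm (e - y).
  by apply: lt_le_trans (_ : enorm y - 1 <= _); rewrite ?subr_gt0// -e1 enormBC enorm_dist.
have yd : enorm y - 1 <= enorm (e - y) by rewrite -e1 enormBC enorm_dist.
rewrite /kern [X in _ <= c0 * X]powRD; last by rewrite (gt_eqF d0) implybT.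
rewrite mulrA ler_wpM2r ?powR_ge0// /c0 -powRM ?addr_ge0 ?enorm_ge0//.
rewrite ge0_ler_powR ?nnegrE ?subr_ge0 ?mulr_ge0 ?addr_ge0 ?enorm_ge0 ?(ltW p_gt1)//.
apply: (le_trans (powR_sub1_le (ltW y1) tau_le1)).
by rewrite ler_wpM2l// addr_ge0.
Qed.

Let outer_split e del eps : 0 < del < 1 -> 0 < eps ->
  (\int[mu]_y (outer_kern e eps y)%:E <= \int[mu]_y (main e del eps y)%:E
   + (\int[mu]_y (shell e eps y)%:E + \int[mu]_y (tail e del y)%:E))%E.
Proof.
move=> /andP[d0 d1] eps0; have mk := measurable_kern e.
have k0 := kern_ge0 e.
have m1 : measurable_fun setT (main e del eps) by rewrite /main /kern; mfun.
have m2 : measurable_fun setT (shell e eps) by rewrite /shell /kern; mfun.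
have m3 : measurable_fun setT (tail e del) by rewrite /tail /kern; mfun.
have p1 y : 0 <= main e del eps y by rewrite /main; case: ifP.
have p2 y : 0 <= shell e eps y by rewrite /shell; case: ifP.
have p3 y : 0 <= tail e del y by rewrite /tail; case: ifP.
rewrite -(integral_EFinD m2 m3 p2 p3) -integral_EFinD//; last 2 first.
- exact: measurable_funD.
- by move=> y; rewrite addr_ge0.
apply: le_integral_EFin.
- by rewrite /outer_kern /kern; mfun.
- by apply: measurable_funD => //; apply: measurable_funD.
- by move=> y; rewrite /outer_kern; case: ifP.
move=> y; rewrite /outer_kern /main /shell /tail.
case: (ltP 1 (enorm y)) => y1 /=; last by rewrite !add0r; case: ifP.
have [h1|h1] /= := ltP (del * enorm y) 1; last first.
  rewrite add0r; apply: (@le_trans _ _ (kern e y)); first by case: ifP.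
  by rewrite lerDr; case: ifP.
rewrite addr0; have [h2|h2] /= := leP (eps * enorm y) (enorm (e - y)).
  by rewrite andbF addr0; case: ifP.
by rewrite add0r andbT.
Qed.

(** The truncation |e - y| >= eps is not invariant under inversion, but the mismatch has thickness
    of order eps^2 around a sphere of radius eps: its volume is O(eps^(N+1)), the kernel there is
    O(eps^(p-1-N-sp)), and the product O(eps^(p-sp)) tends to 0 since sp < p. *)
Let shell_small eta : 0 < eta -> exists2 eps0, 0 < eps0 &
  forall eps e, 0 < eps < eps0 -> enorm e = 1 ->
  (\int[mu]_y (shell e eps y)%:E <= eta%:E)%E.
Proof.
move=> eta0; pose q := p - 1 - (N%:R + sp); pose V := fine (@vol_ball R N 1).
have VE : @vol_ball R N 1 = V%:E by rewrite fineK// vol_ball1_fin.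
have V0 : 0 <= V by apply/fine_ge0/ltW/vol_ball1_gt0.
pose C := c0 * (1 + 2 `^ q) * (V * ((2 ^+ N - 1) * 2)).
have c0_ge0 : 0 <= c0 by exact: powR_ge0.
have N2 : 0 <= (2 : R) ^+ N - 1 by rewrite subr_ge0 exprn_ege1// ler1n.
have C0 : 0 <= C by rewrite /C !mulr_ge0// addr_ge0// powR_ge0.
pose eps1 := (eta / (C + 1)) `^ ((p - sp)^-1).
have psp : 0 < p - sp by rewrite subr_gt0.
have eps10 : 0 < eps1 by rewrite powR_gt0// divr_gt0// ltr_wpDl.
exists (Num.min eps1 2^-1); first by rewrite lt_min eps10 invr_gt0 ltr0n.
move=> eps e /andP[eps0]; rewrite lt_min => /andP[epsl epsh] e1.
(* From |e - y| < eps |y| <= eps (1 + |e - y|) follows |e - y| < eps / (1 - eps), which is at most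
   this [r] for eps <= 1/2. *)
pose r := eps * (1 + 2 * eps).
have r0 : 0 < r by rewrite mulr_gt0// addr_gt0// mulr_gt0.
have rle : r <= 2 * eps by rewrite /r; nra.
(* The factor 1 + 2^q covers both signs of q, as eps <= |e - y| <= 2 eps. *)
pose K := c0 * ((1 + 2 `^ q) * eps `^ q).
have K0 : 0 <= K by rewrite !mulr_ge0 ?addr_ge0 ?powR_ge0.
pose g (y : 'rV[R]_N) : R := if (eps <= enorm y) && (enorm y < r) then 1 else 0.
have g0 y : 0 <= g y by rewrite /g; case: ifP.
have mg : measurable_fun setT g by rewrite /g; mfun.
apply: (@le_trans _ _ (K%:E * \int[mu]_y (g y)%:E)%E).
  rewrite (_ : \int[mu]_y (g y)%:E = \int[mu]_y (g (y - e)%R)%:E)%E; last first.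
    apply: (@ge0_integral_translate _ _ (fun y => (g y)%:E)).
      exact/measurable_EFinP.
    by move=> y; rewrite lee_fin.
  have mge : measurable_fun setT (fun y : 'rV[R]_N => g (y - e)).
    by apply: (measurableT_comp mg); mfun.
  rewrite -(integral_EFinZl mge (fun y => g0 (y - e)) K0); apply: le_integral_EFin.
  - by rewrite /shell /kern; mfun.
  - by apply: measurable_funM => //; exact: measurable_cst.
  - by move=> y; rewrite /shell; case: ifP => // _; exact: kern_ge0.
  move=> y; rewrite /shell /g (enormBC y e); case: ifPn => [/and3P[y1 h1 h2]|_]; last first.
    by rewrite mulr_ge0//; case: ifP.
  have yle : enorm y <= 1 + enorm (e - y).
    by rewrite -lerBlDl -e1 enormBC enorm_dist.
  have d : enorm (e - y) < r by rewrite /r; nra.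
  rewrite h1 d mulr1; apply: (le_trans (kern_le e1 y1)).
  rewrite /K ler_wpM2l// -/q.
  have [q0|q0] := leP 0 q.
    apply: (@le_trans _ _ ((2 * eps) `^ q)).
      rewrite ge0_ler_powR ?nnegrE ?enorm_ge0 ?mulr_ge0 ?(ltW eps0)//.
      exact: le_trans (ltW d) rle.
    by rewrite powRM ?(ltW eps0)// ler_wpM2r ?powR_ge0// lerDr.
  apply: (@le_trans _ _ (eps `^ q)).
    have E (x : R) : x `^ q = (x `^ (- q))^-1 by rewrite powRN invrK.
    rewrite !E lef_pV2 ?posrE ?powR_gt0//; last exact: lt_le_trans h1.
    rewrite ge0_ler_powR ?nnegrE ?enorm_ge0 ?(ltW eps0)//.
    by rewrite oppr_ge0 ltW.
  by rewrite ler_peMl ?powR_ge0// lerDl powR_ge0.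
have gE : (\int[mu]_y (g y)%:E = (V * (r ^+ N - eps ^+ N))%:E)%E.
  have : (@vol_ball R N r = @vol_ball R N eps + \int[mu]_y (g y)%:E)%E.
    rewrite /vol_ball -integral_EFinD//; last 2 first.
    - by apply: measurable_fun_ind_ball; exact: measurable_id.
    - exact: ind_ball_ge0.
    apply: eq_integral => y _; congr EFin; rewrite /ind_ball /g.
    have [h|h] /= := ltP (enorm y) eps; last by rewrite add0r.
    rewrite addr0 ifT// (lt_le_trans h)// /r; nra.
  rewrite (vol_ball_scale r0) (vol_ball_scale eps0) VE -!EFinM.
  case: (integral _ _ _) => [x|//|//]; rewrite -EFinD => -[E]; congr EFin.
  by rewrite mulrBr (mulrC V) E (mulrC V) addrC addKr.
rewrite gE -EFinM lee_fin.
have re : r ^+ N - eps ^+ N <= eps ^+ N * ((2 ^+ N - 1) * (2 * eps)).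
  rewrite /r exprMn -[X in _ - X]mulr1 -mulrBr ler_wpM2l ?exprn_ge0 ?(ltW eps0)//.
  rewrite lerBlDl; apply: exprD1_le; apply/andP; split; first by rewrite mulr_ge0// ltW.
  by move: epsh; lra.
apply: (@le_trans _ _ (C * eps `^ (p - sp))).
  apply: (@le_trans _ _ (K * (V * (eps ^+ N * ((2 ^+ N - 1) * (2 * eps)))))).
    by rewrite !ler_wpM2l.
  rewrite (_ : eps `^ (p - sp) = eps `^ q * (eps ^+ N * eps)); last first.
    rewrite -[X in _ * X]exprSr -powR_mulrn ?(ltW eps0)// -powRD; last by rewrite (gt_eqF eps0) implybT.
    by congr (_ `^ _); rewrite /q -natr1; lra.
  rewrite /C /K le_eqVlt; apply/orP; left; apply/eqP.
  have G (x1 x2 x3 x4 x5 x6 x7 : R) :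
      x1 * ((1 + x2) * x5) * (x3 * (x6 * ((x4 - 1) * (2 * x7)))) =
      x1 * (1 + x2) * (x3 * ((x4 - 1) * 2)) * (x5 * (x6 * x7)) by ring.
  exact: G.
have : eps `^ (p - sp) <= eta / (C + 1).
  apply: (@le_trans _ _ (eps1 `^ (p - sp))).
    by rewrite ge0_ler_powR ?nnegrE ?ltW.
  by rewrite -powRrM mulVf ?gt_eqF// powRr1// ltW// divr_gt0// ltr_wpDl.
rewrite ler_pdivlMr ?ltr_wpDl// => H; apply: le_trans H; rewrite mulrDr mulr1 mulrC.
by rewrite lerDl powR_ge0.
Qed.

(** For |y| >= 2 one has |e - y| >= |y| / 2, so the kernel is at most C |y|^(-N-a) with
    [a = sp - max(0, tau) (p - 1)], positive by tau (p - 1) < sp. *)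
Let tail_small eta : 0 < eta -> exists2 del0, 0 < del0 &
  forall del e, 0 < del < del0 -> enorm e = 1 ->
  (\int[mu]_y (tail e del y)%:E <= eta%:E)%E.
Proof.
move=> eta0; pose a := sp - Num.max 0 tau * (p - 1).
have a0 : 0 < a.
  by rewrite /a subr_gt0; case: (leP 0 tau) => // _; rewrite mul0r.
pose C : R := 2 `^ (N%:R + sp).
have C0 : 0 < C by rewrite powR_gt0.
have [K0 K00 HK] := @integral_tail_pow_small R N a _ a0 (divr_gt0 eta0 C0).
exists (Num.min (K0^-1) 2^-1); first by rewrite lt_min !invr_gt0 K00 ltr0n.
move=> del e /andP[d0]; rewrite lt_min => /andP[dK d2] e1.
have dK' : K0 <= del^-1 by rewrite -[K0]invrK lef_pV2 ?posrE ?invr_gt0// ltW.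
apply: (@le_trans _ _ (C%:E * \int[mu]_y (tail_pow a del^-1 y)%:E)%E); last first.
  apply: (@le_trans _ _ (C%:E * (eta / C)%:E)%E).
    by rewrite lee_pmul2l//; exact: HK.
  by rewrite -EFinM mulrCA divff ?mulr1 ?gt_eqF.
rewrite -(integral_EFinZl (measurable_tail_pow _ _) (tail_pow_ge0 _ _) (ltW C0)).
apply: le_integral_EFin.
- by rewrite /tail /kern; mfun.
- by apply: measurable_funM; [exact: measurable_cst|exact: measurable_tail_pow].
- by move=> y; rewrite /tail; case: ifP => // _; exact: kern_ge0.
move=> y; rewrite /tail /tail_pow (_ : (1 <= del * enorm y) = (del^-1 <= enorm y)); last by rewrite -ler_pdivrMl// mulr1.
case: ifPn => [yd|_]; last by rewrite mulr0.
have y2 : 2 < enorm y.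
  apply: lt_le_trans yd; rewrite -[2]invrK ltf_pV2 ?posrE ?invr_gt0 ?ltr0n//.
have y0 : 0 < enorm y by apply: lt_trans y2.
have ye : enorm y / 2 <= enorm (e - y).
  have : enorm y - 1 <= enorm (e - y) by rewrite -e1 enormBC enorm_dist.
  by move: y2; lra.
rewrite /kern mulrC (_ : - (N%:R + a) = - (N%:R + sp) + Num.max 0 tau * (p - 1)); last by rewrite /a; ring.
rewrite [enorm y `^ (- _ + _)]powRD; last by rewrite (gt_eqF y0) implybT.
rewrite mulrA ler_pM ?powR_ge0//.
  have d0' : 0 < enorm (e - y) by apply: lt_le_trans ye; rewrite divr_gt0.
  rewrite !powRN ler_pdivlMr ?powR_gt0// mulrC ler_pdivrMr ?powR_gt0//.
  rewrite /C -powRM ?enorm_ge0// ge0_ler_powR ?nnegrE ?mulr_ge0 ?enorm_ge0//.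
    by rewrite addr_ge0// ltW.
  by rewrite mulrC -ler_pdivrMr.
rewrite powRrM ge0_ler_powR ?nnegrE ?powR_ge0 ?subr_ge0 ?(ltW p_gt1)//.
case: (leP 0 tau) => t0.
  rewrite ger0_norm ?gerBl// subr_ge0 -(powRr0 (enorm y)) ler_powR//.
  by apply/ltW/(lt_trans _ y2); rewrite ltr1n.
rewrite powRr0 ler0_norm.
  by rewrite opprB gerBl powR_ge0.
rewrite subr_le0 -(powRr0 (enorm y)) ler_powR ?ltW//.
by apply: (lt_trans _ y2); rewrite ltr1n.
Qed.

Let outer_le (del0 eta : R) : 0 < del0 -> 0 < eta -> exists2 del, 0 < del < Num.min del0 1 &
  exists2 eps0, 0 < eps0 & forall eps e, 0 < eps < eps0 -> enorm e = 1 ->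
  (\int[mu]_y (outer_kern e eps y)%:E <=
   \int[mu]_y (main e del eps y)%:E + eta%:E)%E.
Proof.
move=> d00 eta0; have eta2 : 0 < eta / 2 by rewrite divr_gt0.
have [eps0 eps00 Hs] := shell_small eta2; have [del1 del10 Ht] := tail_small eta2.
pose d := Num.min (Num.min del0 1) del1.
have d0 : 0 < d by rewrite !lt_min d00 ltr01.
have d2 : d / 2 < d by rewrite ltr_pdivrMr// ltr_pMr// ltr1n.
have dd : 0 < d / 2 < Num.min del0 1.
  by rewrite divr_gt0//= (lt_le_trans d2)// ge_min lexx.
exists (d / 2) => //; exists eps0 => // eps e /andP[e0 e1] ee.
have d1 : 0 < d / 2 < 1.
  by move: dd => /andP[-> /= dd]; rewrite (lt_le_trans dd)// ge_min lexx orbT.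
apply: (le_trans (outer_split e d1 e0)); rewrite leeD2l//.
rewrite [eta]splitr EFinD leeD ?Hs ?e0//; apply: Ht => //.
by rewrite divr_gt0//= (lt_le_trans d2)// ge_min lexx orbT.
Qed.

(** After inversion the difference is the integral of (1 - |y|^beta) [kern], at most |beta| c0 |e -
    y|^(p - sp - N) pointwise. This is integrable on bounded sets whatever the sign of beta; the 1
    in [L] pays for shell and tail. *)
Lemma outer_kern_le : exists2 del, 0 < del < 1 & exists L : R,
  exists2 eps0, 0 < eps0 & forall eps e, 0 < eps < eps0 -> enorm e = 1 ->
  (\int[mu]_y (outer_kern e eps y)%:E <=
   \int[mu]_y (inner_kern e del eps y)%:E + L%:E)%E.
Proof.
have [del dd [eps0 eps00 H]] := outer_le ltr01 ltr01.
have {dd} /andP[d0 d1] : 0 < del < 1 by rewrite minxx in dd.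
exists del; first by rewrite d0.
have psp : 0 < p - sp by rewrite subr_gt0.
(* On the domain of [main], |y| < 1 / del, hence |e - y| < r. *)
pose r := 1 + del^-1; have r0 : 0 < r by rewrite addr_gt0 ?invr_gt0.
pose C := `|beta| * c0; have C0 : 0 <= C by rewrite mulr_ge0 ?powR_ge0.
have If := @integral_head_pow_fin R N N_gt0 _ _ psp r0.
pose I := fine (\int[mu]_z (head_pow (p - sp) r z : R)%:E)%E.
exists (C * I + 1); exists eps0 => // eps e e0 e1.
apply: (le_trans (H _ _ e0 e1)); rewrite EFinD addeA leeD2r//.
move: e0 => /andP[e0 _].
rewrite inner_kernE ?d0// EFinM /I fineK//.
have hE : (\int[mu]_z (head_pow (p - sp) r z)%:E =
    \int[mu]_z (head_pow (p - sp) r (z - e)%R)%:E)%E.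
  apply: (@ge0_integral_translate _ _ (fun z => (head_pow (p - sp) r z)%:E)).
    by apply/measurable_EFinP; exact: measurable_head_pow.
  by move=> z; rewrite lee_fin head_pow_ge0.
have mh : measurable_fun setT (fun z : 'rV[R]_N => head_pow (p - sp) r (z - e)).
  by apply: (measurableT_comp (measurable_head_pow _ _)); mfun.
rewrite hE -(integral_EFinZl mh (fun z => head_pow_ge0 _ _ _) C0).
have mb : measurable_fun setT (main_beta e del eps) by rewrite /main_beta /kern; mfun.
have b0 y : 0 <= main_beta e del eps y.
  rewrite /main_beta. case: ifP => _. 2: exact: lexx.
  exact: mulr_ge0 (powR_ge0 _ _) (kern_ge0 _ _).
have mC : measurable_fun setT (fun z : 'rV[R]_N => C * head_pow (p - sp) r (z - e)).
  by apply: measurable_funM => //; exact: measurable_cst.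
have hC y : 0 <= C * head_pow (p - sp) r (y - e) by apply: (mulr_ge0 C0); exact: head_pow_ge0.
rewrite -(integral_EFinD mb mC b0 hC); apply: le_integral_EFin.
- by rewrite /main /kern; mfun.
- exact: measurable_funD.
- by move=> y; rewrite /main; case: ifP => _; [exact: kern_ge0|exact: lexx].
move=> y; rewrite /main /main_beta; case: ifPn => [/and3P[y1 h1 h2]|_]; last first.
  by rewrite add0r; exact: hC.
clear hC b0; have yd : enorm y - 1 <= enorm (e - y) by rewrite -e1 enormBC enorm_dist.
have dist0 : 0 < enorm (e - y) by apply: lt_le_trans yd; rewrite subr_gt0.
rewrite /head_pow enormBC dist0 ifT /=; last first.
  apply: (le_lt_trans (enormB _ _)); rewrite e1 ltrD2l.
  by rewrite -[ltRHS]mulr1 ltr_pdivlMl.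
rewrite -lerBlDl -{1}[kern e y]mul1r -mulrBl.
apply: (@le_trans _ _ (`|beta| * enorm (e - y) * (c0 * enorm (e - y) `^ (p - 1 - (N%:R + sp))))).
  apply: (@le_trans _ _ (`|beta| * enorm (e - y) * kern e y)).
    apply: ler_wpM2r; first exact: kern_ge0.
    apply: (le_trans (powR_Bernoulli _ (ltW y1))).
    by apply: ler_wpM2l; first exact: normr_ge0.
  apply: ler_wpM2l; first exact: mulr_ge0 (normr_ge0 _) (enorm_ge0 _).
  exact: kern_le.
rewrite mulrACA; apply: (ler_wpM2l C0).
rewrite -{1}(powRr1 (enorm_ge0 (e - y))) -powRD; last by rewrite (gt_eqF dist0) implybT.
by rewrite (_ : 1 + _ = p - sp - N%:R); [exact: lexx|ring].
Qed.

(** Now beta > 0, so the weight |y|^beta exceeds 1 for |y| > 1 and inversion makes the inner part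
    the larger one. The shell 3 <= |y| < 4, away from the unit sphere, contributes a definite
    surplus [eta]; half of it absorbs the shell and tail errors. *)
Lemma outer_kern_lt : tau < 0 -> 0 < sp - N%:R - tau * (p - 1) ->
  exists2 del, 0 < del < 1 & exists2 L : R, L < 0 &
  exists2 eps0, 0 < eps0 & forall eps e, 0 < eps < eps0 -> enorm e = 1 ->
  (\int[mu]_y (outer_kern e eps y)%:E <=
   \int[mu]_y (inner_kern e del eps y)%:E + L%:E)%E.
Proof.
move=> tau0 beta0.
pose V := fine (@vol_ball R N 1).
have VE : @vol_ball R N 1 = V%:E by rewrite fineK// vol_ball1_fin.
have V0 : 0 < V by rewrite -lte_fin -VE vol_ball1_gt0.
pose g (y : 'rV[R]_N) : R := if (3 <= enorm y) && (enorm y < 4) then 1 else 0.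
have g0 y : 0 <= g y by rewrite /g; case: ifP.
have mg : measurable_fun setT g by rewrite /g; mfun.
have gE : (\int[mu]_y (g y)%:E = (V * (4 ^+ N - 3 ^+ N))%:E)%E.
  have : (@vol_ball R N 4 = @vol_ball R N 3 + \int[mu]_y (g y)%:E)%E.
    rewrite /vol_ball -integral_EFinD//; last 2 first.
    - by apply: measurable_fun_ind_ball; exact: measurable_id.
    - exact: ind_ball_ge0.
    apply: eq_integral => y _; congr EFin; rewrite /ind_ball /g.
    have [h|h] /= := ltP (enorm y) 3; last by rewrite add0r.
    by rewrite addr0 ifT// (lt_le_trans h)// ler_nat.
  have p3 : 0 < 3 :> R by rewrite ltr0n.
  have p4 : 0 < 4 :> R by rewrite ltr0n.
  rewrite (vol_ball_scale p3) (vol_ball_scale p4) VE -!EFinM.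
  case: (integral _ _ _) => [x|//|//]; rewrite -EFinD => -[E]; congr EFin.
  by rewrite mulrBr (mulrC V) E (mulrC V) addrC addKr.
pose k := (3 `^ beta - 1) * ((1 - 3 `^ tau) `^ (p - 1) * 5 `^ (- (N%:R + sp))).
have t3 : (3 : R) `^ tau < 1.
  rewrite /powR pnatr_eq0 /= -[X in _ < X]expR0 ltr_expR.
  by rewrite (nmulr_rlt0 _ tau0) ln_gt0 ?ltr1n.
have b3 : 1 < (3 : R) `^ beta.
  by rewrite /powR pnatr_eq0 /= expR_gt1 mulr_gt0 ?ln_gt0 ?ltr1n.
have k0 : 0 < k.
  by rewrite /k !mulr_gt0 ?subr_gt0 ?powR_gt0 ?subr_gt0.
pose eta := k * (V * (4 ^+ N - 3 ^+ N)).
have eta0 : 0 < eta.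
  apply: (mulr_gt0 k0); apply: (mulr_gt0 V0); rewrite subr_gt0.
  by rewrite ltr_pXn2r ?nnegrE ?ler0n// ltr_nat.
have eta2 : 0 < eta / 2 by rewrite divr_gt0.
(* With del < 1/4 and eps < 1/2 the domain of [main] contains the shell 3 <= |y| < 4. *)
have d4 : 0 < (4^-1 : R) by rewrite invr_gt0.
have [del dd [eps1 eps10 H]] := outer_le d4 eta2.
have /andP[d0 dl] : 0 < del < 4^-1.
  by move: dd => /andP[-> /= dd]; rewrite (lt_le_trans dd)// ge_min lexx.
have d1 : 0 < del < 1.
  by move: dd => /andP[-> /= dd]; rewrite (lt_le_trans dd)// ge_min lexx orbT.
exists del => //; exists (- (eta / 2)); first by rewrite oppr_lt0.
exists (Num.min eps1 2^-1); first by rewrite lt_min eps10 invr_gt0 ltr0n.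
move=> eps e /andP[e0]; rewrite lt_min => /andP[el eh] e1.
apply: (@le_trans _ _ (\int[mu]_y (main e del eps y)%:E + (eta / 2)%:E)%E).
  by apply: H => //; rewrite e0.
rewrite inner_kernE//.
suff M : (\int[mu]_y (main e del eps y)%:E + eta%:E <=
    \int[mu]_y (main_beta e del eps y)%:E)%E.
  rewrite [X in (_ + X%:E <= _)%E](_ : eta / 2 = eta + - (eta / 2)); last by lra.
  by rewrite EFinD addeA; exact: leeD2r.
rewrite /eta EFinM -gE -(integral_EFinZl mg g0 (ltW k0)).
have mm : measurable_fun setT (main e del eps) by rewrite /main /kern; mfun.
have m0 y : 0 <= main e del eps y.
  by rewrite /main; case: ifP => _; [exact: kern_ge0|exact: lexx].
have mkg : measurable_fun setT (fun y => k * g y).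
  by apply: measurable_funM => //; exact: measurable_cst.
have kg0 y : 0 <= k * g y := mulr_ge0 (ltW k0) (g0 y).
rewrite -(integral_EFinD mm mkg m0 kg0); apply: le_integral_EFin.
- exact: measurable_funD.
- by rewrite /main_beta /kern; mfun.
- by move=> y; exact: addr_ge0 (m0 y) (kg0 y).
move=> y; rewrite /main /main_beta /g.
have [/andP[y3 y4]|_] := boolP ((3 <= enorm y) && (enorm y < 4)); last first.
  clear m0 kg0 g0; rewrite mulr0 addr0; case: ifPn => // /andP[y1 _].
  apply: ler_peMl; first exact: kern_ge0.
  by rewrite -(powRr0 (enorm y)) ler_powR ?(ltW y1) ?(ltW beta0).
clear m0 kg0 g0.
have y1 : 1 < enorm y by apply: lt_le_trans y3; rewrite ltr1n.
have yd : enorm y - 1 <= enorm (e - y) by rewrite -e1 enormBC enorm_dist.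
have -> : [&& 1 < enorm y, del * enorm y < 1 & eps * enorm y <= enorm (e - y)].
  rewrite y1 /=; apply/andP; split; last by move: y3 y4 yd eh e0; nra.
  have d41 : del * 4 < 1 by rewrite -ltr_pdivlMr ?ltr0n// div1r.
  by move: y4 d0 d41; nra.
rewrite mulr1 -lerBrDl -[X in _ - X]mul1r -mulrBl /k /kern.
have y0 : 0 < enorm y by exact: lt_trans y1.
have b0 : 0 <= beta by exact: ltW.
rewrite ler_pM ?mulr_ge0 ?powR_ge0 ?subr_ge0 ?(ltW b3)//.
  by rewrite lerD2r ge0_ler_powR ?nnegrE ?(ltW y0)//.
rewrite ler_pM ?powR_ge0//.
  rewrite ge0_ler_powR ?nnegrE ?subr_ge0 ?(ltW p_gt1) ?(ltW t3)//.
  have T : enorm y `^ tau <= 3 `^ tau.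
    rewrite -[tau]opprK !(powRN _ (- tau)) lef_pV2 ?posrE ?powR_gt0//.
    by rewrite ge0_ler_powR ?nnegrE ?(ltW y0)// oppr_ge0 ltW.
  rewrite -normrN opprB ger0_norm ?lerD2l ?lerN2// subr_ge0.
  exact: le_trans T (ltW t3).
have dist0 : 0 < enorm (e - y) by apply: lt_le_trans yd; rewrite subr_gt0.
rewrite !powRN lef_pV2 ?posrE ?powR_gt0//.
rewrite ge0_ler_powR ?nnegrE ?(ltW dist0)//; first by rewrite addr_ge0// ltW.
apply: (le_trans (enormB _ _)); rewrite e1.
by move: y4; lra.
Qed.

End kernel.

(** * Upper bound for the truncated operator *)

Section integral_comparison.
Local Open Scope ereal_scope.
Context d (T : measurableType d) (R : realType).
Variable mu : {measure set T -> \bar R}.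

(** Both sides are suprema over the nonnegative simple functions below the integrand, so nothing has
    to be measurable; the integrand of the operator contains an arbitrary patched function. *)
Lemma ge0_le_integralT (f g : T -> \bar R) :
  (forall x, 0 <= f x) -> (forall x, f x <= g x) ->
  \int[mu]_x f x <= \int[mu]_x g x.
Proof.
move=> f0 fg; have g0 x : 0 <= g x by exact: le_trans (f0 x) (fg x).
rewrite !ge0_integralTE//; apply: le_ereal_sup => _ [h hf <-].
by exists h => // x; exact: le_trans (hf x) (fg x).
Qed.

(** The hypotheses say that the positive part of f is below g1 and its negative part above g2; the
    integral is by definition the difference of the integrals of these parts. *)
Lemma integral_le_sub (D : set T) (f : T -> \bar R) (g1 g2 : T -> R) :
  (forall x, (0 <= g1 x)%R) -> (forall x, (0 <= g2 x)%R) ->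
  (forall x, (f \_ D) x <= (g1 x)%:E) ->
  (forall x, (g2 x != 0)%R -> (f \_ D) x <= (- g2 x)%:E) ->
  \int[mu]_(x in D) f x <= \int[mu]_x (g1 x)%:E - \int[mu]_x (g2 x)%:E.
Proof.
move=> g10 g20 fg1 fg2; rewrite integral_mkcond integralE leeB//.
  apply: ge0_le_integralT => x; first exact: funepos_ge0.
  by rewrite funeposE ge_max fg1 lee_fin g10.
apply: ge0_le_integralT => x; first by rewrite lee_fin g20.
rewrite funenegE le_max; have [->|/fg2 h] := eqVneq (g2 x) 0%R.
  by rewrite lexx orbT.
by rewrite leeNr -EFinN h.
Qed.

End integral_comparison.

Section signed_power.
Context {R : realType} (p : R).
Hypothesis p_gt1 : 1 < p.

Definition signed_pow (x : R) : R := `|x| `^ (p - 2) * x.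

Lemma signed_pow_ge0E x : 0 <= x -> signed_pow x = x `^ (p - 1).
Proof.
rewrite le_eqVlt => /predU1P[<-|x0]; rewrite /signed_pow.
  by rewrite mulr0 powR0// gt_eqF// subr_gt0.
rewrite gtr0_norm// -{2}(powRr1 (ltW x0)) -powRD; last first.
  by rewrite (gt_eqF x0) implybT.
by congr (_ `^ _); lra.
Qed.

Lemma signed_powN x : signed_pow (- x) = - signed_pow x.
Proof. by rewrite /signed_pow normrN mulrN. Qed.

Lemma signed_pow_le x y : 0 <= y -> x <= y -> signed_pow x <= y `^ (p - 1).
Proof.
move=> y0 xy; have [x0|x0] := leP 0 x.
  by rewrite signed_pow_ge0E// ge0_ler_powR ?nnegrE// subr_ge0 ltW.
apply: (@le_trans _ _ 0); last exact: powR_ge0.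
by rewrite /signed_pow mulr_ge0_le0 ?powR_ge0// ltW.
Qed.

Lemma signed_pow_leN x y : 0 <= y -> x <= - y -> signed_pow x <= - y `^ (p - 1).
Proof.
move=> y0 xy; have x0 : x <= 0 by rewrite (le_trans xy)// oppr_le0.
rewrite -[x]opprK signed_powN lerN2 signed_pow_ge0E ?oppr_ge0//.
by rewrite ge0_ler_powR ?nnegrE ?oppr_ge0// ?subr_ge0 ?(ltW p_gt1)// lerNr.
Qed.

End signed_power.

Section truncated_bound.
Context {R : realType} {N : nat}.
Variables (s p tau : R).
Hypotheses (p_gt1 : 1 < p).
Local Notation mu := (@lebesgue_rV R N).
Local Notation sp := (s * p).
Implicit Types (x y : 'rV[R]_N).

Variables (x0 x1 : 'rV[R]_N).
Let r0 := enorm (x0 - x1).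
Let e := r0^-1 *: (x0 - x1).
Hypothesis r0_gt0 : 0 < r0.

Let e1 : enorm e = 1.
Proof. by rewrite /e enormZ gtr0_norm ?invr_gt0// mulVf// gt_eqF. Qed.

Let ratio_kern k y : R :=
  (k * `|(enorm (y - x1) / r0) `^ tau - 1|) `^ (p - 1) * enorm (x0 - y) `^ (- (N%:R + sp)).

Let ratio_kern_ge0 k y : 0 <= ratio_kern k y.
Proof. by rewrite mulr_ge0 ?powR_ge0. Qed.

Let rescale_dist (z : 'rV[R]_N) : enorm ((r0 *: z + x1) - x1) = r0 * enorm z.
Proof. by rewrite addrK enormZ gtr0_norm. Qed.

Let rescale_dist0 (z : 'rV[R]_N) : enorm (x0 - (r0 *: z + x1)) = r0 * enorm (e - z).
Proof.
rewrite (_ : _ - _ = r0 *: (e - z)) ?enormZ ?gtr0_norm//.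
by rewrite scalerBr /e scalerA mulfV ?gt_eqF// scale1r opprD addrA addrAC.
Qed.

Let rescale_kern k (z : 'rV[R]_N) : 0 <= k ->
  r0 ^+ N * ratio_kern k (r0 *: z + x1) =
  k `^ (p - 1) * r0 `^ (- sp) * kern p sp tau e z.
Proof.
move=> k0; rewrite /ratio_kern rescale_dist rescale_dist0 /kern.
rewrite (mulrC r0 (enorm z)) mulfK ?gt_eqF//.
rewrite (powRM _ k0 (normr_ge0 _)) (powRM _ (ltW r0_gt0) (enorm_ge0 _)).
rewrite opprD (powRD (x := r0)); last by rewrite (gt_eqF r0_gt0) implybT.
rewrite (powRN r0 N%:R) powR_mulrn ?(ltW r0_gt0)//.
have rN : r0 ^+ N != 0 by rewrite expf_neq0// gt_eqF.
set A := k `^ _; set B := `|_| `^ _; set C := r0 `^ _; set E := enorm _ `^ _.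
have G (a b c q f : R) : q != 0 -> q * (a * b * (q^-1 * c * f)) = a * c * (b * f).
  by move=> q0; field.
exact: G.
Qed.

(** Since x |-> |x|^(p-2) x is increasing, the integrand is at most the outer kernel beyond the
    sphere |y - x1| = r0 and at most minus the inner kernel in the annulus; in the small ball only
    its sign is used. The substitution y = r0 z + x1 reduces to the unit sphere and extracts r0^(-
    sp). *)
Lemma frac_plaplacian_trunc_le (psi : 'rV[R]_N -> R) (k del L eps : R) :
  0 <= k -> 0 < del < 1 -> 0 < eps ->
  (forall y, r0 < enorm (y - x1) ->
     psi x0 - psi y <= k * `|(enorm (y - x1) / r0) `^ tau - 1|) ->
  (forall y, del * r0 < enorm (y - x1) < r0 ->
     psi x0 - psi y <= - (k * `|(enorm (y - x1) / r0) `^ tau - 1|)) ->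
  (forall y, enorm (y - x1) <= r0 -> psi x0 - psi y <= 0) ->
  (\int[mu]_y (outer_kern p sp tau e eps y)%:E <=
   \int[mu]_y (inner_kern p sp tau e del eps y)%:E + L%:E)%E ->
  (frac_plaplacian_trunc s p psi x0 (r0 * eps) <=
   (k `^ (p - 1) * r0 `^ (- sp) * L)%:E)%E.
Proof.
move=> k0 /andP[del0 del1] eps0 Hout Hin H0 HL.
pose A := k `^ (p - 1) * r0 `^ (- sp).
rewrite -/A; have A0 : 0 <= A := mulr_ge0 (powR_ge0 _ _) (powR_ge0 _ _).
pose G1 y : R := if (r0 < enorm (y - x1)) && (r0 * eps <= enorm (x0 - y))
  then ratio_kern k y else 0.
pose G2 y : R := if (del * r0 < enorm (y - x1)) &&
    ((enorm (y - x1) < r0) && (r0 * eps <= enorm (x0 - y)))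
  then ratio_kern k y else 0.
have G10 y : 0 <= G1 y by rewrite /G1; case: ifP => _; [exact: ratio_kern_ge0|exact: lexx].
have G20 y : 0 <= G2 y by rewrite /G2; case: ifP => _; [exact: ratio_kern_ge0|exact: lexx].
have mG1 : measurable_fun setT G1 by rewrite /G1 /ratio_kern; mfun.
have mG2 : measurable_fun setT G2 by rewrite /G2 /ratio_kern; mfun.
have mo := measurable_outer_kern p sp tau e eps.
have mi := measurable_inner_kern p sp tau e del eps.
have o0 := outer_kern_ge0 p sp tau e eps.
have i0 := inner_kern_ge0 p sp tau e del eps.
have P1 y : r0 ^+ N * G1 (r0 *: y + x1) = A * outer_kern p sp tau e eps y.
  rewrite /G1 /outer_kern rescale_dist rescale_dist0.
  rewrite (ltr_pMr _ r0_gt0) (ler_pM2l r0_gt0).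
  case: (_ && _); first by rewrite (rescale_kern _ k0).
  by rewrite !mulr0.
have P2 y : r0 ^+ N * G2 (r0 *: y + x1) = A * inner_kern p sp tau e del eps y.
  rewrite /G2 /inner_kern rescale_dist rescale_dist0.
  rewrite (gtr_pMr _ r0_gt0) (ler_pM2l r0_gt0) (mulrC del) (ltr_pM2l r0_gt0).
  case: (_ && _); first by rewrite (rescale_kern _ k0).
  by rewrite !mulr0.
have E1 : (\int[mu]_y (G1 y)%:E = A%:E * \int[mu]_y (outer_kern p sp tau e eps y)%:E)%E.
  rewrite -(integral_EFinZl mo o0 A0) (integral_EFin_affine x1 r0_gt0 mG1 G10).
  by apply: (congr1 (integral mu setT)); apply/funext => y; rewrite P1.
have E2 : (\int[mu]_y (G2 y)%:E = A%:E * \int[mu]_y (inner_kern p sp tau e del eps y)%:E)%E.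
  rewrite -(integral_EFinZl mi i0 A0) (integral_EFin_affine x1 r0_gt0 mG2 G20).
  by apply: (congr1 (integral mu setT)); apply/funext => y; rewrite P2.
clear P1 P2 mo mi o0 i0 mG1 mG2.
apply: (@le_trans _ _ (\int[mu]_y (G1 y)%:E - \int[mu]_y (G2 y)%:E)%E).
  rewrite /frac_plaplacian_trunc.
  have J y : `|psi x0 - psi y| `^ (p - 2) * (psi x0 - psi y) / enorm (x0 - y) `^ (N%:R + sp)
      = signed_pow p (psi x0 - psi y) * enorm (x0 - y) `^ (- (N%:R + sp)).
    by rewrite powRN.
  apply: integral_le_sub => // y.
    rewrite patchE; case: ifPn => [|_]; last by rewrite lee_fin.
    rewrite inE /eball /= => /negP; rewrite -leNgt => ye.
    rewrite enormBC in ye; rewrite lee_fin J /G1 ye andbT; case: ltP => yr.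
      rewrite /ratio_kern ler_wpM2r ?powR_ge0//.
      by apply: (signed_pow_le p_gt1); [rewrite mulr_ge0|exact: Hout].
    rewrite mulr_le0_ge0 ?powR_ge0//.
    by rewrite /signed_pow mulr_ge0_le0 ?powR_ge0//; exact: H0.
  rewrite /G2; case: ifPn => [/and3P[y1 y2 y3] _|_]; last by rewrite eqxx.
  rewrite patchE ifT; last by rewrite inE /eball /= enormBC; apply/negP; rewrite -leNgt.
  rewrite lee_fin J /ratio_kern -mulNr ler_wpM2r ?powR_ge0//.
  apply: (signed_pow_leN p_gt1); first by rewrite mulr_ge0.
  by apply: Hin; rewrite y1.
rewrite E1 E2.
have : (0 <= \int[mu]_y (inner_kern p sp tau e del eps y)%:E)%E.
  by apply: integral_ge0 => y _; rewrite lee_fin inner_kern_ge0.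
have : (0 <= \int[mu]_y (outer_kern p sp tau e eps y)%:E)%E.
  by apply: integral_ge0 => y _; rewrite lee_fin outer_kern_ge0.
clear G10 G20 E1 E2; move: HL; set O := integral _ _ _; set I := integral _ _ _ => HL O0 I0.
have := A0; rewrite le_eqVlt => /predU1P[<-|A_gt0].
  by rewrite !mul0e sube0 mul0r.
move: HL I0; case: I => [i| |] HL I0 //.
  apply: (@le_trans _ _ ((A * (i + L))%:E - (A * i)%:E)%E).
    rewrite !EFinM EFinD; apply: leeB; last exact: lexx.
    by apply: lee_wpmul2l; rewrite ?lee_fin.
  by rewrite -EFinB lee_fin mulrDr addrC addKr.
(* An infinite inner integral makes the difference -oo, even against an infinite outer one: +oo -
   +oo is -oo here. *)
by rewrite mulry gtr0_sg// mul1e /= addeNy leNye.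
Qed.

End truncated_bound.

(** * Semicontinuity, compactness, and radial functions *)

(** The sublevel sets of g are nested, hence generate a proper filter on K. A cluster point of it is
    a minimizer: by semicontinuity a point with a larger value has a neighbourhood missing some
    sublevel set. *)
Lemma compact_lsc_min (T : topologicalType) (R : realType) (K : set T)
    (g : T -> R) : K !=set0 -> compact K ->
  (forall x b, K x -> b < g x -> \forall y \near x, b < g y) ->
  exists2 x0, K x0 & forall x, K x -> g x0 <= g x.
Proof.
move=> [z Kz] cK lg.
pose B x := [set y | K y /\ g y <= g x].
pose F := filter_from K B.
have FF : ProperFilter F.
  apply: filter_from_proper; last by move=> x Kx; exists x; split.
  apply: filter_from_filter; first by exists z.
  move=> x y Kx Ky; have [xy|yx] := leP (g x) (g y).
    by exists x => // w [Kw wx]; split; split => //; exact: le_trans wx xy.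
  by exists y => // w [Kw wy]; split; split => //; exact: le_trans wy (ltW yx).
have [|p [Kp clp]] := cK F FF; first by exists z => // w [].
exists p => // x Kx; rewrite leNgt; apply/negP => /(lg p _ Kp) np.
have FB : F (B x) by exists x.
by have [y [[_ yx]]] := clp _ _ FB np; rewrite /= ltNge yx.
Qed.

Section enorm_topology.
Context {R : realType} {N : nat}.
Implicit Types (a x y : 'rV[R]_N).

Lemma coord_sub_continuous a i : continuous (fun x : 'rV[R]_N => x 0 i - a 0 i).
Proof.
move=> x; apply: (@continuousB R (R : normedModType R) _ (fun y : 'rV[R]_N => y 0 i) (cst (a 0 i))); last exact: cst_continuous.
exact: coord_continuous.
Qed.

Lemma dotV_sub_continuous a : continuous (fun x => dotV (x - a) (x - a)).
Proof.
suff H (r : seq 'I_N) :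
    continuous (fun x => \sum_(i <- r) (x - a) 0 i * (x - a) 0 i) by exact: H.
elim: r => [|i r IH].
  by under eq_fun do rewrite big_nil; exact: cst_continuous.
under eq_fun do rewrite big_cons.
move=> x; apply: (@continuousD R (R : normedModType R) _
  (fun y => (y - a) 0 i * (y - a) 0 i)); last exact: IH.
have -> : (fun y : 'rV[R]_N => (y - a) 0 i * (y - a) 0 i) =
    (fun y => (y 0 i - a 0 i) * (y 0 i - a 0 i)).
  by apply/funext => y; rewrite !mxE.
apply: (@continuousM R _ (fun y : 'rV[R]_N => y 0 i - a 0 i));
  exact: coord_sub_continuous.
Qed.

Lemma enorm_sub_continuous a : continuous (fun x => enorm (x - a)).
Proof.
rewrite (_ : (fun x => _) = Num.sqrt \o (fun x => dotV (x - a) (x - a))).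
  move=> x; apply: continuous_comp; first exact: dotV_sub_continuous.
  exact: sqrt_continuous.
by apply/funext => x; rewrite /= enormE.
Qed.

Lemma near_enorm_sub_gt a x r : r < enorm (x - a) ->
  \forall y \near x, r < enorm (y - a).
Proof. by move=> rx; exact: (cvgr_gt _ (@enorm_sub_continuous a x)). Qed.

Lemma compact_annulus a (r1 r2 : R) :
  compact [set x | r1 <= enorm (x - a) <= r2].
Proof.
apply: bounded_closed_compact.
  exists (enorm a + r2); split; first exact: num_real.
  move=> M hM x /= /andP[_ xr].
  have M0 : 0 <= M.
    by rewrite (le_trans _ (ltW hM))// addr_ge0 ?enorm_ge0// (le_trans _ xr)// enorm_ge0.
  rewrite /Num.norm /= mx_normrE; apply: bigmax_le => // -[i j] _ /=.
  rewrite (ord1 i); have := coord_le_enorm (x - a) j; rewrite !mxE => xj.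
  apply: le_trans (ltW hM).
  rewrite -[x 0 j](subrK (a 0 j)); apply: (le_trans (ler_normD _ _)).
  by rewrite addrC lerD ?coord_le_enorm// (le_trans xj).
rewrite (_ : [set x | _] = (fun x => enorm (x - a)) @^-1` `[r1, r2]); last first.
  by apply/seteqP; split => x /=; rewrite in_itv.
by apply: closed_comp; [move=> x _; exact: enorm_sub_continuous|exact: itv_closed].
Qed.

End enorm_topology.

Section directional.
Context {R : realType}.

(** Restriction to the line t |-> t v + x reduces this to the chain rule in one variable, so f need
    only be derivable in the direction v. *)
Lemma is_derive_comp_dir (V : normedModType R) (f : V -> R) (G : R -> R)
    (x v : V) (df dG : R) :
  is_derive x v f df -> is_derive (f x) 1 G dG ->
  is_derive x v (G \o f) (dG * df).
Proof.
move=> [dfx dfE] HG.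
have lineE (h : V -> R) : 'D_1 (fun t : R => h (t *: v + x)) 0 = 'D_v h x.
  rewrite /derive; set g1 := fun t => t^-1 *: _; set g2 := fun t => t^-1 *: _.
  suff -> : g1 = g2 by [].
  by apply/funext => t; rewrite /g1 /g2 /= addr0 scale0r add0r [_%:A]mulr1.
have F0 : is_derive (0 : R) 1 (fun t : R => f (t *: v + x)) df.
  by split; [exact: ((derivable1P f x v).1 dfx)|rewrite lineE].
have GF : is_derive ((fun t : R => f (t *: v + x)) 0) 1 G dG.
  by rewrite scale0r add0r.
have [dGF dGFE] := @is_derive1_comp R G (fun t : R => f (t *: v + x)) 0 dG df GF F0.
split; first exact: ((derivable1P _ x v).2 dGF).
by rewrite -lineE.
Qed.

Context {N : nat}.
Implicit Types (a x v : 'rV[R]_N).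

Lemma is_derive_coord x v a i :
  is_derive x v (fun y : 'rV[R]_N => y 0 i - a 0 i) (v 0 i).
Proof.
have H : (fun h : R => h^-1 *: (((fun y : 'rV[R]_N => y 0 i - a 0 i) \o shift x) (h *: v) -
    (x 0 i - a 0 i))) @ 0^' --> v 0 i.
  apply: cvg_near_cst; near=> h; rewrite /= !mxE.
  have h0 : h != 0 by near: h; exact: nbhs_dnbhs_neq.
  by rewrite (_ : _ - _ = h * v 0 i); [rewrite [_ *: _]mulKf|ring].
split; first by apply/cvg_ex; exists (v 0 i).
exact: cvg_lim H.
Unshelve. all: by end_near. Qed.

Lemma is_derive_dotV x v a :
  is_derive x v (fun y => dotV (y - a) (y - a)) (2 * dotV v (x - a)).
Proof.
have H : (fun h : R => h^-1 *: (((fun y => dotV (y - a) (y - a)) \o shift x) (h *: v) -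
    dotV (x - a) (x - a))) @ 0^' --> 2 * dotV v (x - a).
  apply: (@cvg_trans _ ((fun h : R => 2 * dotV v (x - a) + h * dotV v v) @ 0^')).
    apply: near_eq_cvg; near=> h; rewrite /=.
    have h0 : h != 0 by near: h; exact: nbhs_dnbhs_neq.
    have E (b c : 'rV[R]_N) : dotV (b + c) (b + c) = dotV b b + 2 * dotV b c + dotV c c.
      by rewrite dotVDl !(dotVC _ (b + c)) !dotVDl (dotVC c b); ring.
    rewrite -addrA (E (h *: v)) !dotVZl !dotVZr.
    rewrite (_ : _ - _ = h * (2 * dotV v (x - a) + h * dotV v v)); last by ring.
    by rewrite [_ *: _]mulKf.
  have L : (2 * dotV v (x - a) + h * dotV v v) @[h --> (0 : R)^'] -->
      2 * dotV v (x - a) + 0 * dotV v v.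
    apply: cvgD; first exact: cvg_cst.
    by apply: cvgM; [exact: nbhs_dnbhs|exact: cvg_cst].
  by rewrite mul0r addr0 in L.
split; first by apply/cvg_ex; eexists; exact: H.
exact: cvg_lim H.
Unshelve. all: by end_near. Qed.

End directional.

Section radial.
Context {R : realType} {N : nat}.
Variables (a : 'rV[R]_N) (G G1 G2 : R -> R).
Hypotheses (dG : forall t : R, 0 < t -> is_derive t 1 G (G1 t))
  (dG1 : forall t : R, 0 < t -> is_derive t 1 G1 (G2 t))
  (cG2 : forall t : R, 0 < t -> {for t, continuous G2}).
Implicit Types (x y : 'rV[R]_N).

Let q y := dotV (y - a) (y - a).

(** With the squared distance the inner function is a polynomial, and regularity of G on t > 0
    suffices away from the centre. *)
Definition radial y : R := G (q y).

Let q_gt0 y : y != a -> 0 < q y.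
Proof.
move=> ya; rewrite lt_neqAle dotV_ge0 andbT eq_sym; apply: contra ya => /eqP.
by move=> /dotV_eq0 /eqP; rewrite subr_eq0.
Qed.

Let dotV_delta i y : dotV (delta_mx 0 i) y = y 0 i.
Proof.
rewrite /dotV (bigD1 i)//= big1 ?addr0; last first.
  by move=> j ji; rewrite mxE eqxx (negPf ji) mul0r.
by rewrite mxE !eqxx mul1r.
Qed.

Let dq x i : is_derive x (delta_mx 0 i : 'rV[R]_N) q (2 * (x 0 i - a 0 i)).
Proof.
by have := is_derive_dotV x (delta_mx 0 i) a; rewrite dotV_delta !mxE.
Qed.

Let P1 i y := G1 (q y) * (2 * (y 0 i - a 0 i)).
Let P2 i j y := G1 (q y) * (2 * (i == j)%:R) +
  2 * (y 0 i - a 0 i) * (G2 (q y) * (2 * (y 0 j - a 0 j))).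

Let radial_d1 x i : x != a -> is_derive x (delta_mx 0 i : 'rV[R]_N) radial (P1 i x).
Proof. by move=> xa; apply: is_derive_comp_dir; [exact: dq|exact/dG/q_gt0]. Qed.

Let radial_d2 x i j : x != a -> is_derive x (delta_mx 0 j : 'rV[R]_N) (P1 i) (P2 i j x).
Proof.
move=> xa.
have d1 : is_derive x (delta_mx 0 j : 'rV[R]_N) (G1 \o q) (G2 (q x) * (2 * (x 0 j - a 0 j))).
  by apply: is_derive_comp_dir; [exact: dq|exact/dG1/q_gt0].
have d2 : is_derive x (delta_mx 0 j : 'rV[R]_N)
    (fun y : 'rV[R]_N => 2 * (y 0 i - a 0 i)) (2 * (i == j)%:R).
  have := @is_derive_coord R N x (delta_mx 0 j) a i; rewrite mxE eqxx /= => h.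
  exact: (@is_deriveZ R _ _ (fun y : 'rV[R]_N => y 0 i - a 0 i) 2 x _ _ h).
exact: (@is_deriveM _ _ (G1 \o q) (fun y : 'rV[R]_N => 2 * (y 0 i - a 0 i)) x _ _ _ d1 d2).
Qed.

Let near_neq x : x != a -> \forall y \near x, y != a.
Proof.
move=> xa; have x0 : 0 < enorm (x - a).
  by rewrite lt_neqAle enorm_ge0 andbT eq_sym enorm_eq0 subr_eq0.
apply: filterS (near_enorm_sub_gt x0) => y.
by apply: contraTN => /eqP ->; rewrite subrr enorm0 ltxx.
Qed.

Let partial1 x i : x != a -> partial i radial x = P1 i x.
Proof. by move=> xa; have [_] := radial_d1 i xa. Qed.

Let near_partial1 x i : x != a -> \near x, P1 i x = partial i radial x.
Proof. by move=> xa; apply: filterS (near_neq xa) => y ya; rewrite partial1. Qed.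

(** The formula [P1] for the first derivative is established off [a] only, so the second derivative
    is transferred through equality near x. *)
Let partial2 x i j : x != a ->
  is_derive x (delta_mx 0 j : 'rV[R]_N) (partial i radial) (P2 i j x).
Proof.
by move=> xa; apply: near_eq_is_derive (near_partial1 i xa) _; exact: radial_d2.
Qed.

Let continuous_derive1 (f : R -> R) (t df : R) : is_derive t 1 f df -> {for t, continuous f}.
Proof. by case=> h _; apply/differentiable_continuous/derivable1_diffP. Qed.

Let cq : continuous q. Proof. exact: dotV_sub_continuous. Qed.

Let cG1q x : x != a -> {for x, continuous (G1 \o q)}.
Proof.
move=> xa; apply: continuous_comp; first exact: cq.
exact: continuous_derive1 (dG1 (q_gt0 xa)).
Qed.

Let cG2q x : x != a -> {for x, continuous (G2 \o q)}.
Proof. by move=> xa; apply: continuous_comp; [exact: cq|exact/cG2/q_gt0]. Qed.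

Let c2coord i : continuous (fun y : 'rV[R]_N => 2 * (y 0 i - a 0 i)).
Proof.
move=> x; apply: (@continuousM R _ (cst 2) (fun y : 'rV[R]_N => y 0 i - a 0 i)).
  exact: cst_continuous.
exact: coord_sub_continuous.
Qed.

Let cP1 x i : x != a -> {for x, continuous (P1 i)}.
Proof.
move=> xa; apply: (@continuousM R _ (G1 \o q)); first exact: cG1q.
exact: c2coord.
Qed.

Let cP2 x i j : x != a -> {for x, continuous (P2 i j)}.
Proof.
move=> xa.
apply: (@continuousD R (R : normedModType R) _ (fun y => (G1 \o q) y * (2 * (i == j)%:R))
  (fun y : 'rV[R]_N => 2 * (y 0 i - a 0 i) * ((G2 \o q) y * (2 * (y 0 j - a 0 j))))).
  apply: (@continuousM R _ (G1 \o q) (cst (2 * (i == j)%:R))); first exact: cG1q.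
  exact: cst_continuous.
apply: (@continuousM R _ (fun y : 'rV[R]_N => 2 * (y 0 i - a 0 i))); first exact: c2coord.
apply: (@continuousM R _ (G2 \o q)); first exact: cG2q.
exact: c2coord.
Qed.

Let near_continuous (f g : 'rV[R]_N -> R) x :
  (\near x, f x = g x) -> {for x, continuous f} -> {for x, continuous g}.
Proof.
move=> fg cf; rewrite /prop_for /continuous_at -(nbhs_singleton fg).
exact: cvg_trans (near_eq_cvg fg) cf.
Qed.

Lemma gradient_radial x : x != a -> gradient radial x = (2 * G1 (q x)) *: (x - a).
Proof.
move=> xa; apply/rowP => i; rewrite !mxE partial1// /P1; ring.
Qed.

Lemma C2_radial (D : set 'rV[R]_N) : (forall x, D x -> x != a) -> C2 D radial.
Proof.
move=> Da x /Da xa; split.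
- apply: (@continuous_comp _ _ _ q G); first exact: cq.
  exact: continuous_derive1 (dG (q_gt0 xa)).
- move=> i; split; first by case: (radial_d1 i xa).
  by apply: (near_continuous (near_partial1 i xa)); exact: cP1.
- move=> i j; split; first by case: (partial2 i j xa).
  have n2 : \near x, P2 i j x = partial j (partial i radial) x.
    by apply: filterS (near_neq xa) => y ya; have [_ <-] := partial2 i j ya.
  by apply: (near_continuous n2); exact: cP2.
Qed.

End radial.

(** * Touching from below *)

Section touching.
Context {R : realType} {N : nat}.
Variables (s p t m : R).
Implicit Types (v phi : 'rV[R]_N -> R) (x y : 'rV[R]_N).

(* What is left of the supersolution property when only test functions with
   nonzero gradient are used; unlike the original it passes to v - inf v. *)
Definition touching_inequality v := forall x0 (r : R) phi (B : R),
  0 < r -> C2 (eball x0 r) phi -> phi x0 = v x0 ->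
  (forall x, eball x0 r x -> phi x <= v x) -> gradient phi x0 != 0 ->
  (\forall e \near 0^'+,
     (frac_plaplacian_trunc s p (patch v (eball x0 r) phi) x0 e <= B%:E)%E) ->
  v x0 `^ t * enorm (gradient phi x0) `^ m <= B.

Lemma derivable_addr phi (c : R) x w :
  derivable phi x w -> derivable (fun y => phi y + c) x w.
Proof. by move=> H; apply: derivableD => //; exact: derivable_cst. Qed.

Lemma derive_addr phi (c : R) x w :
  'D_w (fun y => phi y + c) x = 'D_w phi x.
Proof.
rewrite /derive.
set g1 := fun h => h^-1 *: _; set g2 := fun h => h^-1 *: _.
suff -> : g1 = g2 by [].
by apply/funext => h; rewrite /g1 /g2 /= opprD addrACA subrr addr0.
Qed.

Lemma gradient_addr phi (c : R) : gradient (fun y => phi y + c) = gradient phi.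
Proof.
by apply/funext => x; apply/rowP => i; rewrite !mxE /partial derive_addr.
Qed.

Lemma C2_addr D phi (c : R) : C2 D phi -> C2 D (fun y => phi y + c).
Proof.
have P i : partial i (fun y => phi y + c) = partial i phi.
  by apply/funext => x; exact: derive_addr.
move=> H x /H[H0 H1 H2]; split.
- apply: (@continuousD R (R : normedModType R) _ phi (cst c)) => //.
  exact: cst_continuous.
- by move=> i; rewrite P; have [h1 h2] := H1 i; split => //; exact: derivable_addr.
- by move=> i j; rewrite P; exact: H2.
Qed.

(** Adding c to the test function makes it touch u, and the truncated integrals see only
    differences. The right-hand side can only drop, as (u - c)^t <= u^t for t >= 0; the principal
    value inherits the bound B from the truncations. *)
Lemma viscosity_touching (u : 'rV[R]_N -> R) (c : R) : 0 <= t -> 0 <= c ->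
  (forall x, c <= u x) ->
  viscosity_supersolution s p setT (fun _ (z : R) g => z `^ t * enorm g `^ m) u ->
  touching_inequality (fun x => u x - c).
Proof.
move=> t0 c0 cu [_ visc _] x0 r phi B r0 C2phi phix0 phile gphi HB.
have [|||||l] := visc x0 r (fun y => phi y + c) r0.
- by [].
- exact: C2_addr.
- by rewrite phix0 subrK.
- by move=> x /phile; rewrite lerBrDr.
- by left; right; rewrite gradient_addr.
rewrite gradient_addr phix0 subrK => lim fl; rewrite -lee_fin.
apply: (@le_trans _ _ (u x0 `^ t * enorm (gradient phi x0) `^ m)%:E).
  rewrite lee_fin ler_wpM2r ?powR_ge0// ge0_ler_powR ?nnegrE ?subr_ge0//.
    exact: le_trans c0 (cu x0).
  by rewrite gerBl.
apply: (le_trans fl); rewrite -(cvg_lim _ lim)//; apply: lime_le.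
  by apply/cvg_ex; exists l.
apply: filterS HB => e; congr (_ <= _)%E.
rewrite /frac_plaplacian_trunc.
suff E y : patch u (eball x0 r) (fun y => phi y + c) y =
    patch (fun x => u x - c) (eball x0 r) phi y + c.
  apply: eq_integral => y _; rewrite !E.
  have D (b d : R) : b + c - (d + c) = b - d by lra.
  by rewrite D.
by rewrite /patch; case: ifP => // _; rewrite subrK.
Qed.

End touching.

Lemma powRN_le (R : realType) (a b g : R) : 0 < a -> a <= b -> 0 <= g ->
  b `^ (- g) <= a `^ (- g).
Proof.
move=> a0 ab g0; have b0 : 0 < b by exact: lt_le_trans ab.
rewrite !powRN lef_pV2 ?posrE ?powR_gt0//.
by rewrite ge0_ler_powR ?nnegrE// ltW.
Qed.

Lemma powR_sqr_half (R : realType) (x g : R) : 0 <= x ->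
  (x ^+ 2) `^ (g / 2) = x `^ g.
Proof.
move=> x0; rewrite -powR_mulrn// -powRrM; congr (_ `^ _).
by rewrite mulrC divfK.
Qed.

Definition lsc_real (T : topologicalType) (R : realType) (v : T -> R) :=
  forall x b, b < v x -> \forall y \near x, b < v y.

Lemma lsc_gt_continuous (T : topologicalType) (R : realType) (v h : T -> R) x :
  lsc_real v -> {for x, continuous h} -> h x < v x -> \forall y \near x, h y < v y.
Proof.
move=> lv ch hv; pose b := (h x + v x) / 2.
have [hb bv] : h x < b /\ b < v x by rewrite /b; split; lra.
have n1 : \forall y \near x, h y < b by exact: (cvgr_lt _ ch).
have n2 := lv x b bv.
by near do apply: lt_trans (_ : _ < b) _.
Unshelve. all: by end_near. Qed.

Lemma nbhs_eball (R : realType) N (x : 'rV[R]_N) (P : 'rV[R]_N -> Prop) :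
  (\forall y \near x, P y) ->
  exists2 r, 0 < r & forall y, enorm (y - x) < r -> P y.
Proof.
move=> /nbhs_ballP[r r0 H]; exists r => // y yr; apply: H.
split => // i j; rewrite (ord1 i) /ball /= distrC.
have := coord_le_enorm (y - x) j; rewrite !mxE => h.
exact: le_lt_trans h yr.
Qed.

Section lower_barrier.
Context {R : realType} {N : nat}.
Variables (s p t m gam : R).
Hypotheses (N_gt0 : (0 < N)%N) (p_gt1 : 1 < p) (sp_gt0 : 0 < s * p)
  (sp_ltp : s * p < p) (gam_gt0 : 0 < gam)
  (gam_gt : 0 < s * p - N%:R + gam * (p - 1)).
Variable v : 'rV[R]_N -> R.
Hypotheses (v_ge0 : forall x, 0 <= v x) (v_lsc : lsc_real v)
  (v_touch : touching_inequality s p t m v).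

Lemma lower_barrier x1 : 0 < v x1 -> exists2 c : R, 0 < c &
  forall x, Num.min c (c * enorm (x - x1) `^ (- gam)) <= v x.
Proof.
have ar1 (a b e f : R) : a <= b -> b < e -> 0 < f -> a - f <= e by lra.
have ar2 (a b e f : R) : a - b <= e - f -> f - (b - a) <= e by lra.
have ar3 (a b e f : R) : a <= b -> 0 <= e -> b < f -> a - f <= e by lra.
have ar4 (a b e f : R) : a - b <= e - f -> e < f -> (f - e) / 2 < b - a by lra.
have ar5 (a b e f : R) : a - b <= e -> b < a - f -> f < e by lra.
have ar6 (a b e f : R) : a - b <= e -> f - b - e <= f - a by lra.
have ar7 (a b e f : R) : a - b <= e -> f <= a -> f - b - e <= 0 by lra.
have ar8 (a b e f : R) : a <= e -> f <= a -> 0 < b -> f - b - e <= 0 by lra.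
move=> vx1.
have [r r0 Hr] : exists2 r, 0 < r & forall y, enorm (y - x1) < r -> v x1 / 2 < v y.
  by apply: nbhs_eball; apply: v_lsc; rewrite ltr_pdivrMr// ltr_pMr// ltr1n.
pose c := v x1 / 2; have c0 : 0 < c by rewrite divr_gt0.
have gam' : - gam < 0 by rewrite oppr_lt0.
have [del /andP[d0 d1] [L L0 [eps0 eps00 HL]]] : exists2 del : R, 0 < del < 1 & exists2 L : R, L < 0 &
    exists2 eps0 : R, 0 < eps0 & forall (eps : R) (e : 'rV[R]_N), 0 < eps < eps0 -> enorm e = 1 ->
    (\int[@lebesgue_rV R N]_y (outer_kern p (s * p) (- gam) e eps y)%:E <=
     \int[@lebesgue_rV R N]_y (inner_kern p (s * p) (- gam) e del eps y)%:E + L%:E)%E.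
  apply: outer_kern_lt => //.
  - by rewrite (le_trans (ltW gam')).
  - by rewrite (lt_trans _ sp_gt0)// nmulr_rlt0// subr_gt0.
  - by rewrite mulNr opprK.
(* The contact radius will be at least r, so the annulus |y - x1| > del |x0 - x1| of the kernel
   estimate stays beyond [rho]. [A] makes W equal to c at radius [rho]. *)
pose rho := del * r; have rho0 : 0 < rho by rewrite mulr_gt0.
have rhor : rho < r by rewrite /rho gtr_pMl.
pose A := c * rho `^ gam; have A0 : 0 < A by rewrite mulr_gt0// powR_gt0.
pose W x := A * enorm (x - x1) `^ (- gam).
have W_le x y : 0 < enorm (x - x1) -> enorm (x - x1) <= enorm (y - x1) -> W y <= W x.
  by move=> h1 h2; apply: (ler_wpM2l (ltW A0)); exact: powRN_le h1 h2 (ltW gam_gt0).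
have W_lec x : rho <= enorm (x - x1) -> W x <= c.
  move=> h; rewrite /W /A -mulrA ler_piMr ?(ltW c0)//.
  have x0 : 0 < enorm (x - x1) by exact: lt_le_trans h.
  rewrite powRN ler_pdivrMr ?powR_gt0// mul1r ge0_ler_powR ?nnegrE ?enorm_ge0//;
  by rewrite ltW.
suff claim x : r <= enorm (x - x1) -> W x <= v x.
  pose c' := Num.min c A.
  have c'0 : 0 < c' by rewrite lt_min c0.
  exists c' => // x; have [xr|xr] := ltP (enorm (x - x1)) r.
    rewrite ge_min; apply/orP; left; apply: le_trans (ltW (Hr _ xr)).
    by rewrite ge_min lexx.
  rewrite ge_min; apply/orP; right; apply: le_trans (claim _ xr).
  by rewrite /W ler_wpM2r ?powR_ge0// ge_min lexx orbT.
move=> xsr; rewrite leNgt; apply/negP => vxs; rename x into xs.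
(* Half of the excess at [xs]: beyond [R2] the barrier is at most [ep], less than the maximal excess
   d, so W - d <= 0 <= v there. *)
pose ep := (W xs - v xs) / 2.
have ep0 : 0 < ep by rewrite divr_gt0// subr_gt0.
pose R2 := Num.max (enorm (xs - x1)) ((A / ep) `^ (gam^-1)).
have R2W y : R2 < enorm (y - x1) -> W y <= ep.
  move=> hy; have h2 : (A / ep) `^ (gam^-1) < enorm (y - x1).
    by apply: le_lt_trans hy; rewrite le_max lexx orbT.
  have h0 : 0 < A / ep by rewrite divr_gt0.
  have y0 : 0 < enorm (y - x1) by apply: lt_trans h2; rewrite powR_gt0.
  have h3 : A / ep <= enorm (y - x1) `^ gam.
    rewrite -[A / ep](powRr1 (ltW h0)) -(mulVf (lt0r_neq0 gam_gt0)) powRrM.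
    by rewrite ge0_ler_powR ?nnegrE ?powR_ge0 ?enorm_ge0// ltW.
  by rewrite /W powRN (ler_pdivrMr _ _ (powR_gt0 gam y0)) mulrC -(ler_pdivrMr _ _ ep0).
have [x0 [/andP[x0r x0R2] x0min]] : exists x0, r <= enorm (x0 - x1) <= R2 /\
    forall x, r <= enorm (x - x1) <= R2 -> v x0 - W x0 <= v x - W x.
  have := @compact_lsc_min _ R [set x | r <= enorm (x - x1) <= R2] (fun x => v x - W x).
  case.
  - by exists xs; rewrite /= xsr le_max lexx.
  - exact: compact_annulus.
  - move=> x b /= /andP[xr _] bx.
    have x0 : 0 < enorm (x - x1) by exact: lt_le_trans xr.
    have : \forall y \near x, b + W y < v y.
      apply: lsc_gt_continuous => //; last by rewrite -ltrBrDr.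
      apply: (@continuousD R (R : normedModType R) _ (cst b) W); first exact: cst_continuous.
      apply: (@continuousM R _ (cst A) (fun y : 'rV[R]_N => enorm (y - x1) `^ (- gam))).
        exact: cst_continuous.
      apply: (@continuous_comp _ _ _ (fun y : 'rV[R]_N => enorm (y - x1)) (@powR R ^~ (- gam))).
        exact: enorm_sub_continuous.
      have [h _] := is_derive1_powR (- gam) x0.
      exact/differentiable_continuous/derivable1_diffP.
    by apply: filterS => y; rewrite ltrBrDr.
  - by move=> x0 K0 H; exists x0.
pose d := W x0 - v x0.
have dep : ep < d.
  apply: ar4 vxs; apply: x0min.
  by rewrite xsr le_max lexx.
have d_gt0 : 0 < d by exact: lt_trans dep.
have phi_le y : rho < enorm (y - x1) -> W y - d <= v y.
  move=> hy; have [yr|yr] := ltP (enorm (y - x1)) r.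
    have h1 := W_lec _ (ltW hy); have h2 := Hr _ yr; rewrite -/c in h2.
    exact: ar1 h1 h2 d_gt0.
  have [yR|yR] := leP (enorm (y - x1)) R2.
    by apply: ar2; apply: x0min; rewrite yr yR.
  exact: ar3 (R2W _ yR) (v_ge0 y) dep.
(* The test ball must stay beyond radius [rho], since W - d is unbounded near x1. *)
pose r' := enorm (x0 - x1) - rho.
have rho_x0 : rho < enorm (x0 - x1) by exact: lt_le_trans rhor x0r.
have r'0 : 0 < r' by rewrite subr_gt0.
have ball_rho y : eball x0 r' y -> rho < enorm (y - x1).
  rewrite /eball /r' /= => h.
  have := enorm_dist (x0 - x1) (x0 - y).
  rewrite (_ : x0 - x1 - (x0 - y) = y - x1); last first.
    by rewrite opprB addrC addrA subrK.
  by rewrite enormBC in h => h'; exact: ar5 h' h.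
have x01 : x0 != x1.
  by apply: contraTN rho_x0 => /eqP ->; rewrite subrr enorm0 -leNgt ltW.
pose G (z : R) := A * z `^ (- gam / 2) - d.
pose G1 (z : R) := A * ((- gam / 2) * z `^ (- gam / 2 - 1)).
pose G2 (z : R) := A * ((- gam / 2) * ((- gam / 2 - 1) * z `^ (- gam / 2 - 1 - 1))).
have dG (z : R) : 0 < z -> is_derive z 1 G (G1 z).
  move=> z0; have h := is_derive1_powR (- gam / 2) z0.
  have h1 := @is_deriveZ R _ _ (@powR R ^~ (- gam / 2)) A z 1 _ h.
  have h2 := @is_deriveD R _ _ _ (cst (- d)) z 1 _ _ h1 (is_derive_cst (- d) z 1).
  by rewrite addr0 in h2.
have dG1 (z : R) : 0 < z -> is_derive z 1 G1 (G2 z).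
  move=> z0; have h := is_derive1_powR (- gam / 2 - 1) z0.
  have h1 := @is_deriveZ R _ _ (@powR R ^~ (- gam / 2 - 1)) (- gam / 2) z 1 _ h.
  exact: (@is_deriveZ R _ _ _ A z 1 _ h1).
have cG2 (z : R) : 0 < z -> {for z, continuous G2}.
  move=> z0; have h := is_derive1_powR (- gam / 2 - 1 - 1) z0.
  have h1 := @is_deriveZ R _ _ (@powR R ^~ (- gam / 2 - 1 - 1)) (- gam / 2 - 1) z 1 _ h.
  have h2 := @is_deriveZ R _ _ _ (- gam / 2) z 1 _ h1.
  have [h3 _] := @is_deriveZ R _ _ _ A z 1 _ h2.
  exact/differentiable_continuous/derivable1_diffP.
have radE y : radial x1 G y = W y - d.
  by rewrite /radial /G -sqr_enorm powR_sqr_half ?enorm_ge0.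
have grad0 : gradient (radial x1 G) x0 != 0.
  rewrite (gradient_radial dG x01) scaler_eq0 subr_eq0 (negPf x01) orbF.
  have q0 : 0 < dotV (x0 - x1) (x0 - x1).
    by rewrite -sqr_enorm exprn_gt0// (lt_trans rho0).
  apply: mulf_neq0; first by rewrite pnatr_eq0.
  apply: mulf_neq0; first exact: lt0r_neq0 A0.
  apply: mulf_neq0; last exact: lt0r_neq0 (powR_gt0 _ q0).
  apply: mulf_neq0; first by rewrite oppr_eq0; exact: lt0r_neq0 gam_gt0.
  by rewrite invr_eq0 pnatr_eq0.
have W0 : 0 < W x0 by rewrite mulr_gt0// powR_gt0// (lt_trans rho0).
have r00 : 0 < enorm (x0 - x1) by rewrite (lt_trans rho0).
have Wratio y : W x0 - W y = - W x0 * ((enorm (y - x1) / enorm (x0 - x1)) `^ (- gam) - 1).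
  rewrite powRM ?enorm_ge0 ?invr_ge0 ?enorm_ge0// /W.
  rewrite -powR_inv1 ?enorm_ge0// powRAC powR_inv1 ?powR_ge0//.
  have : enorm (x0 - x1) `^ (- gam) != 0 by rewrite gt_eqF// powR_gt0.
  move: (enorm (y - x1) `^ _) (enorm (x0 - x1) `^ _) => b c1 c10.
  have K (a : R) : a * c1 - a * b = - (a * c1) * (b / c1 - 1) by field.
  exact: K.
pose psi := patch v (eball x0 r') (radial x1 G).
have psi0 : psi x0 = v x0.
  rewrite /psi /patch radE mem_set; first by rewrite /d opprB addrC subrK.
  by rewrite /eball /= subrr enorm0.
have psi_ge y : rho < enorm (y - x1) -> W y - d <= psi y.
  move=> hy; rewrite /psi /patch radE; case: ifP => _; last exact: phi_le.
  exact: lexx.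
have psi_c y : enorm (y - x1) <= rho -> c <= psi y.
  move=> hy; rewrite /psi /patch memNset; last by move=> /ball_rho; rewrite ltNge hy.
  by apply/ltW/Hr; exact: le_lt_trans hy rhor.
have vx0 : v x0 = W x0 - d by rewrite /d opprB addrC subrK.
have ratio_gt0 y : 0 < enorm (y - x1) -> 0 < enorm (y - x1) / enorm (x0 - x1).
  by move=> y0; rewrite divr_gt0.
have one : 1 `^ (- gam) = 1 :> R by rewrite powR1.
have Hneg : (W x0) `^ (p - 1) * enorm (x0 - x1) `^ (- (s * p)) * L < 0.
  by rewrite (pmulr_rlt0 _ (mulr_gt0 (powR_gt0 _ W0) (powR_gt0 _ r00))).
have Hpos : 0 <= v x0 `^ t * enorm (gradient (radial x1 G) x0) `^ m.
  exact: mulr_ge0 (powR_ge0 _ _) (powR_ge0 _ _).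
have : v x0 `^ t * enorm (gradient (radial x1 G) x0) `^ m <=
    (W x0) `^ (p - 1) * enorm (x0 - x1) `^ (- (s * p)) * L; last first.
  by move=> /(le_trans Hpos); rewrite leNgt Hneg.
apply: (v_touch r'0) => //.
- apply: (C2_radial dG dG1 cG2) => y /ball_rho hy.
  by apply: contraTN hy => /eqP ->; rewrite subrr enorm0 -leNgt ltW.
- by rewrite radE vx0.
- by move=> y /ball_rho /phi_le; rewrite radE.
near=> e.
have e0 : 0 < e by near: e; exact: nbhs_right_gt.
have el : e < enorm (x0 - x1) * eps0.
  by near: e; apply: nbhs_right_lt; rewrite mulr_gt0.
rewrite (_ : e = enorm (x0 - x1) * (e / enorm (x0 - x1))); last first.
  by rewrite mulrC divfK// gt_eqF.
have ee : 0 < e / enorm (x0 - x1) < eps0.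
  by rewrite divr_gt0//= ltr_pdivrMr// mulrC.
apply: (@frac_plaplacian_trunc_le R N s p (- gam) p_gt1 x0 x1 r00 _ _ del).
- exact: ltW W0.
- by rewrite d0.
- by case/andP: ee.
- move=> y hy; rewrite -/psi psi0 vx0.
  have y0 : 0 < enorm (y - x1) by exact: lt_trans hy.
  have hpsi := ar6 _ _ _ (W x0) (psi_ge y (lt_trans rho_x0 hy)).
  have : `|(enorm (y - x1) / enorm (x0 - x1)) `^ (- gam) - 1| =
      - ((enorm (y - x1) / enorm (x0 - x1)) `^ (- gam) - 1).
    apply: ler0_norm; rewrite subr_le0 -[X in _ <= X]one.
    apply: powRN_le ltr01 _ (ltW gam_gt0).
    by rewrite (ler_pdivlMr _ _ r00) mul1r ltW.
  by move=> ->; rewrite mulrN -mulNr -Wratio.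
- move=> y /andP[h1 h2]; rewrite -/psi psi0 vx0.
  have rhoy : rho < enorm (y - x1).
    by apply: le_lt_trans h1; rewrite /rho ler_pM2l.
  have y0 : 0 < enorm (y - x1) by exact: lt_trans rhoy.
  have hpsi := ar6 _ _ _ (W x0) (psi_ge y rhoy).
  have : `|(enorm (y - x1) / enorm (x0 - x1)) `^ (- gam) - 1| =
      (enorm (y - x1) / enorm (x0 - x1)) `^ (- gam) - 1.
    apply: ger0_norm; rewrite subr_ge0 -[X in X <= _]one.
    apply: powRN_le (ratio_gt0 _ y0) _ (ltW gam_gt0).
    by rewrite (ler_pdivrMr _ _ r00) mul1r ltW.
  by move=> ->; rewrite -mulNr -Wratio.
- move=> y hy; rewrite -/psi psi0 vx0; have [h|h] := ltP rho (enorm (y - x1)).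
    exact: ar7 (psi_ge y h) (W_le y x0 (lt_trans rho0 h) hy).
  exact: ar8 (psi_c y h) (W_lec _ (ltW rho_x0)) d_gt0.
apply: HL; first exact: ee.
by rewrite enormZ gtr0_norm ?invr_gt0// mulVf// lt0r_neq0.
Unshelve. all: by end_near. Qed.

End lower_barrier.

(** * Slow exponential profiles *)

Lemma ln_le_powR (R : realType) (x eta : R) : 0 < eta -> 0 < x ->
  ln x <= eta^-1 * x `^ eta.
Proof.
move=> eta0 x0; rewrite ler_pdivlMl// -ln_powR.
have y0 : 0 < x `^ eta by rewrite powR_gt0.
have := expR_ge1Dx (ln (x `^ eta)); rewrite lnK ?posrE//.
by move: (x `^ eta) (ln _) => a b; lra.
Qed.

(** With n = p - 1 - m and Q = max(0, t - n), dividing by u^t (u X)^m r^(- sp) leaves kap^m r^(sp -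
    m) <= |L| u^(n - t) X^n. Insert X <= - ln u <= u^(- eta) / eta and 1 / u <= r^gam / c: then
    r^(sp - m) <= C r^(gam (Q + eta n)), which fails for large r once eta is small. Since 1 / u >=
    1, the exponent t - n may be raised to Q. *)
Lemma no_large_radius (R : realType) (p sp t m gam kap c L : R) :
  1 < p -> 0 <= t -> 0 <= m -> m <= p - 1 -> 0 < gam -> 0 < kap -> 0 < c ->
  gam * Num.max 0 (t - (p - 1 - m)) < sp - m ->
  exists2 R1, 1 <= R1 & forall r u X, R1 <= r -> c * r `^ (- gam) <= u ->
    0 < u -> u <= 1 -> 0 < X -> X <= - ln u ->
    u `^ t * (u * X * kap / r) `^ m <= (u * X) `^ (p - 1) * r `^ (- sp) * L -> False.
Proof.
move=> p1 t0 m0 mp gam0 kap0 c0; set n := p - 1 - m; set Q := Num.max 0 _ => hQ.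
have n0 : 0 <= n by rewrite subr_ge0.
have Q0 : 0 <= Q by rewrite le_max lexx.
have Qt : t - n <= Q by rewrite le_max lexx orbT.
have den0 : 0 < 2 * (gam * n + 1) by rewrite mulr_gt0// ltr_wpDl// mulr_ge0// ltW.
(* Makes gam eta n less than half of the gap sp - m - gam Q, so that [th > 0]; the + 1 covers n =
   0. *)
pose eta := (sp - m - gam * Q) / (2 * (gam * n + 1)).
have num0 : 0 < sp - m - gam * Q by rewrite subr_gt0.
have eta0 : 0 < eta by rewrite divr_gt0.
pose th := sp - m - gam * (Q + eta * n).
have th0 : 0 < th.
  rewrite /th; have : eta * (2 * (gam * n + 1)) = sp - m - gam * Q.
    by rewrite /eta divfK// gt_eqF.
  move: num0 n0 gam0 eta0; nra.
pose C := `|L| * eta^-1 `^ n * c `^ (- (Q + eta * n)) / kap `^ m.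
have C0 : 0 <= C.
  by rewrite divr_ge0 ?powR_ge0// !mulr_ge0 ?powR_ge0.
exists (Num.max 1 ((C + 1) `^ th^-1)); first by rewrite le_max lexx.
move=> r u X; rewrite ge_max => /andP[r1 rC] cu u0 u1 X0 Xu.
have r0 : 0 < r by exact: lt_le_trans r1.
have v0 : 0 < u^-1 by rewrite invr_gt0.
have v1 : 1 <= u^-1 by rewrite invf_ge1.
have Xle : X <= eta^-1 * u^-1 `^ eta.
  by apply: (le_trans Xu); rewrite -lnV ?posrE// ln_le_powR.
have Xn : X `^ n <= eta^-1 `^ n * u^-1 `^ (eta * n).
  rewrite powRrM -powRM ?powR_ge0 ?invr_ge0 ?(ltW eta0)//.
  by rewrite ge0_ler_powR ?nnegrE ?(ltW X0)// mulr_ge0 ?powR_ge0// invr_ge0 ltW.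
move=> H.
have uX0 : 0 < u * X by rewrite mulr_gt0.
have H1 : kap `^ m * r `^ (sp - m) <= `|L| * (u^-1 `^ (t - n) * X `^ n).
  have E1 : (u * X) `^ (p - 1) = (u * X) `^ m * (u `^ n * X `^ n).
    rewrite -powRM ?ltW// -powRD; last by rewrite (gt_eqF uX0) implybT.
    by congr (_ `^ _); rewrite /n; ring.
  have E2 : (u * X * kap / r) `^ m = (u * X) `^ m * (kap `^ m * r `^ (- m)).
    rewrite !powRM ?invr_ge0 ?mulr_ge0 ?ltW// -!mulrA; do 3!congr (_ * _).
    by rewrite -powR_inv1 ?ltW// powRAC powR_inv1 ?powR_ge0// powRN.
  rewrite E1 E2 in H.
  have E3 : u^-1 `^ (t - n) = u `^ n * u `^ (- t).
    rewrite -powR_inv1 ?ltW// -powRrM -powRD; last by rewrite (gt_eqF u0) implybT.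
    by congr (_ `^ _); ring.
  have ut : u `^ t * u `^ (- t) = 1.
    by rewrite powRN mulfV// gt_eqF// powR_gt0.
  have rs : r `^ (sp - m) = r `^ (- m) * r `^ sp.
    by rewrite -powRD; [rewrite addrC|rewrite (gt_eqF r0) implybT].
  have rss : r `^ (- sp) * r `^ sp = 1.
    by rewrite powRN mulVf// gt_eqF// powR_gt0.
  rewrite E3 rs.
  have A0 : 0 < (u * X) `^ m by rewrite powR_gt0.
  have B0 : 0 < u `^ (- t) by rewrite powR_gt0.
  have D0 : 0 < r `^ sp by rewrite powR_gt0.
  have un0 : 0 <= u `^ n := powR_ge0 _ _.
  have Xn0 : 0 <= X `^ n := powR_ge0 _ _.
  move: H A0 B0 D0 ut rss un0 Xn0.
  move: (u `^ t) ((u * X) `^ m) (kap `^ m) (r `^ (- m)) (u `^ n) (X `^ n)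
    (r `^ (- sp)) (r `^ sp) (u `^ (- t)) => a1 a2 a3 a4 a5 a6 a7 a8 a9.
  move=> H A0 B0 D0 ut rss a50 a60.
  have H' : a3 * a4 * (a1 * a2) <= a5 * a6 * a7 * L * a2.
    by apply: le_trans (_ : a1 * (a2 * (a3 * a4)) <= _);
      [rewrite le_eqVlt; apply/orP; left; apply/eqP; ring|apply: (le_trans H); rewrite le_eqVlt; apply/orP; left; apply/eqP; ring].
  rewrite mulrA ler_pM2r// in H'.
  have : a3 * a4 * a1 * (a8 * a9) <= a5 * a6 * a7 * L * (a8 * a9).
    by rewrite ler_wpM2r// mulr_ge0// ltW.
  rewrite (_ : a3 * a4 * a1 * (a8 * a9) = a3 * (a4 * a8) * (a1 * a9)); last by ring.
  rewrite (_ : a5 * a6 * a7 * L * (a8 * a9) = (a7 * a8) * (L * (a5 * a9 * a6))); last by ring.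
  rewrite ut rss mulr1 mul1r => /le_trans; apply.
  by rewrite ler_wpM2r ?ler_norm// !mulr_ge0// ltW.
have H2 : u^-1 `^ (t - n) * X `^ n <= eta^-1 `^ n * u^-1 `^ (Q + eta * n).
  rewrite [X in _ <= _ * X]powRD; last by rewrite (gt_eqF v0) implybT.
  rewrite mulrCA ler_pM ?powR_ge0//.
  by rewrite ler_powR.
have ucr : u^-1 <= c^-1 * r `^ gam.
  rewrite -[c^-1 * _]invrK invfM invrK -powRN lef_pV2 ?posrE// mulr_gt0// powR_gt0//.
have H3 : u^-1 `^ (Q + eta * n) <= c `^ (- (Q + eta * n)) * r `^ (gam * (Q + eta * n)).
  have e0 : 0 <= Q + eta * n by rewrite addr_ge0// mulr_ge0// ltW.
  apply: (@le_trans _ _ ((c^-1 * r `^ gam) `^ (Q + eta * n))).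
    by rewrite ge0_ler_powR ?nnegrE ?(ltW v0)// mulr_ge0 ?powR_ge0// invr_ge0 ltW.
  rewrite powRM ?powR_ge0 ?invr_ge0 ?(ltW c0)// powRrM -(powR_inv1 (ltW c0)).
  by rewrite powRAC powR_inv1 ?powR_ge0// -powRN.
have H4 : kap `^ m * r `^ (sp - m) <= kap `^ m * C * r `^ (gam * (Q + eta * n)).
  apply: (le_trans H1).
  apply: (@le_trans _ _ (`|L| * (eta^-1 `^ n * (c `^ (- (Q + eta * n)) * r `^ (gam * (Q + eta * n)))))).
    apply: (ler_wpM2l (normr_ge0 _)); apply: (le_trans H2).
    exact: (ler_wpM2l (powR_ge0 _ _)).
  have k0 : kap `^ m != 0 by rewrite gt_eqF// powR_gt0.
  rewrite /C le_eqVlt; apply/orP; left; apply/eqP.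
  move: (eta^-1 `^ n) (c `^ _) (r `^ _) (kap `^ m) k0 `|L| => b1 b2 b3 b4 b40 b5.
  by field.
have H5 : r `^ th <= C.
  rewrite /th; have rg0 : 0 < r `^ (gam * (Q + eta * n)) by rewrite powR_gt0.
  have k0 : 0 < kap `^ m by rewrite powR_gt0.
  move: H4; rewrite -mulrA ler_pM2l// => H4.
  rewrite powRD; last by rewrite (gt_eqF r0) implybT.
  by rewrite (powRN r (gam * _)) ler_pdivrMr.
have H6 : C + 1 <= r `^ th.
  have C1 : 0 <= C + 1 by rewrite addr_ge0.
  have -> : C + 1 = ((C + 1) `^ th^-1) `^ th.
    by rewrite -powRrM mulVf ?lt0r_neq0// powRr1.
  by rewrite ge0_ler_powR ?nnegrE ?powR_ge0 ?(ltW th0) ?(ltW r0).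
by move: (le_trans H6 H5); rewrite -[X in _ <= X]addr0 lerD2l ler10.
Qed.

Lemma is_derive_expR_comp (R : realType) (b : R -> R) (z b1 : R) :
  is_derive z 1 b b1 -> is_derive z 1 (expR \o b) (b1 * expR (b z)).
Proof.
by move=> db; have := is_derive1_comp (is_derive_expR (b z)) db; rewrite mulrC.
Qed.

Section no_decay.
Context {R : realType} {N : nat}.
Variables (s p t m gam c : R).
Hypotheses (N_gt0 : (0 < N)%N) (p_gt1 : 1 < p) (sp_gt0 : 0 < s * p)
  (sp_ltp : s * p < p) (t_ge0 : 0 <= t) (m_ge0 : 0 <= m) (m_le : m <= p - 1)
  (gam_gt0 : 0 < gam) (gam_lt : gam * Num.max 0 (t - (p - 1 - m)) < s * p - m)
  (c_gt0 : 0 < c).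
Variables (v : 'rV[R]_N -> R) (x1 : 'rV[R]_N).
Hypotheses (v_gt0 : forall x, 0 < v x) (v_lsc : lsc_real v)
  (v_touch : touching_inequality s p t m v)
  (v_low : forall x, 1 <= enorm (x - x1) -> c * enorm (x - x1) `^ (- gam) <= v x).

Section profile.
Variables (a kap : R).
Hypotheses (a_gt0 : 0 < a) (kap_gt0 : 0 < kap).

Let dist x := enorm (x - x1).

(** The parameter w whose profile a exp (w |y - x1|^kap) passes through the graph of v at x. For x
    <> x1 a profile lies below v at x exactly when its parameter is at most [rate x]. *)
Let rate x := ln (v x / a) / dist x `^ kap.

Let rate_gt b x : 0 < dist x -> (b < rate x) = (a * expR (b * dist x `^ kap) < v x).
Proof.
move=> x0; rewrite /rate ltr_pdivlMr ?powR_gt0// -[LHS]ltr_expR lnK ?posrE ?divr_gt0//.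
by rewrite ltr_pdivlMr// mulrC.
Qed.

Let rate_ge b x : 0 < dist x -> (b <= rate x) = (a * expR (b * dist x `^ kap) <= v x).
Proof.
move=> x0; rewrite /rate ler_pdivlMr ?powR_gt0// -[LHS]ler_expR lnK ?posrE ?divr_gt0//.
by rewrite ler_pdivlMr// mulrC.
Qed.

(* [w] is the minimum of ln (v x / a) / |x - x1|^kap over |x - x1| >= R1; the
   polynomial lower bound on [v] keeps the minimizer in a bounded region. *)
Lemma exponential_contact R1 : a <= 1 -> 1 <= R1 ->
  (forall x, dist x <= R1 -> a <= v x) -> (exists x, v x < a) ->
  exists x0 w, [/\ R1 <= dist x0, w < 0, a * expR (w * dist x0 `^ kap) = v x0 &
    forall x, a * expR (w * dist x `^ kap) <= v x].
Proof.
have ar0 (r : R) : r < 0 -> 0 < - r by rewrite oppr_gt0.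
have ar (P l r lc k n g : R) : l <= k * P -> 1 <= P -> n + g * k <= - r * P ->
    - lc <= n -> 0 <= n -> 0 < g -> r * (P * P) <= lc + - g * l.
  move=> h2 h3 h4 h5 h6 g0.
  have e1 : (n + g * k) * P <= - r * P * P by rewrite ler_wpM2r//; lra.
  have e2 : g * l <= g * (k * P) by rewrite ler_wpM2l// ltW.
  have e3 : n <= n * P by rewrite ler_peMr.
  by lra.
move=> a1 R11 aball [ys vys].
have dys : R1 < dist ys by rewrite ltNge; apply/negP => /aball; rewrite leNgt vys.
have dys0 : 0 < dist ys by rewrite (lt_trans _ dys)// (lt_le_trans ltr01).
have rys : rate ys < 0.
  rewrite /rate pmulr_llt0 ?invr_gt0 ?powR_gt0// ln_lt0//.
  by rewrite divr_gt0//= ltr_pdivrMr// mul1r.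
(* Chosen so that |ln c| + gam ln |x - x1| <= D |x - x1|^(kap/2) for |x - x1| >= 1. Beyond [R2] this
   is at most - rate ys |x - x1|^kap, so the polynomial lower bound on v forces rate ys <= rate
   x. *)
pose D := `|ln c| + gam * (kap / 2)^-1.
have k20 : 0 < kap / 2 by rewrite divr_gt0.
have D0 : 0 <= D by rewrite addr_ge0// mulr_ge0 ?invr_ge0 ?ltW.
pose R2 := Num.max (dist ys) ((D / - rate ys) `^ (kap / 2)^-1).
have [x0 /andP[x0R1 x0R2] x0min] : exists2 x0, R1 <= dist x0 <= R2 &
    forall x, R1 <= dist x <= R2 -> rate x0 <= rate x.
  apply: (@compact_lsc_min _ R [set x | R1 <= dist x <= R2] rate).
  - by exists ys; rewrite /= (ltW dys) le_max lexx.
  - exact: compact_annulus.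
  - move=> x b /= /andP[xR1 _] bx.
    have x0 : 0 < dist x by rewrite (lt_le_trans ltr01)// (le_trans R11).
    have n1 : \forall y \near x, 0 < dist y by exact: near_enorm_sub_gt.
    have n2 : \forall y \near x, a * expR (b * dist y `^ kap) < v y.
      apply: lsc_gt_continuous => //; last by rewrite -rate_gt.
      apply: (@continuousM R _ (cst a) (fun y => expR (b * dist y `^ kap))).
        exact: cst_continuous.
      apply: (@continuous_comp _ _ _ (fun y => b * dist y `^ kap) expR); last first.
        exact: continuous_expR.
      apply: (@continuousM R _ (cst b) (fun y => dist y `^ kap)).
        exact: cst_continuous.
      apply: (@continuous_comp _ _ _ dist (@powR R ^~ kap)).
        exact: enorm_sub_continuous.
      have [h _] := is_derive1_powR kap x0.
      exact/differentiable_continuous/derivable1_diffP.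
    by apply: filterS2 n1 n2 => y y0; rewrite rate_gt.
have w_ys : rate x0 <= rate ys by apply: x0min; rewrite (ltW dys) le_max lexx.
have w0 : rate x0 < 0 by exact: le_lt_trans rys.
have dx0 : 0 < dist x0 by rewrite (lt_le_trans ltr01)// (le_trans R11).
exists x0, (rate x0); split => //.
  rewrite /rate divfK ?gt_eqF ?powR_gt0// lnK ?posrE ?divr_gt0//.
  by rewrite mulrC divfK// gt_eqF.
move=> x; have [xR1|xR1] := leP (dist x) R1.
  apply: le_trans (aball _ xR1); rewrite (ler_piMr (ltW a_gt0))// -expR0 ler_expR.
  exact: mulr_le0_ge0 (ltW w0) (powR_ge0 _ _).
have dx1 : 1 < dist x by exact: le_lt_trans xR1.
have dx : 0 < dist x by exact: lt_trans dx1.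
rewrite -(rate_ge _ dx); have [xR2|xR2] := leP (dist x) R2.
  by apply: x0min; rewrite (ltW xR1).
apply: (le_trans w_ys); rewrite [X in _ <= X]/rate ler_pdivlMr ?powR_gt0//.
have h1 : ln (c * dist x `^ (- gam)) <= ln (v x / a).
  have cd : 0 < c * dist x `^ (- gam) by rewrite mulr_gt0// powR_gt0.
  rewrite ler_ln ?posrE ?divr_gt0//; apply: (le_trans (v_low (ltW dx1))).
  by rewrite ler_pdivlMr// ler_piMr// ltW.
apply: le_trans h1; rewrite lnM ?posrE ?powR_gt0// ln_powR.
have h2 := ln_le_powR k20 dx.
have h3 : 1 <= dist x `^ (kap / 2).
  have one : 1 `^ (kap / 2) = 1 :> R by rewrite powR1.
  rewrite -[X in X <= _]one.
  by rewrite ge0_ler_powR ?nnegrE ?(ltW dx) ?(ltW k20) ?(ltW dx1).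
have h4 : D <= - rate ys * dist x `^ (kap / 2).
  have nr := ar0 _ rys.
  have q0 : 0 <= D / - rate ys := divr_ge0 D0 (ltW nr).
  rewrite mulrC -(ler_pdivrMr _ _ nr).
  have -> : D / - rate ys = (D / - rate ys) `^ (kap / 2)^-1 `^ (kap / 2).
    by rewrite -powRrM mulVf ?lt0r_neq0// powRr1.
  rewrite ge0_ler_powR ?nnegrE ?powR_ge0 ?(ltW k20) ?(ltW dx)//.
  by apply: le_trans (ltW xR2); rewrite le_max lexx orbT.
have -> : dist x `^ kap = dist x `^ (kap / 2) * dist x `^ (kap / 2).
  by rewrite -powRD ?(gt_eqF dx) ?implybT// -splitr.
have h5 := ler_norm (- ln c); rewrite normrN in h5.
have h6 := normr_ge0 (ln c).
exact: ar h2 h3 h4 h5 h6 gam_gt0.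
Qed.

End profile.

(** At the contact point v has logarithmic slope X kap / r0 and the operator is at most (v X)^(p-1)
    r0^(- sp) L. The sign of [L] does not matter here: [no_large_radius] excludes such a contact
    once r0 >= R1. *)
Lemma no_decay : ~ forall b, 0 < b -> exists x, v x < b.
Proof.
have ar1 (a b : R) : 0 < a -> 0 < b -> a / (a + b) <= 1.
  by move=> a0 b0; rewrite ler_pdivrMr ?addr_gt0// mul1r lerDl ltW.
have ar2 (a b : R) : 0 < a -> 0 < b -> a / (a + b) * b < a.
  move=> a0 b0; rewrite mulrAC ltr_pdivrMr ?addr_gt0//.
  by rewrite ltr_pM2l// ltrDr.
have ar3 (a w E f P Q : R) : 1 + w * (Q - P) <= E -> 0 < a -> f = a * E ->
    a - f <= - (a * w * (Q - P)).
  move=> h a0 ->; have : a * (1 + w * (Q - P)) <= a * E by rewrite ler_pM2l.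
  by lra.
have ar5 (w P Q : R) : w * P + w * (Q - P) = w * Q by ring.
have ar4 (a X z : R) : a * X * z <= - (a * X * - z) by lra.
move=> vinf.
have p10 : 0 < p - 1 by rewrite subr_gt0.
(* A choice with kap <= 1, for the linear bound on the kernel, and kap (p - 1) < sp, for its
   integrability at infinity. *)
pose kap := s * p / (s * p + (p - 1)).
have kap0 : 0 < kap := divr_gt0 sp_gt0 (addr_gt0 sp_gt0 p10).
have kap1 : kap <= 1 := ar1 _ _ sp_gt0 p10.
have kapp : kap * (p - 1) < s * p := ar2 _ _ sp_gt0 p10.
have [del /andP[d0 d1] [L [eps0 eps00 HL]]] : exists2 del : R, 0 < del < 1 &
    exists L : R, exists2 eps0 : R, 0 < eps0 &
    forall (eps : R) (e : 'rV[R]_N), 0 < eps < eps0 -> enorm e = 1 ->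
    (\int[@lebesgue_rV R N]_y (outer_kern p (s * p) kap e eps y)%:E <=
     \int[@lebesgue_rV R N]_y (inner_kern p (s * p) kap e del eps y)%:E + L%:E)%E.
  exact: outer_kern_le.
have [R1 R11 HR1] := no_large_radius L p_gt1 t_ge0 m_ge0 m_le gam_gt0 kap0 c_gt0 gam_lt.
have R10 : 0 < R1 by exact: lt_le_trans R11.
have [xm _ xmin] : exists2 xm, [set x | 0 <= enorm (x - x1) <= R1] xm &
    forall x, [set x | 0 <= enorm (x - x1) <= R1] x -> v xm <= v x.
  apply: (@compact_lsc_min _ R).
  - by exists x1; rewrite /= subrr enorm0 lexx ltW.
  - exact: compact_annulus.
  - by move=> x b _ bx; exact: v_lsc.
(* As v >= a up to radius [R1], contact can be arranged at radius at least [R1]; a <= 1 will give X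
   <= - ln (v x0). *)
pose a := Num.min 1 (v xm).
have a0 : 0 < a by rewrite lt_min ltr01 v_gt0.
have a1 : a <= 1 by rewrite ge_min lexx.
have aball x : enorm (x - x1) <= R1 -> a <= v x.
  move=> h; rewrite ge_min; apply/orP; right; apply: xmin.
  by rewrite /= enorm_ge0.
have [x0 [w [x0R1 w0 vx0 phile]]] := exponential_contact a0 kap0 a1 R11 aball (vinf a a0).
have r00 : 0 < enorm (x0 - x1) by exact: lt_le_trans x0R1.
have x01 : x0 != x1.
  by apply: contraTN r00 => /eqP ->; rewrite subrr enorm0 ltxx.
pose b (z : R) := w * z `^ (kap / 2).
pose b1 (z : R) := w * ((kap / 2) * z `^ (kap / 2 - 1)).
pose b2 (z : R) := w * ((kap / 2) * ((kap / 2 - 1) * z `^ (kap / 2 - 1 - 1))).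
have db (z : R) : 0 < z -> is_derive z 1 b (b1 z).
  move=> z0; have h := is_derive1_powR (kap / 2) z0.
  exact: (@is_deriveZ R _ _ (@powR R ^~ (kap / 2)) w z 1 _ h).
have db1 (z : R) : 0 < z -> is_derive z 1 b1 (b2 z).
  move=> z0; have h := is_derive1_powR (kap / 2 - 1) z0.
  have h1 := @is_deriveZ R _ _ (@powR R ^~ (kap / 2 - 1)) (kap / 2) z 1 _ h.
  exact: (@is_deriveZ R _ _ _ w z 1 _ h1).
have cb2 (z : R) : 0 < z -> {for z, continuous b2}.
  move=> z0; have h := is_derive1_powR (kap / 2 - 1 - 1) z0.
  have h1 := @is_deriveZ R _ _ (@powR R ^~ (kap / 2 - 1 - 1)) (kap / 2 - 1) z 1 _ h.
  have h2 := @is_deriveZ R _ _ _ (kap / 2) z 1 _ h1.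
  have [h3 _] := @is_deriveZ R _ _ _ w z 1 _ h2.
  exact/differentiable_continuous/derivable1_diffP.
pose G (z : R) := a * expR (b z).
pose G1 (z : R) := a * (b1 z * expR (b z)).
pose G2 (z : R) := a * (b1 z * (b1 z * expR (b z)) + expR (b z) * b2 z).
have dG (z : R) : 0 < z -> is_derive z 1 G (G1 z).
  move=> z0; have h := is_derive_expR_comp (db z z0).
  exact: (@is_deriveZ R _ _ _ a z 1 _ h).
have dG1 (z : R) : 0 < z -> is_derive z 1 G1 (G2 z).
  move=> z0; have h := is_derive_expR_comp (db z z0).
  have h1 := @is_deriveM R _ _ _ z 1 _ _ (db1 z z0) h.
  exact: (@is_deriveZ R _ _ _ a z 1 _ h1).
have cG2 (z : R) : 0 < z -> {for z, continuous G2}.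
  move=> z0.
  have cb1 : {for z, continuous b1}.
    by have [h _] := db1 z z0; exact/differentiable_continuous/derivable1_diffP.
  have cE : {for z, continuous (expR \o b)}.
    have [h _] := is_derive_expR_comp (db z z0).
    exact/differentiable_continuous/derivable1_diffP.
  apply: (@continuousM R _ (cst a)); first exact: cst_continuous.
  apply: (@continuousD R (R : normedModType R) _ (fun z => b1 z * (b1 z * expR (b z)))
    (fun z => expR (b z) * b2 z)).
    by apply: (@continuousM R _ b1) => //; apply: (@continuousM R _ b1 (expR \o b)).
  by apply: (@continuousM R _ (expR \o b) b2) => //; exact: cb2.
have radE y : radial x1 G y = a * expR (w * enorm (y - x1) `^ kap).
  by rewrite /radial /G /b -sqr_enorm powR_sqr_half ?enorm_ge0.
set r0 := enorm (x0 - x1) in r00 x0R1 vx0.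
(* Equal to ln (a / v x0), because the profile takes the value v x0 at the contact point. *)
pose X := - (w * r0 `^ kap).
have X0 : 0 < X by rewrite oppr_gt0 nmulr_rlt0// powR_gt0.
have gradE : gradient (radial x1 G) x0 = (- (v x0 * X * kap / r0 ^+ 2)) *: (x0 - x1).
  rewrite (gradient_radial dG x01); congr (_ *: _).
  rewrite -sqr_enorm -/r0 /G1 /b1 /b powR_sqr_half ?(ltW r00)// -vx0 /X.
  have -> : (r0 ^+ 2) `^ (kap / 2 - 1) = r0 `^ kap / r0 ^+ 2.
    have q0 : 0 < r0 ^+ 2 by rewrite exprn_gt0.
    rewrite powRD; last by rewrite (gt_eqF q0) implybT.
    by rewrite powR_sqr_half ?(ltW r00)// powR_inv1// ltW.
  have r0n : r0 != 0 by rewrite gt_eqF.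
  move: (r0 `^ kap) (expR _) => P E.
  have K (r P' E' : R) : r != 0 -> 2 * (a * (w * (kap / 2 * (P' / r ^+ 2)) * E')) =
      - (a * E' * - (w * P') * kap / r ^+ 2) by move=> rn; field.
  exact: K.
have gradN : enorm (gradient (radial x1 G) x0) = v x0 * X * kap / r0.
  rewrite gradE enormZ normrN ger0_norm; last first.
    apply: divr_ge0 (exprn_ge0 2 (ltW r00)).
    exact: mulr_ge0 (mulr_ge0 (ltW (v_gt0 x0)) (ltW X0)) (ltW kap0).
  rewrite -/r0; have r0n : r0 != 0 by rewrite gt_eqF.
  have K (A r : R) : r != 0 -> A / r ^+ 2 * r = A / r by move=> rn; field.
  exact: K.
have vx0a : v x0 <= a.
  rewrite -vx0 ler_piMr ?(ltW a0)// -[X in _ <= X]expR0 ler_expR.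
  by rewrite mulr_le0_ge0 ?powR_ge0// ltW.
apply: (HR1 r0 (v x0) X) => //.
- by apply: v_low; exact: le_trans x0R1.
- exact: le_trans a1.
- rewrite -vx0 lnM ?posrE ?expR_gt0// expRK opprD /X lerDr oppr_ge0.
  exact: ln_le0.
(* The test ball has radius |x0 - x1| and so omits x1, where the profile is not smooth. *)
rewrite -gradN; apply: (v_touch r00).
- apply: (C2_radial dG dG1 cG2) => y.
  rewrite /eball /= => h; apply: contraTN h => /eqP ->.
  by rewrite enormBC -/r0 ltxx.
- by rewrite radE.
- by move=> y _; rewrite radE; exact: phile.
- rewrite -enorm_eq0 gradN gt_eqF//; apply: divr_gt0 r00.
  exact: mulr_gt0 (mulr_gt0 (v_gt0 x0) X0) kap0.
pose psi := patch v (eball x0 r0) (radial x1 G).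
have psi0 : psi x0 = v x0.
  rewrite /psi /patch radE mem_set; first exact: vx0.
  by rewrite /eball /= subrr enorm0.
have psi_ge y : a * expR (w * enorm (y - x1) `^ kap) <= psi y.
  by rewrite /psi /patch radE; case: ifP => _; [exact: lexx|exact: phile].
(* The tangent-line inequality exp z >= 1 + z at the contact point replaces the exponential profile
   by the power profile, with k = v x0 X; it holds for all y because the profile lies below v
   globally. *)
have key y : psi x0 - psi y <= v x0 * X * ((enorm (y - x1) / r0) `^ kap - 1).
  apply: (@le_trans _ _ (v x0 - a * expR (w * enorm (y - x1) `^ kap))).
    by rewrite psi0 lerD2l lerN2; exact: psi_ge.
  have E1 : a * expR (w * enorm (y - x1) `^ kap) =
      v x0 * expR (w * (enorm (y - x1) `^ kap - r0 `^ kap)).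
    rewrite -vx0 -mulrA; congr (a * _).
    by rewrite -expRD (ar5 w).
  have P0 : r0 `^ kap != 0 by rewrite gt_eqF// powR_gt0.
  have h := ar3 _ _ _ _ _ _ (expR_ge1Dx _) (v_gt0 x0) E1.
  apply: (le_trans h); rewrite /X.
  have -> : (enorm (y - x1) / r0) `^ kap = enorm (y - x1) `^ kap / r0 `^ kap.
    rewrite powRM ?enorm_ge0 ?invr_ge0 ?(ltW r00)//.
    by rewrite -powR_inv1 ?(ltW r00)// powRAC powR_inv1 ?powR_ge0.
  rewrite le_eqVlt; apply/orP; left; apply/eqP.
  move: (enorm (y - x1) `^ kap) (r0 `^ kap) P0 (v x0) => Q P P0 V.
  have K (w' : R) : - (V * w' * (Q - P)) = V * - (w' * P) * (Q / P - 1) by field.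
  exact: K.
have one : 1 `^ kap = 1 :> R by rewrite powR1.
have uX0 : 0 <= v x0 * X by rewrite mulr_ge0 ?(ltW X0)// ltW.
have ratio_ge0 y : 0 <= enorm (y - x1) / r0.
  by rewrite divr_ge0 ?enorm_ge0// ltW.
have ratio_le1 y : enorm (y - x1) <= r0 -> (enorm (y - x1) / r0) `^ kap - 1 <= 0.
  move=> h; rewrite subr_le0 -[X in _ <= X]one.
  rewrite ge0_ler_powR ?nnegrE ?(ltW kap0)// ler_pdivrMr//.
  by rewrite mul1r.
near=> e.
have e0 : 0 < e by near: e; exact: nbhs_right_gt.
have el : e < r0 * eps0.
  by near: e; apply: nbhs_right_lt; rewrite mulr_gt0.
rewrite (_ : e = r0 * (e / r0)); last first.
  by rewrite mulrC divfK// gt_eqF.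
have ee : 0 < e / r0 < eps0.
  by rewrite divr_gt0//= ltr_pdivrMr// mulrC.
apply: (@frac_plaplacian_trunc_le R N s p kap p_gt1 x0 x1 r00 _ _ del).
- exact: uX0.
- by rewrite d0.
- by case/andP: ee.
- move=> y hy; apply: (le_trans (key y)); apply: ler_wpM2l; [exact: uX0|].
  exact: ler_norm.
- move=> y /andP[_ h2]; apply: (le_trans (key y)).
  rewrite (ler0_norm (ratio_le1 _ (ltW h2))); exact: ar4.
- move=> y hy; apply: (le_trans (key y)).
  by apply: mulr_ge0_le0; [exact: uX0|exact: ratio_le1].
apply: HL; first exact: ee.
by rewrite enormZ gtr0_norm ?invr_gt0// mulVf// lt0r_neq0.
Unshelve. all: by end_near. Qed.

End no_decay.

(** * The Liouville theorem *)

(** At the critical g = (N - a) / (p - 1), the inequality g (t + m - p + 1) < a - m multiplied by p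
    - 1 is exactly the subcriticality hypothesis. Both alternatives on m give m <= p - 1 and m < a,
    the latter settling the case where the maximum is 0. As the inequality is strict, g may be
    raised slightly. *)
Lemma admissible_barrier_exponent (R : realType) (N a p t m : R) :
  0 < a -> 1 < p -> a < N ->
  (a / (p - 1) > 1 -> m <= p - 1) -> (a / (p - 1) <= 1 -> m < a) ->
  t * (N - a) + m * (N - (a - p + 1)) < N * (p - 1) ->
  m <= p - 1 /\ exists gam, [/\ 0 < gam, 0 < a - N + gam * (p - 1) &
    gam * Num.max 0 (t - (p - 1 - m)) < a - m].
Proof.
move=> a0 p1 aN hm1 hm2 hsub; have q0 : 0 < p - 1 by rewrite subr_gt0.
have [mq ma] : m <= p - 1 /\ m < a.
  have [h|h] := leP (a / (p - 1)) 1.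
    have ma := hm2 h; split=> //; move: h; rewrite ler_pdivrMr// mul1r => h.
    exact/ltW/(lt_le_trans ma).
  have mq := hm1 h; split=> //; move: h; rewrite ltr_pdivlMr// mul1r => h.
  exact: le_lt_trans h.
split => //; set M := Num.max _ _.
have M0 : 0 <= M by rewrite le_max lexx.
pose g := (N - a) / (p - 1).
have gq : g * (p - 1) = N - a by rewrite /g divfK// gt_eqF.
have g0 : 0 < g by rewrite divr_gt0// subr_gt0.
have gM : g * M < a - m.
  rewrite /M; have [h|h] := leP (t - (p - 1 - m)) 0.
    by rewrite mulr0 subr_gt0.
  rewrite -(ltr_pM2r q0) mulrAC gq; move: hsub; lra.
(* With this increment, (g + d) M = a - m - d, still below a - m. *)
pose d := (a - m - g * M) / (M + 1).
have M1 : 0 < M + 1 by rewrite ltr_wpDl.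
have d0 : 0 < d by rewrite divr_gt0// subr_gt0.
have dM : d * (M + 1) = a - m - g * M by rewrite /d divfK// gt_eqF.
exists (g + d); split; first exact: addr_gt0.
  by rewrite mulrDl gq addrA addrC -addrA; have := mulr_gt0 d0 q0; lra.
by rewrite mulrDl; move: dM d0; lra.
Qed.

Lemma lsc_real_subspaceT (T : topologicalType) (R : realType) (u : T -> R) (c : R) :
  lower_semicontinuous ((fun x => (u x)%:E) : subspace (closure setT) -> \bar R) ->
  lsc_real (fun x => u x - c).
Proof.
rewrite closureT => lu x b; rewrite ltrBrDr => bu.
have [V Vx HV] := lu x (b + c) bu.
have : nbhs (x : T) V by move: Vx; rewrite nbhs_subspaceT.
by apply: filterS => y /HV; rewrite lte_fin ltrBrDr.
Qed.

Theorem theorem1p1 (R : realType) (N : nat) (s p t m : R)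
    (hN : (2 <= N)%N) (hs0 : 0 < s) (hs1 : s < 1) (hp : 1 < p)
    (ht : 0 <= t) (hm : 0 <= m)
    (hm1 : s * p / (p - 1) > 1 -> m <= p - 1)
    (hm2 : s * p / (p - 1) <= 1 -> m < s * p)
    (hNsp : s * p < N%:R)
    (hsub : t * (N%:R - s * p) + m * (N%:R - (s * p - p + 1))
            < N%:R * (p - 1))
    (u : 'rV[R]_N -> R) (hu0 : forall x, 0 <= u x)
    (hu : viscosity_supersolution s p [set: 'rV[R]_N]
            (fun _ v g => v `^ t * enorm g `^ m) u) :
  exists c : R, forall x, u x = c.

Proof.
have N0 : (0 < N)%N by exact: leq_trans hN.
have sp0 : 0 < s * p by rewrite mulr_gt0// (lt_trans ltr01).
have spp : s * p < p by rewrite gtr_pMl// (lt_trans ltr01).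
have [mp [gam [gam0 gamN gamM]]] := admissible_barrier_exponent sp0 hp hNsp hm1 hm2 hsub.
have ui : has_inf (range u).
  by split; [exists (u 0), 0 | exists 0 => _ [y _ <-]].
pose i0 := inf (range u).
have i00 : 0 <= i0 by apply: lb_le_inf => [|_ [x _ <-]//]; exists (u 0), 0.
have i0u x : i0 <= u x by apply: ge_inf; [exists 0 => _ [y _ <-]|exists x].
pose v x := u x - i0.
have v_ge0 x : 0 <= v x by rewrite subr_ge0.
have v_lsc : lsc_real v by case: hu => [lu _ _]; exact: lsc_real_subspaceT lu.
have v_touch : touching_inequality s p t m v := viscosity_touching ht i00 i0u hu.
have vinf b : 0 < b -> exists x, v x < b.
  move=> b0; have [_ [x _ <-] xb] := inf_adherent b0 ui.
  by exists x; rewrite ltrBlDl.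
exists i0 => x1; apply/eqP; rewrite -subr_eq0 eq_le v_ge0 andbT leNgt.
apply/negP => vx1.
have [c c0 vlow] := lower_barrier N0 hp sp0 spp gam0 gamN v_ge0 v_lsc v_touch vx1.
apply: (no_decay N0 hp sp0 spp ht hm mp gam0 gamM c0 (v := v) (x1 := x1)) => //.
- move=> x; have [->//|xx1] := eqVneq x x1.
  apply: lt_le_trans (vlow x); rewrite lt_min c0 mulr_gt0// powR_gt0//.
  by rewrite lt_neqAle enorm_ge0 eq_sym enorm_eq0 subr_eq0 xx1.
- move=> x x1x; apply: le_trans (vlow x); rewrite le_min lexx andbT.
  rewrite ler_piMr ?(ltW c0)//.
  have one : 1 `^ (- gam) = 1 :> R by rewrite powR1.
  by rewrite -[X in _ <= X]one; apply: powRN_le ltr01 _ (ltW gam0).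
Qed.
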